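(* Let $n=p+q$, $G=SL(n,\mathbb R)$, $1\le i\le n-1$, let $b$ be a non-degenerate symmetric bilinear form of signature $(p,q)$ on $\mathbb R^{n}$ and $H=SO(p,q)\subset G$ the subgroup preserving $b$. Let $0\le r\le p$, $0\le s\le q$ with $r+s\le i$, and put $\nu:=i-r-s$, $\hat r:=p-r-\nu$, $\hat s:=q-s-\nu$. Consider the $H$-orbit $\mathcal O:=\mathcal O_{(r,s)}\subset Gr(i,\mathbb R^{p+q})$ of $i$-dimensional subspaces on which $b$ restricts to a form of signature $(r,s)$. Let $IGr(\nu,\mathbb R^{(p,q)})$ be the Grassmannian of $\nu$-dimensional subspaces of $\mathbb R^n$ that are isotropic for $b$. Then: (1) The orbit $\mathcal O$ is non-empty if and only if $\nu\le\min(p,q)$, and in that case its codimension in $Gr(i,\mathbb R^{p+q})$ is $\nu(\nu+1)/2$. (2) There is an $H$-equivariant surjective submersion $\mathcal O\to IGr(\nu,\mathbb R^{(p,q)})$ whose fibers are isomorphic to the symmetric space $SO(p-\nu,q-\nu)/S(O(r,s)\times O(\hat r,\hat s))$. (3) Let $P\subset G$ be the stabilizer of $\mathbb R^i\subset\mathbb R^n$, so $G/P=Gr(i,\mathbb R^n)$, and replace $H$ by a conjugate subgroup $H_{\mathcal O}\subset G$ such that the $H_{\mathcal O}$-orbit of the base point $eP$ is isomorphic to $\mathcal O$. Then there is a natural quotient homomorphism $H_{\mathcal O}\cap P\to GL(\nu,\mathbb R)\times S(O(r,s)\times O(\hat r,\hat s))$. Thus the representation $S^2\mathbb R^{\nu*}$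 of $GL(\nu,\mathbb R)$ gives rise to a representation of $H_{\mathcal O}\cap P$, which is isomorphic to $(\mathfrak g/\mathfrak p)/(\mathfrak h_{\mathcal O}/(\mathfrak h_{\mathcal O}\cap\mathfrak p))$.
   Context: A symmetric bilinear form on a real vector space has signature $(r,s)$ if $r$ and $s$ are the maximal dimensions of positive definite and negative definite subspaces; its rank is $r+s$. $\mathcal O_{(r,s)}$ is the set of all $i$-dimensional $W\subset\mathbb R^n$ for which $b|_{W\times W}$ has signature $(r,s)$. $SO(p,q)$ denotes all elements of determinant $1$ in $O(p,q)$, and $S(O(r,s)\times O(\hat r,\hat s))$ the pairs with product of determinants equal to $1$. Concretely, $H_{\mathcal O}$ is the special orthogonal group of a bilinear form of signature $(p,q)$ on $\mathbb R^n$ whose restriction to $\mathbb R^i$ has signature $(r,s)$. $\mathfrak g,\mathfrak p,\mathfrak h_{\mathcal O}$ are the Lie algebras of $G,P,H_{\mathcal O}$; the group $H_{\mathcal O}\cap P$ acts on $\mathfrak g/\mathfrak p$ and on $\mathfrak h_{\mathcal O}/(\mathfrak h_{\mathcal O}\cap\mathfrak p)\hookrightarrow\mathfrak g/\mathfrak p$ via the adjoint action, hence on the quotient. A quotient homomorphism is a surjective homomorphism.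
   Formalization: In (1) the criterion for O non-empty is ν ≤ min(p,q) together with r̂ ≥ 0 and ŝ ≥ 0; the printed one fails for p=q=2, i=3, (r,s)=(2,0), where ν=1 but O is empty. Accordingly (2) and (3) are stated for non-empty O. *)

(* Defs.v *)
From HB Require Import structures.
From mathcomp Require Import all_boot all_order all_algebra.
From mathcomp Require Import all_classical all_reals all_analysis.

Set Implicit Arguments.
Unset Strict Implicit.
Unset Printing Implicit Defensive.

Import Order.TTheory GRing.Theory Num.Theory.
Import numFieldNormedType.Exports.

Local Open Scope classical_set_scope.
Local Open Scope ring_scope.

(** * Smooth maps between open subsets of vector spaces *)

Fixpoint Ck_on (R : realType) (V W : normedModType R) (k : nat)
    (U : set V) (f : V -> W) : Prop :=
  if k is k'.+1 then
    (forall x, U x -> differentiable f x) /\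
    (forall v, Ck_on k' U (fun x => 'd f x v))
  else forall x, U x -> {for x, continuous f}.

Definition smooth_on (R : realType) (V W : normedModType R)
  (U : set V) (f : V -> W) : Prop := forall k, Ck_on k U f.

(** * Smooth structures

  A smooth structure is recorded by its smooth parametrizations ("plots"),
  i.e. the smooth maps into it from open subsets of the spaces R^d.  For a
  manifold this datum is equivalent to the maximal atlas: a map of manifolds
  is smooth iff composition with it preserves plots, and the charts of the
  maximal atlas are exactly the diffeomorphisms [is_chart] below.  An embedded
  submanifold has as plots the plots of the ambient manifold with values in
  it, and the quotient of a manifold by a surjective submersion has as plots
  the maps that lift locally to plots upstairs. *)

Record smooth_space (R : realType) := SmoothSpace {
  pt :> Type;
  carrier : set pt;
  plot : forall d : nat, set 'rV[R]_d -> ('rV[R]_d -> pt) -> Prop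
}.
Arguments carrier {R} s.
Arguments plot {R} s {d}.

Section SmoothSpaces.
Variable R : realType.

Definition mx_space (m n : nat) : smooth_space R :=
  @SmoothSpace R 'M[R]_(m, n) setT (fun d U f => open U /\ smooth_on U f).

Definition sub_space (X : smooth_space R) (S : set X) : smooth_space R :=
  @SmoothSpace R X (carrier X `&` S)
    (fun d U f => plot X U f /\ (forall x, U x -> S (f x))).
Arguments sub_space : clear implicits.

Definition quot_space (X : smooth_space R) (Q : Type) (pi : X -> Q)
    : smooth_space R :=
  @SmoothSpace R Q (pi @` carrier X)
    (fun d U f => open U /\
       forall x, U x -> exists V (g : 'rV[R]_d -> X),
         [/\ V x, V `<=` U, plot X V g & forall y, V y -> f y = pi (g y)]).

Definition smooth_map (X Y : smooth_space R) (f : X -> Y) : Prop :=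
  (forall x, carrier X x -> carrier Y (f x)) /\
  (forall d (U : set 'rV[R]_d) (c : 'rV[R]_d -> X),
     plot X U c -> plot Y U (f \o c)).
Arguments smooth_map : clear implicits.

(* [g] is the inverse of [f] *)
Definition diffeo (X Y : smooth_space R) (f : X -> Y) (g : Y -> X) : Prop :=
  [/\ smooth_map X Y f, smooth_map Y X g,
      forall x, carrier X x -> g (f x) = x
    & forall y, carrier Y y -> f (g y) = y].
Arguments diffeo : clear implicits.

Definition smooth_open (X : smooth_space R) (D : set X) : Prop :=
  D `<=` carrier X /\
  (forall d (U : set 'rV[R]_d) (c : 'rV[R]_d -> X),
     plot X U c -> open (U `&` c @^-1` D)).
Arguments smooth_open : clear implicits.

(* [kappa] is a chart with domain [D]; [phi] is its inverse. *)
Definition is_chart (X : smooth_space R) (d : nat) (D : set X)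
    (kappa : X -> 'rV[R]_d) (phi : 'rV[R]_d -> X) : Prop :=
  [/\ smooth_open X D, open (kappa @` D)
    & diffeo (sub_space X D) (sub_space (mx_space 1 d) (kappa @` D))
        kappa phi].
Arguments is_chart : clear implicits.

(* [S] is an embedded submanifold of codimension [k]: around each of its
   points there is a chart of [X] in which [S] is given by the vanishing of
   the last [k] coordinates. *)
Definition embedded_codim (X : smooth_space R) (S : set X) (k : nat) : Prop :=
  exists d : nat, forall x, S x ->
    exists D (kappa : X -> 'rV[R]_(d + k)) phi,
      [/\ is_chart X (d + k) D kappa phi, D x
        & forall y, D y -> (S y <-> rsubmx (kappa y) = 0)].
Arguments embedded_codim : clear implicits.

Definition submersion (X Y : smooth_space R) (f : X -> Y) : Prop :=
  smooth_map X Y f /\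
  forall x, carrier X x ->
    exists d e (D : set X) (E : set Y)
      (kappa : X -> 'rV[R]_d) (phi : 'rV[R]_d -> X)
      (lambda : Y -> 'rV[R]_e) (psi : 'rV[R]_e -> Y),
      [/\ is_chart X d D kappa phi, D x, is_chart Y e E lambda psi, E (f x)
        & forall w : 'rV[R]_e, exists v : 'rV[R]_d,
            'd (lambda \o f \o phi) (kappa x) v = w].
Arguments submersion : clear implicits.

End SmoothSpaces.
Arguments sub_space {R} X S.
Arguments smooth_map {R} X Y f.
Arguments diffeo {R} X Y f g.
Arguments is_chart {R} X d D kappa phi.
Arguments embedded_codim {R} X S k.
Arguments submersion {R} X Y f.

(** * Subspaces of R^n (column vectors) *)

Section Subspaces.
Variable R : realType.

Definition colspan (n k : nat) (A : 'M[R]_(n, k)) : {vspace 'cV[R]_n} :=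
  limg (linfun (mulmx A : 'cV[R]_k -> 'cV[R]_n)).

Definition gact (n : nat) (g : 'M[R]_n) (W : {vspace 'cV[R]_n})
    : {vspace 'cV[R]_n} :=
  (linfun (mulmx g : 'cV[R]_n -> 'cV[R]_n) @: W)%VS.

(* the coordinate subspace R^i of R^n *)
Definition coord_sub (i n : nat) : {vspace 'cV[R]_n} :=
  <<[seq delta_mx j ord0 | j : 'I_n <- enum 'I_n & (j < i)%N]>>%VS.

(* Gr(k, R^n), as the quotient of the open set of n x k matrices of rank k *)
Definition Gr (k n : nat) : smooth_space R :=
  @quot_space R (sub_space (mx_space R n k) [set A | \rank A = k])
    {vspace 'cV[R]_n} (@colspan n k).

End Subspaces.

(** * Bilinear forms *)

Section Forms.
Variable R : realType.

Definition bform (n : nat) (B : 'M[R]_n) (x y : 'cV[R]_n) : R :=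
  (x^T *m B *m y) 0 0.

Definition posdef_on (n : nat) (B : 'M[R]_n) (U : {vspace 'cV[R]_n}) : Prop :=
  forall x, x \in U -> x != 0 -> 0 < bform B x x.

Definition is_max_dim (n : nat) (P : {vspace 'cV[R]_n} -> Prop) (k : nat) :=
  (exists2 U, P U & \dim U = k) /\ (forall U, P U -> (\dim U <= k)%N).

Definition has_signature (n : nat) (B : 'M[R]_n) (W : {vspace 'cV[R]_n})
    (r s : nat) : Prop :=
  is_max_dim (fun U => (U <= W)%VS /\ posdef_on B U) r /\
  is_max_dim (fun U => (U <= W)%VS /\ posdef_on (- B) U) s.

(* the diagonal form with r entries 1 and s entries -1 *)
Definition Jform (r s : nat) : 'M[R]_(r + s) := block_mx 1%:M 0 0 (- 1%:M).

(* A form of signature (r + r', s + s') on R^(r,s) (+) R^(r',s'), written so that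
   the subgroup of maps preserving both summands is block diagonal. *)
Definition Jform_sum (r s r' s' : nat) : 'M[R]_((r + s) + (r' + s')) :=
  block_mx (Jform r s) 0 0 (Jform r' s').

Definition orbit_sig (n : nat) (B : 'M[R]_n) (i r s : nat)
    : set {vspace 'cV[R]_n} :=
  [set W | \dim W = i /\ has_signature B W r s].

Definition isotropic_sub (n : nat) (B : 'M[R]_n) (k : nat)
    : set {vspace 'cV[R]_n} :=
  [set N | \dim N = k /\
           forall x y, x \in N -> y \in N -> bform B x y = 0].

Definition perp (n : nat) (B : 'M[R]_n) (W : {vspace 'cV[R]_n})
    : set 'cV[R]_n :=
  [set x | forall w, w \in W -> bform B w x = 0].

End Forms.

(** * Matrix groups, homogeneous spaces and Lie algebras *)

Section Groups.
Variable R : realType.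

Definition GLset (n : nat) : set 'M[R]_n := [set g | g \in unitmx].

Definition SLset (n : nat) : set 'M[R]_n := [set g | \det g = 1].

Definition Oset (n : nat) (B : 'M[R]_n) : set 'M[R]_n :=
  [set g | g \in unitmx /\ g^T *m B *m g = B].

Definition SOset (n : nat) (B : 'M[R]_n) : set 'M[R]_n :=
  [set g | Oset B g /\ \det g = 1].

Definition S_OO (m n : nat) (B : 'M[R]_m) (C : 'M[R]_n)
    : set ('M[R]_m * 'M[R]_n) :=
  [set g | [/\ Oset B g.1, Oset C g.2 & \det g.1 * \det g.2 = 1]].

Definition S_OO_block (m n : nat) (B : 'M[R]_m) (C : 'M[R]_n)
    : set 'M[R]_(m + n) :=
  [set block_mx g.1 0 0 g.2 | g in S_OO B C].

Definition conj_set (n : nat) (k : 'M[R]_n) (H : set 'M[R]_n) : set 'M[R]_n :=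
  [set invmx k *m h *m k | h in H].

Definition left_coset (n : nat) (K : set 'M[R]_n) (g : 'M[R]_n)
    : set 'M[R]_n := [set g *m k | k in K].

Definition homog_space (n : nat) (H K : set 'M[R]_n) : smooth_space R :=
  @quot_space R (sub_space (mx_space R n n) H) (set 'M[R]_n)
    (@left_coset n K).

(* velocities at the identity of smooth curves in the group *)
Definition lie_alg (n : nat) (H : set 'M[R]_n) : set 'M[R]_n :=
  [set X | exists (U : set 'rV[R]_1) (c : 'rV[R]_1 -> 'M[R]_n),
     [/\ plot (sub_space (mx_space R n n) H) U c, U 0, c 0 = 1%:M
       & 'd c (0 : 'rV[R]_1) (const_mx 1) = X]].

Definition Ad (n : nat) (g X : 'M[R]_n) : 'M[R]_n := g *m X *m invmx g.

(* The element X + p of g/p. *)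
Definition lie_coset (n : nat) (p : set 'M[R]_n) (X : 'M[R]_n)
    : set 'M[R]_n := [set Y | p (Y - X)].

(* The class of X + p in (g/p) / (h / (h cap p)), as a set of elements of g/p;
   h / (h cap p) is identified with its image {Z + p | Z in h} in g/p. *)
Definition lie_class (n : nat) (g p h : set 'M[R]_n) (X : 'M[R]_n)
    : set (set 'M[R]_n) :=
  [set c | exists Y, [/\ g Y, c = lie_coset p Y
     & exists2 Z, h Z & lie_coset p (Y - X) = lie_coset p Z]].

(* The representation S^2 (R^k)^* of GL(k, R): symmetric bilinear forms on
   R^k, with A . S = S (A^-1 -, A^-1 -). *)
Definition S2dual (k : nat) : set 'M[R]_k := [set S | S^T = S].

Definition S2dual_act (k : nat) (A S : 'M[R]_k) : 'M[R]_k :=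
  (invmx A)^T *m S *m invmx A.

(* [F] is a linear isomorphism (g/p) / (h / (h cap p)) -> S^2 (R^k)^*
   intertwining the adjoint action of [Q] with the action of GL(k, R) pulled
   back along [rho]. *)
Definition isotropy_rep_iso (n k : nat) (g p h Q : set 'M[R]_n)
    (rho : 'M[R]_n -> 'M[R]_k) (F : set (set 'M[R]_n) -> 'M[R]_k) : Prop :=
  let cl := lie_class g p h in
  [/\ forall X, g X -> S2dual (F (cl X)),
      forall (a : R) X Y, g X -> g Y ->
        F (cl (a *: X + Y)) = a *: F (cl X) + F (cl Y),
      forall X Y, g X -> g Y -> F (cl X) = F (cl Y) -> cl X = cl Y,
      forall S, S2dual S -> exists2 X, g X & F (cl X) = S
    & forall x X, Q x -> g X ->
        F (cl (Ad x X)) = S2dual_act (rho x) (F (cl X))].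

(* Let N = W cap W^perp.  [E1] is a basis of N, [E2] completes it to a basis
   of W and represents a basis of W/N with Gram matrix [J2], and [E3]
   completes it to a basis of W^perp and represents a basis of W^perp/N with
   Gram matrix [J3]. *)
Definition adapted_frame (n k a c : nat) (B : 'M[R]_n)
    (W : {vspace 'cV[R]_n}) (J2 : 'M[R]_a) (J3 : 'M[R]_c)
    (E1 : 'M[R]_(n, k)) (E2 : 'M[R]_(n, a)) (E3 : 'M[R]_(n, c)) : Prop :=
  [/\ forall x, x \in colspan E1 <-> x \in W /\ perp B W x,
      colspan (row_mx E1 E2) = W,
      forall x, x \in colspan (row_mx E1 E3) <-> perp B W x,
      E2^T *m B *m E2 = J2
    & E3^T *m B *m E3 = J3].

(* The matrices of the maps induced by [x] on N, W/N and W^perp/N. *)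
Definition induced_matrices (n k a c : nat)
    (E1 : 'M[R]_(n, k)) (E2 : 'M[R]_(n, a)) (E3 : 'M[R]_(n, c))
    (x : 'M[R]_n) (A1 : 'M[R]_k) (A2 : 'M[R]_a) (A3 : 'M[R]_c) : Prop :=
  [/\ x *m E1 = E1 *m A1,
      (colspan (x *m E2 - E2 *m A2) <= colspan E1)%VS
    & (colspan (x *m E3 - E3 *m A3) <= colspan E1)%VS].

End Groups.

(* Main.v *)
Require Import Defs.
From HB Require Import structures.
From mathcomp Require Import all_boot all_order all_algebra.
From mathcomp Require Import all_classical all_reals all_analysis.
From mathcomp Require Import zify ring.

(* Let N = W \cap W^\perp.  A basis (E2, E1) of W, with E1 spanning N, extends to a
   basis (E2, E1, E3, E4) of R^n in which b is standard: E1 and E4 are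
   hyperbolically paired, E2 represents W/N and E3 represents W^\perp/N.

   Charts of the orbit: near W the Grassmannian consists of the graphs of the maps
   [v u; y x] from <E2, E1> to <E3, E4>.  In the graph, the orthogonal complement
   of the deformed E2 has dimension nu and Gram matrix x + x^T + corr(v, u, y).
   The signature is still (r, s) iff this symmetric matrix vanishes, and then this
   complement is the radical; shifting x by corr/2 turns the orbit into the linear
   condition that x be antisymmetric.  The space of isotropic subspaces is the case
   r = s = 0, and W |-> N is the submersion.

   Fibers: an element h of the stabilizer of N acts on N^\perp/N by an orthogonal
   matrix theta h, and the subspaces W with radical N correspond to the subspaces
   of signature (r, s) of N^\perp/N, a homogeneous space of SO(p - nu, q - nu).

   Isotropy representation: theta h is block diagonal when h also preserves W.  The
   form X |-> b(X -, -) + b(-, X -) restricted to N vanishes on the Lie algebras of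
   P and of H, and it identifies the quotient with the symmetric forms on N. *)

Set Implicit Arguments.
Unset Strict Implicit.
Unset Printing Implicit Defensive.

Import Order.TTheory GRing.Theory Num.Theory.
Import numFieldNormedType.Exports.

Local Open Scope classical_set_scope.
Local Open Scope ring_scope.

(** * Smooth families of matrices *)

(** Grassmannians and homogeneous spaces carry quotient plots, so openness and smoothness are always
    tested on matrix families over open subsets of some R^d. Hence every construction is an explicit
    matrix formula built from products, inverses and square roots. The signature detects the
    vanishing of the residual symmetric form by Sylvester's law of inertia: a nonzero form on the
    complement would add positive or negative directions to the r and s already present.
    Gram-Schmidt can break down for an indefinite form, but near the standard diagonal form all
    pivots keep their signs. On that open set it works smoothly; both the charts and the local
    sections over the fibers rest on this. Working with SO and SL instead of O and GL costs
    determinant corrections: a reflection in one of the two orthogonal summands, or a rescaling of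
    one vector of the subspace, which exists because i is positive. Lie algebras consist of
    velocities of curves. Differentiating the group equations gives one inclusion; the other needs
    curves, namely a Cayley transform for SO and a line renormalized to determinant 1 for SL and
    P. *)

Section CkMaps.
Variables (R : realType) (V : normedModType R).
Implicit Types (W : normedModType R) (U : set V) (k : nat).

Lemma is_diff_near0 W (f : V -> W) (x : V) :
  (\forall y \near x, f y = 0) -> is_diff x f 0.
Proof.
move=> f0.
have fx0 : f x = 0 := nbhs_singleton f0.
have cont0 : continuous (0 : V -> W) by move=> y; exact: cst_continuous.
have E : f \o shift x = cst (f x) + (0 : V -> W) +o_ 0 id.
  rewrite fx0; apply/eqaddoP => e e0.
  have : \forall y \near x, f y = 0 by [].
  rewrite (near_shift 0 x) subr0 /=.
  apply: filterS => y /= fy.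
  by rewrite !fctE /= fy addr0 subr0 normr0 mulr_ge0 // ltW.
have D : ('d f x : V -> W) = 0 by apply/diff_unique.
by apply: DiffDef => //; apply/diff_locallyP; rewrite D.
Qed.

(** The differential is local: [g - f] vanishes near [x], so it contributes the differential 0. *)
Lemma is_diff_near W (f g df : V -> W) (x : V) :
  (\forall y \near x, f y = g y) -> is_diff x f df -> is_diff x g df.
Proof.
move=> fg dfx.
have -> : g = f + (g - f) by rewrite addrC subrK.
rewrite -[df]addr0; apply: is_diffD.
by apply: is_diff_near0; apply: filterS fg => y; rewrite !fctE => ->; rewrite subrr.
Qed.

Lemma Ck_onS W k U (f : V -> W) : Ck_on k.+1 U f -> Ck_on k U f.
Proof.
elim: k f => [|k IH] f.
  by move=> [d _] x Ux; apply: differentiable_continuous; exact: d.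
by move=> [d c]; split=> // v; apply: IH; exact: c.
Qed.

(** Each clause of [Ck_on] concerns one point, and ['d f] is taken in the ambient space; the sets
    [A] may therefore be arbitrary. *)
Lemma Ck_on_local W k U (f : V -> W) :
  (forall x, U x -> exists2 A, A x & Ck_on k A f) -> Ck_on k U f.
Proof.
elim: k f => [|k IH] f H /=.
  by move=> x Ux; have [A Ax] := H x Ux; apply.
split=> [x Ux|v]; first by have [A Ax [d _]] := H x Ux; exact: d.
apply: IH => x Ux; have [A Ax [_ c]] := H x Ux.
by exists A => //; exact: c.
Qed.

Lemma open_eq_near W U (f g : V -> W) (x : V) : open U -> U x ->
  (forall y, U y -> f y = g y) -> \forall y \near x, f y = g y.
Proof. by move=> oU Ux fg; apply: filterS fg _; exact: open_nbhs_nbhs. Qed.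

(** Openness of [U] turns equality on [U] into equality of germs, hence of all iterated
    differentials. *)
Lemma Ck_on_eq W k U (f g : V -> W) : open U -> (forall x, U x -> f x = g x) ->
  Ck_on k U f -> Ck_on k U g.
Proof.
move=> oU; elim: k f g => [|k IH] f g fg /=.
  move=> cf x Ux; have := cf x Ux; rewrite /prop_for /continuous_at -(fg x Ux).
  by apply: cvg_trans; apply: near_eq_cvg; exact: open_eq_near oU Ux fg.
move=> [df cf].
have D x : U x -> is_diff x g ('d f x).
  move=> Ux; apply: (is_diff_near (open_eq_near oU Ux fg)).
  exact/differentiableP/df.
split=> [x Ux|v]; first by have := D x Ux.
have := IH (fun x => 'd f x v) (fun x => 'd g x v) _ (cf v); apply=> x Ux.
by have Dx := D x Ux; rewrite [in RHS]diff_val.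
Qed.

Lemma Ck_on_cst W k U (w : W) : Ck_on k U (fun=> w).
Proof.
elim: k w => [|k IH] w /=; first by move=> x _; exact: cst_continuous.
split=> // v; rewrite (_ : (fun _ => _) = cst 0) //; first exact: IH.
by apply/funext => x; rewrite diff_cst.
Qed.

Lemma Ck_on_linear W W' k U (l : {linear W -> W'}) (f : V -> W) :
  open U -> continuous l -> Ck_on k U f -> Ck_on k U (l \o f).
Proof.
move=> oU cl; elim: k f => [|k IH] f /=.
  by move=> cf x Ux; apply: continuous_comp; [exact: cf|exact: cl].
move=> [df cf].
have dl y : differentiable l y by exact/linear_differentiable.
split=> [x Ux|v]; first by apply: differentiable_comp => //; exact: df.
apply: (Ck_on_eq oU _ (IH _ (cf v))) => x Ux.
by rewrite diff_comp //; [rewrite /= diff_lin|exact: df].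
Qed.

Lemma Ck_onD W k U (f g : V -> W) : open U ->
  Ck_on k U f -> Ck_on k U g -> Ck_on k U (fun x => f x + g x).
Proof.
move=> oU; elim: k f g => [|k IH] f g /=.
  by move=> cf cg x Ux; apply: continuousD; [exact: cf|exact: cg].
move=> [df cf] [dg cg].
split=> [x Ux|v]; first by apply: differentiableD; [exact: df|exact: dg].
apply: (Ck_on_eq oU _ (IH _ _ (cf v) (cg v))) => x Ux.
by rewrite diffD //; [exact: df|exact: dg].
Qed.

Lemma Ck_on_sum W k U I (s : seq I) (F : I -> V -> W) : open U ->
  (forall i, Ck_on k U (F i)) -> Ck_on k U (fun x => \sum_(i <- s) F i x).
Proof.
move=> oU H; elim: s => [|i s IH].
  by apply: (Ck_on_eq oU _ (Ck_on_cst k U 0)) => x _; rewrite big_nil.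
apply: (Ck_on_eq oU _ (Ck_onD oU (H i) IH)) => x _.
by rewrite big_cons.
Qed.

Lemma Ck_on_mxP k U m n (f : V -> 'M[R]_(m, n)) : open U ->
  Ck_on k U f <-> forall i j, Ck_on k U (fun x => f x i j : R).
Proof.
move=> oU; split=> [H i j|H].
  have @l : {linear 'M[R]_(m, n) -> R}.
    by exists (fun N : 'M[R]_(_, _) => N i j); do 2![eexists]; do ?[constructor];
      rewrite ?mxE// => ? *; rewrite ?mxE//; move=> ?; rewrite !mxE.
  have cl : continuous l by exact: coord_continuous.
  exact: Ck_on_linear oU cl H.
pose F (ij : 'I_m * 'I_n) x := f x ij.1 ij.2 *: delta_mx ij.1 ij.2 : 'M[R]_(m,n).
have HF ij : Ck_on k U (F ij).
  have sl : linear (fun a : R => a *: delta_mx ij.1 ij.2 : 'M[R]_(m,n)).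
    by move=> a b c; rewrite scalerDl scalerA.
  pose sM := GRing.isLinear.Build _ _ _ _ _ sl.
  pose l : {linear R -> 'M[R]_(m, n)} := HB.pack (fun a : R => a *: delta_mx ij.1 ij.2 : 'M[R]_(m,n)) sM.
  have cl : continuous l by exact: scalel_continuous.
  exact: Ck_on_linear oU cl (H _ _).
apply: (Ck_on_eq oU _ (Ck_on_sum (index_enum _) oU HF)) => x _.
by rewrite [RHS]matrix_sum_delta pair_bigA.
Qed.

Lemma Ck_onM k U (f g : V -> R) : open U ->
  Ck_on k U f -> Ck_on k U g -> Ck_on k U (fun x => f x * g x).
Proof.
move=> oU; elim: k f g => [|k IH] f g.
  by move=> cf cg x Ux; apply: continuousM; [exact: cf|exact: cg].
move=> Hf Hg; have [[df cf] [dg cg]] := (Hf, Hg).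
split=> [x Ux|v]; first by apply: differentiableM; [exact: df|exact: dg].
have := Ck_onD oU (IH _ _ (Ck_onS Hf) (cg v)) (IH _ _ (Ck_onS Hg) (cf v)).
apply: Ck_on_eq => // x Ux.
by rewrite diffM //; [exact: df|exact: dg].
Qed.

(** The induction closes because the derivative of 1/f is -(1/f)^2 f', where 1/f is already C^k by
    the inductive hypothesis. *)
Lemma Ck_onV k U (f : V -> R) : open U -> (forall x, U x -> f x != 0) ->
  Ck_on k U f -> Ck_on k U (fun x => (f x)^-1).
Proof.
move=> oU f0; elim: k => [|k IH].
  by move=> cf x Ux; apply: continuousV; [exact: f0|exact: cf].
move=> Hf; have [df cf] := Hf.
split=> [x Ux|v]; first by apply: differentiableV; [exact: df|exact: f0].
have IHk := IH (Ck_onS Hf).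
have := Ck_onM oU (Ck_onM oU (Ck_on_cst k U (-1 : R)) (Ck_onM oU IHk IHk)) (cf v).
apply: Ck_on_eq => // x Ux.
by rewrite diffV //=; [rewrite -expr2 mulN1r exprVn|exact: df|exact: f0].
Qed.

(** As for the inverse: the derivative is f'/(2 sqrt f), whose factor 1/sqrt f is C^k by the
    inductive hypothesis and [Ck_onV]. *)
Lemma Ck_on_sqrt k U (f : V -> R) : open U -> (forall x, U x -> 0 < f x) ->
  Ck_on k U f -> Ck_on k U (fun x => Num.sqrt (f x)).
Proof.
move=> oU f0; elim: k => [|k IH].
  move=> cf x Ux; apply: (@continuous_comp _ _ _ f) => //; first exact: cf.
  exact: sqrt_continuous.
move=> Hf; have [df cf] := Hf.
have dsq x : U x -> differentiable (@Num.sqrt R) (f x).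
  move=> Ux; apply/derivable1_diffP.
  by have := is_derive1_sqrt (f0 x Ux).
split=> [x Ux|v].
  by apply: (@differentiable_comp _ _ _ _ f); [exact: df|exact: dsq].
have IHk := IH (Ck_onS Hf).
have s0 x : U x -> Num.sqrt (f x) != 0 by move=> /f0 ?; rewrite gt_eqF // sqrtr_gt0.
have := Ck_onM oU (Ck_onM oU (Ck_on_cst k U (2^-1 : R)) (Ck_onV oU s0 IHk)) (cf v).
apply: Ck_on_eq => // x Ux.
have /(congr1 (@^~ v)) E := diff_comp (df x Ux) (dsq x Ux).
rewrite [RHS]E /= (diff1E (dsq x Ux)).
rewrite derive1E (derive_sqrt (f0 x Ux)) invfM.
exact: mulrC.
Qed.

End CkMaps.

Section SmoothFamilies.
Variables (R : realType) (d : nat).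
Implicit Types (U : set 'rV[R]_d) (m n k : nat).

(* Smooth families of matrices ([sfam]) and of reals ([rfam]) over an open set. *)
Definition sfam m n U (f : 'rV[R]_d -> 'M[R]_(m, n)) :=
  plot (mx_space R m n) U f.

Definition rfam U (f : 'rV[R]_d -> R) := open U /\ smooth_on U f.

Lemma sfam_entryP m n U f :
  @sfam m n U f <-> open U /\ forall i j, rfam U (fun x => f x i j).
Proof.
split=> [[oU sf]|[oU sf]]; split=> //.
  by move=> i j; split=> // k; exact: (Ck_on_mxP k f oU).1 (sf k) i j.
by move=> k; apply/(Ck_on_mxP k f oU) => i j; exact: (sf i j).2.
Qed.

Lemma sfam_entry m n U f i j :
  @sfam m n U f -> rfam U (fun x => f x i j).
Proof. by move=> /sfam_entryP[_]; apply. Qed.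

Lemma sfam_open m n U f : @sfam m n U f -> open U.
Proof. by case. Qed.

Lemma rfam_eq U (f g : 'rV[R]_d -> R) :
  (forall x, U x -> f x = g x) -> rfam U f -> rfam U g.
Proof. by move=> fg [oU sf]; split=> // k; exact: Ck_on_eq (sf k). Qed.

Lemma sfam_eq m n U (f g : 'rV[R]_d -> 'M[R]_(m, n)) :
  (forall x, U x -> f x = g x) -> sfam U f -> sfam U g.
Proof. by move=> fg [oU sf]; split=> // k; exact: Ck_on_eq (sf k). Qed.

Lemma sfam_local m n U f : open U ->
  (forall x, U x -> exists A g,
     [/\ A x, sfam A g & forall y, A y -> f y = g y]) -> @sfam m n U f.
Proof.
move=> oU H; split=> // k; apply: Ck_on_local => x Ux.
have [A [g [Ax [oA sg] fg]]] := H x Ux.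
by exists A => //; apply: Ck_on_eq (sg k) => // y Ay; rewrite fg.
Qed.

Lemma sfam_sub m n U A f :
  open A -> A `<=` U -> @sfam m n U f -> sfam A f.
Proof.
move=> oA AU [oU sf]; split=> // k; apply: Ck_on_local => x Ax.
by exists U; [exact: AU|exact: sf].
Qed.

Lemma rfam_cst U (a : R) : open U -> rfam U (fun=> a).
Proof. by move=> oU; split=> // k; exact: Ck_on_cst. Qed.

Lemma rfamM U f g : rfam U f -> rfam U g -> rfam U (fun x => f x * g x).
Proof. by move=> [oU sf] [_ sg]; split=> // k; exact: Ck_onM. Qed.

Lemma rfamV U f : (forall x, U x -> f x != 0) -> rfam U f ->
  rfam U (fun x => (f x)^-1).
Proof. by move=> f0 [oU sf]; split=> // k; exact: Ck_onV. Qed.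

Lemma rfam_sqrt U f : (forall x, U x -> 0 < f x) -> rfam U f ->
  rfam U (fun x => Num.sqrt (f x)).
Proof. by move=> f0 [oU sf]; split=> // k; exact: Ck_on_sqrt. Qed.

Lemma rfam_sum U I (s : seq I) (F : I -> 'rV[R]_d -> R) : open U ->
  (forall i, rfam U (F i)) -> rfam U (fun x => \sum_(i <- s) F i x).
Proof. by move=> oU sF; split=> // k; apply: Ck_on_sum => // i; exact: (sF i).2. Qed.

Lemma rfam_prod U I (s : seq I) (F : I -> 'rV[R]_d -> R) : open U ->
  (forall i, rfam U (F i)) -> rfam U (fun x => \prod_(i <- s) F i x).
Proof.
move=> oU sF; elim: s => [|i s IH].
  by apply: rfam_eq (rfam_cst 1 oU) => x _; rewrite big_nil.
by apply: rfam_eq (rfamM (sF i) IH) => x _; rewrite big_cons.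
Qed.

Lemma sfam_id U : open U -> sfam U id.
Proof.
move=> oU; split=> // -[|k] /=; first by move=> x _; exact: cvg_id.
split=> [x _|v]; first exact: ex_diff.
apply: (@Ck_on_eq _ _ _ _ _ (fun=> v)) => //; last exact: Ck_on_cst.
by move=> x _; rewrite diff_val.
Qed.

Lemma sfam_cst m n U (A : 'M[R]_(m, n)) : open U -> sfam U (fun=> A).
Proof. by move=> oU; split=> // k; exact: Ck_on_cst. Qed.

Lemma sfam_add m n U f g :
  @sfam m n U f -> @sfam m n U g -> sfam U (fun x => f x + g x).
Proof. by move=> [oU sf] [_ sg]; split=> // k; exact: Ck_onD. Qed.

Lemma sfam_scale m n U a f :
  rfam U a -> @sfam m n U f -> sfam U (fun x => a x *: f x).
Proof.
move=> sa /sfam_entryP[oU sf]; apply/sfam_entryP; split=> // i j.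
by apply: rfam_eq (rfamM sa (sf i j)) => x _; rewrite mxE.
Qed.

Lemma sfam_opp m n U f :
  @sfam m n U f -> sfam U (fun x => - f x).
Proof.
move=> sf; have := sfam_scale (rfam_cst (-1) (sfam_open sf)) sf.
by apply: sfam_eq => x _; rewrite scaleN1r.
Qed.

Lemma sfam_sum m n U I (s : seq I) (F : I -> 'rV[R]_d -> 'M[R]_(m, n)) :
  open U -> (forall i, sfam U (F i)) -> sfam U (fun x => \sum_(i <- s) F i x).
Proof. by move=> oU sF; split=> // k; apply: Ck_on_sum => // i; exact: (sF i).2. Qed.

Lemma sfam_mul m n p U f g :
  @sfam m n U f -> @sfam n p U g -> sfam U (fun x => f x *m g x).
Proof.
move=> /sfam_entryP[oU sf] /sfam_entryP[_ sg]; apply/sfam_entryP; split=> // i j.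
have := rfam_sum (index_enum _) oU (fun l => rfamM (sf i l) (sg l j)).
by apply: rfam_eq => x _; rewrite mxE.
Qed.

Lemma sfam_linear m n p q U (l : {linear 'M[R]_(m, n) -> 'M[R]_(p, q)}) f :
  @sfam m n U f -> sfam U (fun x => l (f x)).
Proof.
move=> /sfam_entryP[oU sf].
have := sfam_sum (index_enum _) oU
  (fun ij => sfam_scale (sf ij.1 ij.2) (sfam_cst (l (delta_mx ij.1 ij.2)) oU)).
apply: sfam_eq => x _; rewrite [in RHS](matrix_sum_delta (f x)) pair_bigA /=.
by rewrite linear_sum; apply: eq_bigr => ij _; rewrite linearZ.
Qed.

Lemma sfam_tr m n U f :
  @sfam m n U f -> sfam U (fun x => (f x)^T).
Proof. exact: sfam_linear. Qed.

Lemma sfam_row_mx m n1 n2 U f g :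
  @sfam m n1 U f -> @sfam m n2 U g -> sfam U (fun x => row_mx (f x) (g x)).
Proof.
move=> /sfam_entryP[oU sf] /sfam_entryP[_ sg]; apply/sfam_entryP; split=> // i j.
rewrite -(splitK j); case: (fintype.split j) => l /=.
  by apply: rfam_eq (sf i l) => x _; rewrite row_mxEl.
by apply: rfam_eq (sg i l) => x _; rewrite row_mxEr.
Qed.

Lemma sfam_col_mx m1 m2 n U f g :
  @sfam m1 n U f -> @sfam m2 n U g -> sfam U (fun x => col_mx (f x) (g x)).
Proof.
move=> sf sg; have := sfam_tr (sfam_row_mx (sfam_tr sf) (sfam_tr sg)).
by apply: sfam_eq => x _; rewrite tr_row_mx !trmxK.
Qed.

Lemma sfam_block_mx m1 m2 n1 n2 U f1 f2 f3 f4 :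
  @sfam m1 n1 U f1 -> @sfam m1 n2 U f2 -> @sfam m2 n1 U f3 -> @sfam m2 n2 U f4 ->
  sfam U (fun x => block_mx (f1 x) (f2 x) (f3 x) (f4 x)).
Proof.
by move=> s1 s2 s3 s4; apply: sfam_col_mx; apply: sfam_row_mx.
Qed.

Lemma rfam_det n U f :
  @sfam n n U f -> rfam U (fun x => \det (f x)).
Proof.
move=> /sfam_entryP[oU sf].
by apply: rfam_sum => // s; apply: rfamM; [exact: rfam_cst|exact: rfam_prod].
Qed.

(** Cramer's formula: the entries of the adjugate are signed minors, and the determinant has no zero
    on [U]. *)
Lemma sfam_inv n U f :
  (forall x, U x -> f x \in unitmx) ->
  @sfam n n U f -> sfam U (fun x => invmx (f x)).
Proof.
move=> fu sf; have oU := sfam_open sf.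
have d0 x : U x -> \det (f x) != 0 by move=> /fu; rewrite unitmxE unitfE.
have sa : sfam U (fun x => \adj (f x)).
  apply/sfam_entryP; split=> // i j.
  have sm : sfam U (fun x => row' j (col' i (f x))).
    apply/sfam_entryP; split=> // i' j'.
    by apply: rfam_eq (sfam_entry (lift j i') (lift i j') sf) => x _; rewrite !mxE.
  have := rfamM (rfam_cst ((-1) ^+ (j + i)) oU) (rfam_det sm).
  by apply: rfam_eq => x _; rewrite mxE.
have := sfam_scale (rfamV d0 (rfam_det sf)) sa.
by apply: sfam_eq => x Ux; rewrite /invmx fu.
Qed.

Lemma rfam_pos_open U f : rfam U f -> open (U `&` [set x | 0 < f x]).
Proof.
move=> [oU sf]; rewrite openE => x [Ux fx].
have cf : f @ x --> f x := sf 0%N x Ux.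
apply: filterI; first exact: open_nbhs_nbhs.
have pos : nbhs (f x) [set y | 0 < y].
  by apply: open_nbhs_nbhs; split=> //; exact: open_gt.
exact: cf pos.
Qed.

Lemma rfam_neq0_open U f : rfam U f -> open (U `&` [set x | f x != 0]).
Proof.
move=> sf; have := rfam_pos_open (rfamM sf sf).
suff -> : U `&` [set x | f x != 0] = U `&` [set x | 0 < f x * f x] by [].
by apply/seteqP; split=> x [Ux /= h]; split=> //; move: h => /=;
  rewrite -expr2 exprn_even_gt0.
Qed.

Lemma sfam_unit_open n U f :
  @sfam n n U f -> open (U `&` [set x | f x \in unitmx]).
Proof.
move=> sf; have := rfam_neq0_open (rfam_det sf).
suff -> : U `&` [set x | f x \in unitmx] = U `&` [set x | \det (f x) != 0] by [].
by apply/seteqP; split=> x [Ux /= h]; split=> //; move: h => /=;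
  rewrite unitmxE unitfE.
Qed.

End SmoothFamilies.

(** * Column spans and Gram matrices *)

Section Colspan.
Variable R : realType.
Implicit Types (n k l : nat).

Lemma mem_colspan n k (A : 'M[R]_(n, k)) (x : 'cV[R]_n) :
  x \in colspan A <-> exists z, x = A *m z.
Proof.
rewrite /colspan; split.
  by move=> /memv_imgP[z _ ->]; exists z; rewrite lfunE.
by move=> [z ->]; apply/memv_imgP; exists z; rewrite ?memvf // lfunE.
Qed.

Lemma mulmx_colspan n k (A : 'M[R]_(n, k)) z : A *m z \in colspan A.
Proof. by apply/mem_colspan; exists z. Qed.

Lemma colspan_sub n k l (A : 'M[R]_(n, k)) (C : 'M[R]_(n, l)) :
  (colspan A <= colspan C)%VS <-> exists Z, A = C *m Z.
Proof.
split=> [/subvP H|[Z ->]]; last first.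
  apply/subvP => x /mem_colspan[z ->]; apply/mem_colspan.
  by exists (Z *m z); rewrite mulmxA.
have /choice[z zP] : forall j, exists z, col j A = C *m z.
  move=> j; apply/mem_colspan/H/mem_colspan.
  by exists (delta_mx j 0); rewrite -colE.
exists (\matrix_(i, j) z j i 0); apply/matrixP => i j.
have /matrixP/(_ i 0) := zP j; rewrite !mxE => ->.
by apply: eq_bigr => h _; rewrite mxE.
Qed.

Lemma colspan_eq n k l (A : 'M[R]_(n, k)) (C : 'M[R]_(n, l)) Z T :
  A = C *m Z -> C = A *m T -> colspan A = colspan C.
Proof.
move=> AC CA; apply/eqP; rewrite eqEsubv; apply/andP.
by split; apply/colspan_sub; [exists Z|exists T].
Qed.

Lemma colspan_mulr n k (A : 'M[R]_(n, k)) (P : 'M[R]_k) :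
  P \in unitmx -> colspan (A *m P) = colspan A.
Proof. by move=> Pu; apply: (colspan_eq erefl) (esym (mulmxK Pu A)). Qed.

Lemma gact_colspan n k (g : 'M[R]_n) (A : 'M[R]_(n, k)) :
  gact g (colspan A) = colspan (g *m A).
Proof.
apply/vspaceP => x; apply/idP/idP.
  move=> /memv_imgP[y /mem_colspan[z ->] ->].
  by rewrite lfunE /= mulmxA mulmx_colspan.
move=> /mem_colspan[z ->]; apply/memv_imgP; exists (A *m z).
  exact: mulmx_colspan.
by rewrite lfunE /= mulmxA.
Qed.

Lemma colspan1 n : colspan (1%:M : 'M[R]_n) = fullv.
Proof.
apply/vspaceP => x; rewrite memvf; apply/mem_colspan.
by exists x; rewrite mul1mx.
Qed.

Lemma gact_mul n (g h : 'M[R]_n) W : gact (g *m h) W = gact g (gact h W).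
Proof.
apply/vspaceP => x; apply/idP/idP.
  move=> /memv_imgP[y yW ->]; rewrite lfunE /=; apply/memv_imgP.
  exists (h *m y); last by rewrite lfunE /= mulmxA.
  by apply/memv_imgP; exists y => //; rewrite lfunE.
move=> /memv_imgP[z /memv_imgP[y yW ->] ->]; apply/memv_imgP.
by exists y => //; rewrite !lfunE /= mulmxA.
Qed.

Lemma gact1 n W : gact (1%:M : 'M[R]_n) W = W.
Proof.
apply/vspaceP => x; apply/idP/idP.
  by move=> /memv_imgP[y yW ->]; rewrite lfunE /= mul1mx.
by move=> xW; apply/memv_imgP; exists x => //; rewrite lfunE /= mul1mx.
Qed.

Lemma rank_linvP n k (A : 'M[R]_(n, k)) :
  \rank A = k <-> exists C, C *m A = 1%:M.
Proof.
split=> [rA|H]; first by apply/row_fullP; rewrite /row_full rA.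
by apply/eqP; have : row_full A by apply/row_fullP.
Qed.

Lemma rank_injP n k (A : 'M[R]_(n, k)) :
  \rank A = k <-> forall x : 'cV_k, A *m x = 0 -> x = 0.
Proof.
split=> [/rank_linvP[C CA] x Ax|H].
  by rewrite -[x]mul1mx -CA -mulmxA Ax mulmx0.
rewrite -mxrank_tr; apply/eqP; rewrite -[_ == _]/(row_free A^T) -kermx_eq0.
apply/eqP/row_matrixP => i; rewrite row0; apply: trmx_inj; rewrite trmx0.
apply: H; apply: trmx_inj; rewrite trmx_mul trmxK trmx0.
exact/sub_kermxP/row_sub.
Qed.

Lemma rank_inj n k l (A : 'M[R]_(n, k)) (X Y : 'M[R]_(k, l)) :
  \rank A = k -> A *m X = A *m Y -> X = Y.
Proof.
by move=> /rank_linvP[C CA] AXY; rewrite -[X]mul1mx -CA -mulmxA AXY mulmxA CA mul1mx.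
Qed.

Lemma rank_mulmx_full n k l (A : 'M[R]_(n, k)) (C : 'M[R]_(k, l)) :
  \rank A = k -> \rank C = l -> \rank (A *m C) = l.
Proof.
move=> /rank_linvP[A' AA] /rank_linvP[C' CC]; apply/rank_linvP.
by exists (C' *m A'); rewrite -mulmxA (mulmxA A') AA mul1mx.
Qed.

Lemma dim_colspan n k (A : 'M[R]_(n, k)) : \dim (colspan A) = k <-> \rank A = k.
Proof.
pose f := linfun (mulmx A : 'cV[R]_k -> 'cV[R]_n).
have := limg_ker_dim f fullv; rewrite -/(colspan A) capfv dimvf dim_matrix.
rewrite [(k * 1)%R]muln1 => E.
split=> [dA|rA].
  have /lker0P inj : lker f == 0%VS.
    by rewrite -dimv_eq0; apply/eqP/(@addIn (\dim (colspan A))); rewrite E dA.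
  apply/rank_injP => x Ax; apply: inj.
  by rewrite !lfunE /= Ax mulmx0.
have /eqP K : lker f == 0%VS.
  by apply/lker0P => x y; rewrite !lfunE /=; exact: rank_inj.
by move: E; rewrite K dimv0 add0n.
Qed.

Lemma rank_leq_full n k (A : 'M[R]_(n, k)) : \rank A = k -> (k <= n)%N.
Proof. by move=> {1}<-; exact: rank_leq_row. Qed.

Lemma colspan_exists n (W : {vspace 'cV[R]_n}) k : \dim W = k ->
  exists2 A : 'M[R]_(n, k), \rank A = k & colspan A = W.
Proof.
move=> dW; pose A := \matrix_(i < n, j < k) (vbasis W)`_j i 0.
have AW : colspan A = W.
  apply/vspaceP => x; apply/idP/idP => [/mem_colspan[z ->]|xW].
    have -> : A *m z = \sum_(j < k) z j 0 *: (vbasis W)`_j.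
      apply/matrixP => i j; rewrite !mxE summxE (ord1 j); apply: eq_bigr => l _.
      by rewrite !mxE mulrC.
    apply: memv_suml => j _; apply: memvZ; apply: vbasis_mem.
    by apply: mem_nth; rewrite size_tuple dW.
  apply/mem_colspan; subst k; exists (\col_j coord (vbasis W) j x).
  rewrite {1}(coord_vbasis xW); apply/matrixP => i j; rewrite !mxE summxE (ord1 j).
  by apply: eq_bigr => l _; rewrite !mxE mulrC.
by exists A => //; apply/dim_colspan; rewrite AW.
Qed.

Lemma colspan_unique n k (A C : 'M[R]_(n, k)) :
  \rank A = k -> colspan A = colspan C -> exists2 P, P \in unitmx & A = C *m P.
Proof.
move=> rA EAC; have rC : \rank C = k by apply/dim_colspan; rewrite -EAC; apply/dim_colspan.
have [Z AZ] : exists Z, A = C *m Z by apply/colspan_sub; rewrite EAC.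
have [T CT] : exists T, C = A *m T by apply/colspan_sub; rewrite EAC.
exists Z => //; have : Z *m T = 1%:M.
  by apply: (rank_inj rC); rewrite mulmxA -AZ -CT mulmx1.
by move=> /mulmx1_unit[].
Qed.

Lemma colspan_row_mx_mem n k l (A : 'M[R]_(n, k)) (C : 'M[R]_(n, l)) x :
  x \in colspan (row_mx A C) <-> exists y z, x = A *m y + C *m z.
Proof.
split=> [/mem_colspan[w ->]|[y [z ->]]].
  by exists (usubmx w), (dsubmx w); rewrite -{1}[w]vsubmxK mul_row_col.
by apply/mem_colspan; exists (col_mx y z); rewrite mul_row_col.
Qed.

Lemma complete_cols n k (A : 'M[R]_(n, k)) : \rank A = k ->
  exists l (C : 'M[R]_(n, l)), (k + l)%N = n /\ \rank (row_mx A C) = (k + l)%N.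
Proof.
move=> rA; exists (\rank (A^T)^C)%MS, (row_base (A^T)^C)^T%MS.
have kl : (k + \rank (A^T)^C)%N = n.
  by rewrite mxrank_compl mxrank_tr rA subnKC // (rank_leq_full rA).
split=> //; rewrite -mxrank_tr tr_row_mx trmxK; apply: etrans (esym kl).
rewrite -addsmxE; have /eqP := addsmx_compl_full A^T; apply: etrans.
by rewrite (adds_eqmx (eqmx_refl _) (eq_row_base _)).
Qed.

(** The equality [k = n] stays propositional: frames have sizes such as [a + k + (c + k)], which are
    not convertible to [n]. *)
Lemma rect_mulmx1C n k (A : 'M[R]_(n, k)) (C : 'M[R]_(k, n)) :
  k = n -> A *m C = 1%:M -> C *m A = 1%:M.
Proof. by move=> E; subst k; exact: mulmx1C. Qed.

Lemma rank_rinv n k (A : 'M[R]_(n, k)) : k = n -> \rank A = k ->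
  exists2 A', A' *m A = 1%:M & A *m A' = 1%:M.
Proof.
move=> E /rank_linvP[A' AA]; exists A' => //; exact: rect_mulmx1C AA.
Qed.

Lemma rect_det n k (F : 'M[R]_(n, k)) (F' : 'M[R]_(k, n)) (h : 'M[R]_n) :
  k = n -> F' *m F = 1%:M -> \det (F' *m h *m F) = \det h.
Proof.
move=> E; subst k => FF; rewrite !det_mulmx mulrAC -det_mulmx FF det1 mul1r //.
Qed.

End Colspan.

Section Gram.
Variable R : realType.
Implicit Types (n k l : nat).

Definition gram n k l (B : 'M[R]_n) (X : 'M[R]_(n, k)) (Y : 'M[R]_(n, l)) :=
  X^T *m B *m Y.

Lemma gramDl n k l (B : 'M[R]_n) (X X' : 'M[R]_(n, k)) (Y : 'M[R]_(n, l)) :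
  gram B (X + X') Y = gram B X Y + gram B X' Y.
Proof. by rewrite /gram linearD /= !mulmxDl. Qed.

Lemma gramDr n k l (B : 'M[R]_n) (X : 'M[R]_(n, k)) (Y Y' : 'M[R]_(n, l)) :
  gram B X (Y + Y') = gram B X Y + gram B X Y'.
Proof. by rewrite /gram mulmxDr. Qed.

Lemma gramNl n k l (B : 'M[R]_n) (X : 'M[R]_(n, k)) (Y : 'M[R]_(n, l)) :
  gram B (- X) Y = - gram B X Y.
Proof. by rewrite /gram linearN /= !mulNmx. Qed.

Lemma gramNr n k l (B : 'M[R]_n) (X : 'M[R]_(n, k)) (Y : 'M[R]_(n, l)) :
  gram B X (- Y) = - gram B X Y.
Proof. by rewrite /gram mulmxN. Qed.

Lemma gramMl n k l m (B : 'M[R]_n) (X : 'M[R]_(n, k)) (P : 'M[R]_(k, m))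
    (Y : 'M[R]_(n, l)) : gram B (X *m P) Y = P^T *m gram B X Y.
Proof. by rewrite /gram trmx_mul !mulmxA. Qed.

Lemma gramMr n k l m (B : 'M[R]_n) (X : 'M[R]_(n, k)) (Y : 'M[R]_(n, l))
    (P : 'M[R]_(l, m)) : gram B X (Y *m P) = gram B X Y *m P.
Proof. by rewrite /gram !mulmxA. Qed.

Lemma gramZl n k l (B : 'M[R]_n) a (X : 'M[R]_(n, k)) (Y : 'M[R]_(n, l)) :
  gram B (a *: X) Y = a *: gram B X Y.
Proof. by rewrite /gram linearZ /= !scalemxAl. Qed.

Lemma gramZr n k l (B : 'M[R]_n) a (X : 'M[R]_(n, k)) (Y : 'M[R]_(n, l)) :
  gram B X (a *: Y) = a *: gram B X Y.
Proof. by rewrite /gram scalemxAr. Qed.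

Lemma gram_rowl n k k' l (B : 'M[R]_n) (X : 'M[R]_(n, k)) (X' : 'M[R]_(n, k'))
    (Y : 'M[R]_(n, l)) : gram B (row_mx X X') Y = col_mx (gram B X Y) (gram B X' Y).
Proof. by rewrite /gram tr_row_mx !mul_col_mx. Qed.

Lemma gram_rowr n k l l' (B : 'M[R]_n) (X : 'M[R]_(n, k)) (Y : 'M[R]_(n, l))
    (Y' : 'M[R]_(n, l')) : gram B X (row_mx Y Y') = row_mx (gram B X Y) (gram B X Y').
Proof. by rewrite /gram mul_mx_row. Qed.

Lemma gram_block n k k' l l' (B : 'M[R]_n) (X : 'M[R]_(n, k)) (X' : 'M[R]_(n, k'))
    (Y : 'M[R]_(n, l)) (Y' : 'M[R]_(n, l')) :
  gram B (row_mx X X') (row_mx Y Y') =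
  block_mx (gram B X Y) (gram B X Y') (gram B X' Y) (gram B X' Y').
Proof. by rewrite gram_rowl !gram_rowr. Qed.

Lemma gram_tr n k l (B : 'M[R]_n) (X : 'M[R]_(n, k)) (Y : 'M[R]_(n, l)) :
  B^T = B -> (gram B X Y)^T = gram B Y X.
Proof. by move=> sB; rewrite /gram !trmx_mul trmxK sB mulmxA. Qed.

Lemma gram_eq0C n k l (B : 'M[R]_n) (X : 'M[R]_(n, k)) (Y : 'M[R]_(n, l)) :
  B^T = B -> gram B X Y = 0 -> gram B Y X = 0.
Proof. by move=> sB XY; rewrite -(gram_tr _ _ sB) XY trmx0. Qed.

Lemma gramN n k l (B : 'M[R]_n) (X : 'M[R]_(n, k)) (Y : 'M[R]_(n, l)) :
  gram (- B) X Y = - gram B X Y.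
Proof. by rewrite /gram mulmxN mulNmx. Qed.

Lemma gram_act n k l (B : 'M[R]_n) (g : 'M[R]_n) (X : 'M[R]_(n, k)) (Y : 'M[R]_(n, l)) :
  g^T *m B *m g = B -> gram B (g *m X) (g *m Y) = gram B X Y.
Proof. by move=> gB; rewrite -[in RHS]gB /gram trmx_mul !mulmxA. Qed.

Lemma bformE n (B : 'M[R]_n) x y : bform B x y = gram B x y 0 0.
Proof. by []. Qed.

Lemma scalar11 (A B : 'M[R]_1) : A 0 0 = B 0 0 -> A = B.
Proof. by move=> E; apply/matrixP => i j; rewrite (ord1 i) (ord1 j). Qed.

Lemma sqnorm_ge0 k (z : 'cV[R]_k) : 0 <= (z^T *m z) 0 0.
Proof. by rewrite mxE sumr_ge0 // => i _; rewrite mxE -expr2 sqr_ge0. Qed.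

Lemma sqnorm_gt0 k (z : 'cV[R]_k) : z != 0 -> 0 < (z^T *m z) 0 0.
Proof.
move=> z0; rewrite lt_neqAle sqnorm_ge0 andbT eq_sym.
apply: contra z0; rewrite mxE psumr_eq0; last by move=> i _; rewrite mxE -expr2 sqr_ge0.
move=> /allP H; apply/eqP/matrixP => i j; rewrite (ord1 j) !mxE.
by have := H i (mem_index_enum i); rewrite /= mxE -expr2 sqrf_eq0 => /eqP.
Qed.

(** A positive definite subspace meets the negative semidefinite [Wn] only in 0, so its dimension is
    at most the codimension of [Wn] in [W], which is the dimension of [Wp]. *)
Lemma is_max_posdef n k (B : 'M[R]_n) (W Wp Wn : {vspace 'cV[R]_n}) :
  \dim Wp = k -> (Wp <= W)%VS -> (Wn <= W)%VS -> posdef_on B Wp ->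
  (forall x, x \in Wn -> bform B x x <= 0) ->
  (\dim Wp + \dim Wn)%N = \dim W ->
  is_max_dim (fun U => (U <= W)%VS /\ posdef_on B U) k.
Proof.
move=> <- WpW WnW pP nN dW; split=> [|U [UW pU]]; first by exists Wp.
rewrite -(leq_add2r (\dim Wn)) dW -dimv_sum_cap.
suff -> : (U :&: Wn)%VS = 0%VS.
  by rewrite dimv0 addn0; apply: dimvS; rewrite subv_add UW.
apply/eqP; rewrite -subv0; apply/subvP => x; rewrite memv_cap memv0 => /andP[xU xN].
by apply: contraT => x0; have := lt_le_trans (pU x xU x0) (nN x xN); rewrite ltxx.
Qed.

Lemma is_max_dim_unique n (P : {vspace 'cV[R]_n} -> Prop) k l :
  is_max_dim P k -> is_max_dim P l -> k = l.
Proof.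
move=> [[U PU <-] Uk] [[U' PU' <-] Ul].
by apply/eqP; rewrite eqn_leq Ul // Uk.
Qed.

Lemma has_signature_unique n (B : 'M[R]_n) W r s a b :
  has_signature B W r s -> has_signature B W a b -> r = a /\ s = b.
Proof.
move=> [h1 h2] [h3 h4].
by split; [exact: is_max_dim_unique h1 h3|exact: is_max_dim_unique h2 h4].
Qed.

Lemma posdef_colspan n k (B : 'M[R]_n) (X : 'M[R]_(n, k)) :
  gram B X X = 1%:M -> posdef_on B (colspan X).
Proof.
move=> XX x /mem_colspan[z ->] Xz0; rewrite bformE gramMl gramMr XX mul1mx.
by apply: sqnorm_gt0; apply: contra_neq Xz0 => ->; rewrite mulmx0.
Qed.

Lemma semineg_colspan n k l (B : 'M[R]_n) (Y : 'M[R]_(n, k)) (Z : 'M[R]_(n, l)) x :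
  gram B Y Y = - 1%:M -> gram B Y Z = 0 -> gram B Z Y = 0 -> gram B Z Z = 0 ->
  x \in colspan (row_mx Y Z) -> bform B x x <= 0.
Proof.
move=> YY YZ ZY ZZ /mem_colspan[z ->].
rewrite bformE gramMl gramMr gram_block YY YZ ZY ZZ -[z]vsubmxK tr_col_mx.
rewrite mul_block_col !mul0mx !addr0 mul_row_col mulmx0 addr0 mulNmx mulmxN mul1mx.
by rewrite mxE oppr_le0 sqnorm_ge0.
Qed.

Lemma rank_row_mxl n k l (X : 'M[R]_(n, k)) (Y : 'M[R]_(n, l)) :
  \rank (row_mx X Y) = (k + l)%N -> \rank X = k.
Proof.
move=> /rank_injP H; apply/rank_injP => x Xx.
have := H (col_mx x 0); rewrite mul_row_col Xx mulmx0 addr0 => /(_ erefl).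
by move=> /(congr1 usubmx); rewrite col_mxKu linear0.
Qed.

Lemma rank_row_mxC n k l (X : 'M[R]_(n, k)) (Y : 'M[R]_(n, l)) :
  \rank (row_mx X Y) = (k + l)%N -> \rank (row_mx Y X) = (l + k)%N.
Proof.
move=> /rank_injP H; apply/rank_injP => x; rewrite -[x]vsubmxK mul_row_col => E.
have := H (col_mx (dsubmx x) (usubmx x)); rewrite mul_row_col addrC E => /(_ erefl).
rewrite -[0]vsubmxK !linear0 => /eq_col_mx[-> ->].
by rewrite col_mx0.
Qed.

(** Two applications of [is_max_posdef]: [X] against the span of [Y] and [Z] for the form, and [Y]
    against the span of [X] and [Z] for its negative. *)
Lemma has_signature_cols n (B : 'M[R]_n) a b c (X : 'M[R]_(n, a)) (Y : 'M[R]_(n, b))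
    (Z : 'M[R]_(n, c)) :
  B^T = B -> \rank (row_mx (row_mx X Y) Z) = (a + b + c)%N ->
  gram B X X = 1%:M -> gram B Y Y = - 1%:M -> gram B X Y = 0 ->
  gram B X Z = 0 -> gram B Y Z = 0 -> gram B Z Z = 0 ->
  has_signature B (colspan (row_mx (row_mx X Y) Z)) a b.
Proof.
move=> sB rk XX YY XY XZ YZ ZZ.
have ZX := gram_eq0C sB XZ; have ZY := gram_eq0C sB YZ.
have rXY := rank_row_mxl rk; have rX := rank_row_mxl rXY.
have rY := rank_row_mxl (rank_row_mxC rXY).
have dW : \dim (colspan (row_mx (row_mx X Y) Z)) = (a + b + c)%N by apply/dim_colspan.
have memW x y z : X *m x + Y *m y + Z *m z \in colspan (row_mx (row_mx X Y) Z).
  by apply/mem_colspan; exists (col_mx (col_mx x y) z); rewrite !mul_row_col.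
have inj := (rank_injP _).1 rk.
have rk2 : \rank (row_mx Y Z) = (b + c)%N.
  apply/rank_injP => v; rewrite -[v]vsubmxK mul_row_col => E.
  have := inj (col_mx (col_mx 0 (usubmx v)) (dsubmx v)).
  rewrite !mul_row_col mulmx0 add0r E => /(_ erefl).
  move=> H; have := congr1 (@dsubmx _ _ _ _) H; have := congr1 (@dsubmx _ _ _ _ \o @usubmx _ _ _ _) H.
  by rewrite /= !col_mxKd !col_mxKu !col_mxKd !linear0 => -> ->; rewrite col_mx0.
have rk1 : \rank (row_mx X Z) = (a + c)%N.
  apply/rank_injP => v; rewrite -[v]vsubmxK mul_row_col => E.
  have := inj (col_mx (col_mx (usubmx v) 0) (dsubmx v)).
  rewrite !mul_row_col mulmx0 addr0 E => /(_ erefl).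
  move=> H; have := congr1 (@dsubmx _ _ _ _) H; have := congr1 (@usubmx _ _ _ _ \o @usubmx _ _ _ _) H.
  by rewrite /= !col_mxKd !col_mxKu !linear0 => -> ->; rewrite col_mx0.
split.
- apply: (@is_max_posdef _ _ _ _ (colspan X) (colspan (row_mx Y Z))).
  + exact/dim_colspan.
  + by apply/subvP => x /mem_colspan[z ->]; have := memW z 0 0; rewrite !mulmx0 !addr0.
  + by apply/subvP => x /colspan_row_mx_mem[y [z ->]]; have := memW 0 y z; rewrite mulmx0 add0r.
  + exact: posdef_colspan.
  + by move=> x; exact: semineg_colspan.
  + by rewrite dW (dim_colspan X).2 // (dim_colspan (row_mx Y Z)).2 // addnA.
- apply: (@is_max_posdef _ _ _ _ (colspan Y) (colspan (row_mx X Z))).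
  + exact/dim_colspan.
  + by apply/subvP => x /mem_colspan[z ->]; have := memW 0 z 0; rewrite !mulmx0 addr0 add0r.
  + by apply/subvP => x /colspan_row_mx_mem[y [z ->]]; have := memW y 0 z; rewrite mulmx0 addr0.
  + by apply: posdef_colspan; rewrite gramN YY opprK.
  + by move=> x; apply: semineg_colspan; rewrite gramN ?XX // ?XZ ?ZX ?ZZ oppr0.
  + by rewrite dW (dim_colspan Y).2 // (dim_colspan (row_mx X Z)).2 // addnA (addnC b).
Qed.

End Gram.

(** * Signatures and adapted frames *)

Section Frames.
Variable R : realType.
Implicit Types (n k l a b c : nat).

Lemma addr_half : 2^-1 + 2^-1 = 1 :> R.
Proof. by rewrite -mulr2n -[_ *+ 2]mulr_natr mulVf ?pnatr_eq0. Qed.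

Lemma gram_unit_rank n k (B : 'M[R]_n) (E : 'M[R]_(n, k)) :
  gram B E E \in unitmx -> \rank E = k.
Proof.
move=> Gu; apply/rank_injP => x Ex0; rewrite -[x](mulKmx Gu) -gramMr Ex0.
by rewrite /gram !mulmx0.
Qed.

(** Any completion [C] of [E] to a basis is corrected by its orthogonal projection onto the span of
    [E], which exists because the Gram matrix of [E] is invertible. *)
Lemma orth_complement n k (B : 'M[R]_n) (E : 'M[R]_(n, k)) :
  gram B E E \in unitmx -> exists l (K : 'M[R]_(n, l)),
    [/\ (k + l)%N = n, \rank (row_mx E K) = (k + l)%N & gram B E K = 0].
Proof.
move=> Gu; have [l [C [kl rC]]] := complete_cols (gram_unit_rank Gu).
exists l, (C - E *m (invmx (gram B E E) *m gram B E C)); split=> //; last first.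
  by rewrite gramDr gramNr gramMr mulKVmx // subrr.
apply/rank_injP => x; rewrite -[x]vsubmxK mul_row_col mulmxBl.
set y := usubmx x; set z := dsubmx x; set M := invmx _ *m _ => H.
have := (rank_injP _).1 rC (col_mx (y - M *m z) z).
rewrite mul_row_col mulmxBr mulmxA -addrA [- _ + _]addrC H => /(_ erefl).
rewrite -[0]vsubmxK !linear0 => /eq_col_mx[E1 E2].
by move: E1; rewrite E2 mulmx0 subr0 => ->; rewrite col_mx0.
Qed.

Definition diag_cols n a b c (B : 'M[R]_n) (X : 'M[R]_(n, a)) (Y : 'M[R]_(n, b))
    (Z : 'M[R]_(n, c)) :=
  [/\ gram B X X = 1%:M, gram B Y Y = - 1%:M, gram B Z Z = 0,
      gram B X Y = 0 & gram B X Z = 0 /\ gram B Y Z = 0].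

Lemma diag_cols_mul n m a b c (B : 'M[R]_n) (A : 'M[R]_(n, m)) (X : 'M[R]_(m, a))
    (Y : 'M[R]_(m, b)) (Z : 'M[R]_(m, c)) :
  diag_cols (gram B A A) X Y Z -> diag_cols B (A *m X) (A *m Y) (A *m Z).
Proof.
have E p q (P : 'M[R]_(m, p)) (Q : 'M[R]_(m, q)) :
    gram B (A *m P) (A *m Q) = gram (gram B A A) P Q.
  by rewrite gramMl gramMr /gram !mulmxA.
by move=> [XX YY ZZ XY [XZ YZ]]; split; rewrite ?E //; split; rewrite E.
Qed.

(** Pairing a linear relation with [X] and with [Y] kills their coefficients. The form cannot see
    [Z], whose independence has to be assumed. *)
Lemma diag_cols_rank n a b c (B : 'M[R]_n) (X : 'M[R]_(n, a)) (Y : 'M[R]_(n, b))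
    (Z : 'M[R]_(n, c)) : B^T = B ->
  diag_cols B X Y Z -> \rank Z = c -> \rank (row_mx (row_mx X Y) Z) = (a + b + c)%N.
Proof.
move=> sB [XX YY ZZ XY [XZ YZ]] rZ; apply/rank_injP => x.
rewrite -[x]vsubmxK -[usubmx x]vsubmxK !mul_row_col.
set x1 := usubmx _; set x2 := dsubmx (usubmx x); set x3 := dsubmx _ => H.
have x10 : x1 = 0.
  have := congr1 (gram B X) H; rewrite !gramDr !gramMr XX XY XZ !mul0mx !addr0 mul1mx => ->.
  by rewrite /gram mulmx0.
have x20 : x2 = 0.
  have := congr1 (gram B Y) H; rewrite !gramDr !gramMr YY YZ (gram_eq0C sB XY).
  rewrite !mul0mx add0r addr0 mulNmx mul1mx /gram mulmx0 => /eqP.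
  by rewrite oppr_eq0 => /eqP.
have x30 : x3 = 0.
  by apply: (rank_injP _).1 rZ _ _; move: H; rewrite x10 x20 !mulmx0 !add0r.
by rewrite x10 x20 x30 !col_mx0.
Qed.

(** Polarization on the sums of two standard basis vectors. *)
Lemma sym_form_eq0 n (S : 'M[R]_n) : S^T = S ->
  (forall v : 'cV_n, gram S v v = 0) -> S = 0.
Proof.
move=> sS H; apply/matrixP => i j; rewrite mxE.
have E (k l : 'I_n) : gram S (delta_mx k 0 : 'cV_n) (delta_mx l 0 : 'cV_n) 0 0 = S k l.
  by rewrite /gram trmx_delta -rowE -colE !mxE.
have := congr1 (fun M : 'M[R]_1 => M 0 0) (H (delta_mx i 0 + delta_mx j 0)).
rewrite gramDl !gramDr !H addr0 add0r mxE !E mxE.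
have -> : S j i = S i j by rewrite -{1}sS mxE.
by rewrite -mulr2n => /eqP; rewrite mulrn_eq0 /= => /eqP.
Qed.

Lemma unit_vector n (S : 'M[R]_n) : S^T = S -> S != 0 ->
  exists v : 'cV_n, gram S v v = 1%:M \/ gram S v v = - 1%:M.
Proof.
move=> sS S0; have [v v0] : exists v : 'cV_n, gram S v v 0 0 != 0.
  apply/not_existsP => H; move/eqP: S0; apply; apply: sym_form_eq0 => // v.
  by apply: scalar11; rewrite [RHS]mxE; apply/eqP; have /negP := H v; rewrite negbK.
set g := gram S v v 0 0 in v0 *; pose t := (Num.sqrt `|g|)^-1.
have tt : t * t = `|g|^-1.
  by rewrite /t -invfM -expr2 sqr_sqrtr.
exists (t *: v); rewrite gramZl gramZr scalerA tt (mx11_scalar (gram S v v)) -/g.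
rewrite scale_scalar_mx; have [gn|gp|g0] := ltgtP g 0; last by rewrite g0 eqxx in v0.
- by right; rewrite ltr0_norm // invrN mulNr mulVf // raddfN.
- by left; rewrite gtr0_norm // mulVf.
Qed.

(** Induction on the dimension: a nonzero form has a vector of square 1 or -1; it is split off and
    the induction continues on its orthogonal complement. Once the form is 0, every remaining vector
    is a null vector. *)
Lemma sylvester m (S : 'M[R]_m) : S^T = S ->
  exists a b c (X : 'M[R]_(m, a)) (Y : 'M[R]_(m, b)) (Z : 'M[R]_(m, c)),
    [/\ (a + b + c)%N = m, \rank Z = c & diag_cols S X Y Z].
Proof.
elim: m S => [|m IH] S sS.
  exists 0%N, 0%N, 0%N, 0, 0, 0; split=> //; first by rewrite mxrank0.
  by split; rewrite ?[LHS]flatmx0 ?[RHS]flatmx0 //; split; rewrite [LHS]flatmx0.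
have [S0|S0] := eqVneq S 0.
  exists 0%N, 0%N, m.+1, 0, 0, 1%:M; split=> //; first by rewrite mxrank1.
  rewrite S0; split; last by split; rewrite [LHS]flatmx0.
  - by rewrite [LHS]flatmx0 [RHS]flatmx0.
  - by rewrite [LHS]flatmx0 [RHS]flatmx0.
  - by rewrite /gram mulmx0 mul0mx.
  - by rewrite [LHS]flatmx0.
have [v vv] := unit_vector sS S0.
have vu : gram S v v \in unitmx.
  by case: vv => ->; rewrite ?unitmx1 // -scaleN1r unitmxZ ?unitmx1 // unitrN1.
have [l [K [+ rK vK]]] := orth_complement vu; rewrite add1n => -[El]; subst l.
have sS1 : (gram S K K)^T = gram S K K by rewrite gram_tr.
have [a [b [c [X [Y [Z [abc rZ D]]]]]]] := IH _ sS1.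
have [XX YY ZZ XY [XZ YZ]] := diag_cols_mul D.
have vX k (M : 'M[R]_(m, k)) : gram S v (K *m M) = 0 by rewrite gramMr vK mul0mx.
have Xv k (M : 'M[R]_(m, k)) : gram S (K *m M) v = 0 by exact: gram_eq0C (vX _ _).
have rKZ : \rank (K *m Z) = c.
  by apply: rank_mulmx_full => //; exact: rank_row_mxl (rank_row_mxC rK).
case: vv => vv.
  exists (1 + a)%N, b, c, (row_mx v (K *m X)), (K *m Y), (K *m Z); split=> //.
    by rewrite -!addnA add1n addnA abc.
  split; first by rewrite gram_block XX vv vX Xv -scalar_mx_block.
  - by [].
  - by [].
  - by rewrite gram_rowl vX XY col_mx0.
  - by rewrite gram_rowl vX XZ col_mx0.
exists a, (1 + b)%N, c, (K *m X), (row_mx v (K *m Y)), (K *m Z); split=> //.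
  by rewrite addnCA -addnA add1n abc.
split=> //.
- by rewrite gram_block YY vv vX Xv (scalar_mx_block 1 b) opp_block_mx !oppr0.
- by rewrite gram_rowr Xv XY row_mx0.
- by rewrite gram_rowl vX YZ col_mx0.
Qed.

(** Law of inertia: the block sizes produced by [sylvester] also form a signature of [W], so they
    equal [r] and [s]. *)
Lemma signature_cols n (B : 'M[R]_n) (W : {vspace 'cV[R]_n}) r s :
  B^T = B -> has_signature B W r s ->
  exists c (X : 'M[R]_(n, r)) (Y : 'M[R]_(n, s)) (Z : 'M[R]_(n, c)),
    [/\ (r + s + c)%N = \dim W, colspan (row_mx (row_mx X Y) Z) = W,
        \rank (row_mx (row_mx X Y) Z) = (r + s + c)%N & diag_cols B X Y Z].
Proof.
move=> sB sigW; have [A rA AW] := colspan_exists (erefl (\dim W)).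
have sA : (gram B A A)^T = gram B A A by rewrite gram_tr.
have [a [b [c [X [Y [Z [abc rZ D]]]]]]] := sylvester sA.
have D' := diag_cols_mul D.
have rk := diag_cols_rank sB D' (rank_mulmx_full rA rZ).
have E : colspan (row_mx (row_mx (A *m X) (A *m Y)) (A *m Z)) = W.
  apply/eqP; rewrite eqEdim; apply/andP; split.
    by rewrite -[in X in (_ <= X)%VS]AW; apply/colspan_sub; exists (row_mx (row_mx X Y) Z); rewrite !mul_mx_row.
  by rewrite (dim_colspan _).2 // abc.
have [XX YY ZZ XY [XZ YZ]] := D'.
have := has_signature_cols sB rk XX YY XY XZ YZ ZZ.
rewrite E => /(has_signature_unique sigW)[Er Es]; subst a b.
by exists c, (A *m X), (A *m Y), (A *m Z).
Qed.

(** Gram matrix of a basis in the order (E2, E1 | E3, E4). The first half spans the subspace and the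
    second a complement, as graph coordinates require; this puts the hyperbolic pairing of E1 with
    E4 in the off-diagonal blocks. *)
Definition stdform a k c (J2 : 'M[R]_a) (J3 : 'M[R]_c) : 'M[R]_((a + k) + (c + k)) :=
  block_mx (block_mx J2 0 0 0) (block_mx 0 0 0 1%:M)
           (block_mx 0 0 0 1%:M) (block_mx J3 0 0 0).

Lemma stdform_sqr a k c (J2 : 'M[R]_a) (J3 : 'M[R]_c) :
  J2 *m J2 = 1%:M -> J3 *m J3 = 1%:M ->
  stdform k J2 J3 *m stdform k J2 J3 = 1%:M.
Proof.
move=> J22 J33; rewrite /stdform !mulmx_block !mul0mx !mulmx0 !add_block_mx.
rewrite !mulmx1 !addr0 !add0r J22 J33.
by rewrite !block_mx0 -!scalar_mx_block.
Qed.

Lemma Jform_sqr r s : Jform R r s *m Jform R r s = 1%:M.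
Proof.
rewrite /Jform mulmx_block !mul0mx !mulmx0 !addr0 !add0r mulmx1.
by rewrite mulNmx mulmxN opprK mulmx1 -scalar_mx_block.
Qed.

Lemma Jform_tr r s : (Jform R r s)^T = Jform R r s.
Proof. by rewrite /Jform tr_block_mx !trmx0 linearN /= !trmx1. Qed.

Lemma sqr1_unit a (J : 'M[R]_a) : J *m J = 1%:M -> J \in unitmx.
Proof. by move=> /mulmx1_unit[]. Qed.

End Frames.

(** * Witt bases adapted to a subspace *)

Section AdaptedFrames.
Variable R : realType.
Implicit Types (n k l a b c r s : nat).

Lemma gram_surj n m l (B : 'M[R]_n) (A : 'M[R]_(n, m)) (M : 'M[R]_(m, l)) :
  B \in unitmx -> \rank A = m -> exists Y, gram B A Y = M.
Proof.
move=> Bu rA; have : row_free (A^T *m B).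
  by rewrite /row_free mxrankMfree ?row_free_unit // mxrank_tr rA.
by move=> /row_freeP[C EC]; exists (C *m M); rewrite /gram mulmxA EC mul1mx.
Qed.

Lemma gram_inj n m l (B : 'M[R]_n) (A : 'M[R]_(n, m)) (X : 'M[R]_(n, l)) :
  B \in unitmx -> m = n -> \rank A = m -> gram B A X = 0 -> X = 0.
Proof.
move=> Bu mn rA; have [A' _ AA] := rank_rinv mn rA.
move=> /(congr1 (mulmx A'^T)); rewrite /gram !mulmxA -trmx_mul AA trmx1 mul1mx mulmx0.
by move=> /(congr1 (mulmx (invmx B))); rewrite mulKmx // mulmx0.
Qed.

(** Nondegeneracy gives [Y] dual to [E1] and orthogonal to [E2]. Subtracting [E1] times half the
    Gram matrix of [Y] makes it isotropic, and leaves the pairings with [E1] and [E2] unchanged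
    since [E1] is orthogonal to both. *)
Lemma hyperbolic_dual n a k (B : 'M[R]_n) (E2 : 'M[R]_(n, a)) (E1 : 'M[R]_(n, k)) :
  B^T = B -> B \in unitmx -> \rank (row_mx E2 E1) = (a + k)%N ->
  gram B E1 E1 = 0 -> gram B E2 E1 = 0 ->
  exists E4 : 'M[R]_(n, k),
    [/\ gram B E2 E4 = 0, gram B E1 E4 = 1%:M & gram B E4 E4 = 0].
Proof.
move=> sB Bu rk E11 E21; have [Y] := gram_surj (col_mx (0 : 'M[R]_(a, k)) 1%:M) Bu rk.
rewrite gram_rowl => /eq_col_mx[Y2 Y1].
have Y1' : gram B Y E1 = 1%:M by rewrite -(gram_tr _ _ sB) Y1 trmx1.
have sY : (gram B Y Y)^T = gram B Y Y by rewrite gram_tr.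
exists (Y - E1 *m (2^-1 *: gram B Y Y)); split.
- by rewrite gramDr gramNr gramMr E21 mul0mx subr0.
- by rewrite gramDr gramNr gramMr E11 mul0mx subr0.
rewrite gramDr gramNr gramMr !gramDl !gramNl !gramMl E11 Y1 Y1' mulmx0 subr0.
rewrite mulmx1 mul1mx linearZ /= sY -addrA -opprD -scalerDl.
by rewrite [2^-1 + _](_ : _ = 1) ?scale1r ?subrr // -[2^-1]mul1r -splitr.
Qed.

(** The null vectors that [sylvester] finds in the span of [K] are orthogonal to [K] and to [E],
    hence to everything, so there are none. *)
Lemma nondegenerate_complement n m l (B : 'M[R]_n) (E : 'M[R]_(n, m))
    (K : 'M[R]_(n, l)) :
  B^T = B -> B \in unitmx -> (m + l)%N = n -> \rank (row_mx E K) = (m + l)%N ->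
  gram B E K = 0 ->
  exists r s (X : 'M[R]_(l, r)) (Y : 'M[R]_(l, s)),
    [/\ (r + s)%N = l, gram B (K *m X) (K *m X) = 1%:M,
        gram B (K *m Y) (K *m Y) = - 1%:M & gram B (K *m X) (K *m Y) = 0].
Proof.
move=> sB Bu ml rk EK; have sK : (gram B K K)^T = gram B K K by rewrite gram_tr.
have [r [s [c [X [Y [Z [rsc rZ D]]]]]]] := sylvester sK.
have [XX YY ZZ XY [XZ YZ]] := D.
have KZ0 : gram B K (K *m Z) = 0.
  rewrite gramMr; pose P := row_mx (row_mx X Y) Z.
  have rP : \rank P = (r + s + c)%N := diag_cols_rank sK D rZ.
  have [P' _ PP] := rank_rinv rsc rP.
  have : P^T *m (gram B K K *m Z) = 0.
    by rewrite mulmxA -[LHS]/(gram (gram B K K) P Z) /P !gram_rowl XZ YZ ZZ !col_mx0.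
  move=> /(congr1 (mulmx P'^T)); rewrite mulmxA -trmx_mul PP trmx1 mul1mx => ->.
  by rewrite mulmx0.
have KZ : K *m Z = 0.
  apply: (gram_inj Bu ml rk); rewrite gram_rowl KZ0 gramMr EK mul0mx.
  exact: col_mx0.
have c0 : c = 0%N.
  rewrite -rZ -(mulKmx (unitmx1 _ _) Z).
  have rK : \rank K = l := rank_row_mxl (rank_row_mxC rk).
  have -> : Z = 0 by apply: (rank_inj rK); rewrite KZ mulmx0.
  by rewrite !mulmx0 mxrank0.
have [XX' YY' _ XY' _] := diag_cols_mul D.
by exists r, s, X, Y; split=> //; rewrite -rsc c0 addn0.
Qed.

Lemma gram_stdform n a k c (B : 'M[R]_n) J2 J3 (E2 : 'M[R]_(n, a))
    (E1 : 'M[R]_(n, k)) (E3 : 'M[R]_(n, c)) (E4 : 'M[R]_(n, k)) : B^T = B ->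
  gram B E2 E2 = J2 -> gram B E3 E3 = J3 -> gram B E1 E1 = 0 -> gram B E4 E4 = 0 ->
  gram B E1 E4 = 1%:M -> gram B E2 E1 = 0 -> gram B E2 E3 = 0 -> gram B E2 E4 = 0 ->
  gram B E1 E3 = 0 -> gram B E4 E3 = 0 ->
  gram B (row_mx (row_mx E2 E1) (row_mx E3 E4))
         (row_mx (row_mx E2 E1) (row_mx E3 E4)) = stdform k J2 J3.
Proof.
move=> sB h22 h33 h11 h44 h14 h21 h23 h24 h13 h43.
have h41 : gram B E4 E1 = 1%:M by rewrite -(gram_tr _ _ sB) h14 trmx1.
rewrite !gram_block h22 h33 h11 h44 h14 h21 h23 h24 h13 h43 h41.
rewrite (gram_eq0C sB h21) (gram_eq0C sB h23) (gram_eq0C sB h24) (gram_eq0C sB h13).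
by rewrite (gram_eq0C sB h43).
Qed.

Lemma stdform_gram n a k c (B : 'M[R]_n) J2 J3 (E2 : 'M[R]_(n, a))
    (E1 : 'M[R]_(n, k)) (E3 : 'M[R]_(n, c)) (E4 : 'M[R]_(n, k)) :
  gram B (row_mx (row_mx E2 E1) (row_mx E3 E4))
         (row_mx (row_mx E2 E1) (row_mx E3 E4)) = stdform k J2 J3 ->
  [/\ [/\ gram B E2 E2 = J2, gram B E2 E1 = 0, gram B E2 E3 = 0 & gram B E2 E4 = 0],
      [/\ gram B E1 E2 = 0, gram B E1 E1 = 0, gram B E1 E3 = 0 & gram B E1 E4 = 1%:M],
      [/\ gram B E3 E2 = 0, gram B E3 E1 = 0, gram B E3 E3 = J3 & gram B E3 E4 = 0]
    & [/\ gram B E4 E2 = 0, gram B E4 E1 = 1%:M, gram B E4 E3 = 0 & gram B E4 E4 = 0]].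
Proof.
rewrite !gram_block => /eq_block_mx[/eq_block_mx[? ? ? ?] /eq_block_mx[? ? ? ?]].
by move=> /eq_block_mx[? ? ? ?] /eq_block_mx[? ? ? ?].
Qed.

Lemma frame_inv n a k c (B : 'M[R]_n) (J2 : 'M[R]_a) (J3 : 'M[R]_c) F :
  J2 *m J2 = 1%:M -> J3 *m J3 = 1%:M -> (a + k + (c + k))%N = n ->
  gram B F F = stdform k J2 J3 ->
  exists2 F', F' *m F = 1%:M & F *m F' = 1%:M.
Proof.
move=> J22 J33 dn FF; exists (stdform k J2 J3 *m F^T *m B).
  by rewrite -!mulmxA (mulmxA F^T) -/(gram B F F) FF stdform_sqr.
apply: rect_mulmx1C => //.
by rewrite -!mulmxA (mulmxA F^T) -/(gram B F F) FF stdform_sqr.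
Qed.

Lemma stdform_signature n r s k r' s' (B : 'M[R]_n) F : B^T = B ->
  (r + s + k + (r' + s' + k))%N = n ->
  gram B F F = stdform k (Jform R r s) (Jform R r' s') ->
  has_signature B fullv (r + k + r') (s + k + s').
Proof.
move=> sB dn FF.
(* Each hyperbolic pair (E1, E4) splits into E1 + E4 / 2 and E1 - E4 / 2. *)
pose Tx : 'M[R]_(r + s + k + (r' + s' + k), r + k + r') :=
  col_mx (col_mx (col_mx (row_mx (row_mx 1%:M 0) 0) 0) (row_mx (row_mx 0 1%:M) 0))
    (col_mx (col_mx (row_mx 0 1%:M) 0) (2^-1 *: row_mx (row_mx 0 1%:M) 0)).
pose Ty : 'M[R]_(r + s + k + (r' + s' + k), s + k + s') :=
  col_mx (col_mx (col_mx 0 (row_mx (row_mx 1%:M 0) 0)) (row_mx (row_mx 0 1%:M) 0))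
    (col_mx (col_mx 0 (row_mx 0 1%:M)) (- 2^-1 *: row_mx (row_mx 0 1%:M) 0)).
have SX : stdform k (Jform R r s) (Jform R r' s') *m Tx =
  col_mx (col_mx (col_mx (row_mx (row_mx 1%:M 0) 0) 0) (2^-1 *: row_mx (row_mx 0 1%:M) 0))
    (col_mx (col_mx (row_mx 0 1%:M) 0) (row_mx (row_mx 0 1%:M) 0)).
  rewrite /stdform /Jform /Tx !mul_block_col !mul0mx !mulmx0 !mul1mx.
  by rewrite !addr0 !add0r !add_col_mx !addr0 !add0r.
have SY : stdform k (Jform R r s) (Jform R r' s') *m Ty =
  col_mx (col_mx (col_mx 0 (- row_mx (row_mx 1%:M 0) 0)) (- 2^-1 *: row_mx (row_mx 0 1%:M) 0))
    (col_mx (col_mx 0 (- row_mx 0 1%:M)) (row_mx (row_mx 0 1%:M) 0)).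
  rewrite /stdform /Jform /Ty !mul_block_col !mul0mx !mulmx0 !mulNmx !mul1mx.
  by rewrite !addr0 !add0r !add_col_mx !addr0 !add0r.
have XX : gram B (F *m Tx) (F *m Tx) = 1%:M.
  rewrite gramMl gramMr FF SX /Tx !tr_col_mx !mul_row_col !trmx0 !mul0mx.
  rewrite !addr0 [(2^-1 *: _)^T]linearZ /= -scalemxAl -scalemxAr addrACA -scalerDl addr_half scale1r.
  rewrite !tr_row_mx !trmx0 !trmx1 !mul_col_row !(mulmx0, mul0mx, mulmx1).
  rewrite !add_block_mx !(addr0, add0r) !add_block_mx !(addr0, add0r).
  by rewrite -!scalar_mx_block.
have YY : gram B (F *m Ty) (F *m Ty) = - 1%:M.
  rewrite gramMl gramMr FF SY /Ty !tr_col_mx !mul_row_col !trmx0 !mul0mx.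
  rewrite !add0r [(- 2^-1 *: _)^T]linearZ /= -scalemxAl -scalemxAr !mulmxN.
  rewrite addrACA -scalerDl -[- 2^-1 - _]opprD addr_half scaleN1r -!opprD; congr (- _).
  rewrite !tr_row_mx !trmx0 !trmx1 !mul_col_row !(mulmx0, mul0mx, mulmx1).
  rewrite !add_block_mx !(addr0, add0r) !add_block_mx !(addr0, add0r).
  by rewrite -!scalar_mx_block.
have XY : gram B (F *m Tx) (F *m Ty) = 0.
  rewrite gramMl gramMr FF SY /Tx !tr_col_mx !mul_row_col !trmx0 !mul0mx.
  rewrite !(mulmx0, add0r, addr0) [(2^-1 *: _)^T]linearZ /= -scalemxAl -scalemxAr.
  by rewrite -scalerDl addNr scale0r.
(* The form is nondegenerate, so the block of null vectors is empty. *)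
have rk : \rank (row_mx (row_mx (F *m Tx) (F *m Ty)) (0 : 'M[R]_(n, 0))) =
    (r + k + r' + (s + k + s') + 0)%N.
  apply: (@diag_cols_rank _ _ _ _ _ B) => //; last by rewrite mxrank0.
  by split; rewrite ?XX ?YY ?XY // /gram ?mulmx0 //; split; rewrite mulmx0.
have := has_signature_cols sB rk XX YY XY _ _ _.
rewrite (_ : colspan (row_mx _ _) = fullv).
  by apply; rewrite /gram mulmx0.
apply/eqP; rewrite eqEdim subvf (dim_colspan _).2 // dimvf dim_matrix.
by rewrite [(n * 1)%R]muln1 -dn; lia.
Qed.

(** Witt decomposition relative to [W]. The values of [p] and [q] follow by computing the signature
    of the whole space in the new basis and comparing. *)
Lemma adapted_frame_exists n p q r s k (B : 'M[R]_n) (W : {vspace 'cV[R]_n}) :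
  B^T = B -> B \in unitmx -> has_signature B fullv p q ->
  \dim W = (r + s + k)%N -> has_signature B W r s ->
  exists r' s' (F : 'M[R]_(n, r + s + k + (r' + s' + k))),
    [/\ (r + s + k + (r' + s' + k))%N = n, colspan (lsubmx F) = W,
        gram B F F = stdform k (Jform R r s) (Jform R r' s'),
        p = (r + k + r')%N & q = (s + k + s')%N].
Proof.
move=> sB Bu Bsig dW Wsig.
have [c [X [Y [Z [rsc EW rk D]]]]] := signature_cols sB Wsig.
have ck : c = k by move: rsc; rewrite dW; lia.
subst c; have [XX YY ZZ XY [XZ YZ]] := D.
have [E2 [EE2 h22 h2Z]] : exists E2, [/\ E2 = row_mx X Y,
    gram B E2 E2 = Jform R r s & gram B E2 Z = 0].
  eexists; split; first by [].
    by rewrite gram_block XX YY XY (gram_eq0C sB XY).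
  by rewrite gram_rowl XZ YZ col_mx0.
rewrite -EE2 in rk EW.
have [E4 [h24 h14 h44]] := hyperbolic_dual sB Bu rk ZZ h2Z.
have h41 : gram B E4 Z = 1%:M by rewrite -(gram_tr _ _ sB) h14 trmx1.
(* The span of [E2] and the hyperbolic pairs is nondegenerate, so its orthogonal complement can be
   split off and diagonalized to give [E3]. *)
pose E := row_mx E2 (row_mx Z E4).
have EE : gram B E E = block_mx (Jform R r s) 0 0 (block_mx 0 1%:M 1%:M 0).
  rewrite /E gram_block gram_block gram_rowr gram_rowl h22 ZZ h44 h14 h41 h2Z h24.
  by rewrite (gram_eq0C sB h2Z) (gram_eq0C sB h24) row_mx0 col_mx0.
have EEu : gram B E E \in unitmx.
  apply: (@sqr1_unit _ _ (gram B E E)).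
  rewrite EE; move: (Jform R r s) (Jform_sqr R r s) => J JJ.
  rewrite !mulmx_block !(mulmx0, mul0mx, addr0, add0r, mulmx1) JJ.
  by rewrite -!scalar_mx_block.
have [l [K [dl rK EK]]] := orth_complement EEu.
have [r' [s' [X3 [Y3 [rs XX3 YY3 XY3]]]]] := nondegenerate_complement sB Bu dl rK EK.
pose E3 := K *m row_mx X3 Y3.
have h33 : gram B E3 E3 = Jform R r' s'.
  by rewrite /E3 mul_mx_row gram_block XX3 YY3 XY3 (gram_eq0C sB XY3).
move: EK; rewrite gram_rowl gram_rowl -[0]vsubmxK linear0 => /eq_col_mx[K2].
rewrite -[dsubmx 0]vsubmxK !linear0 => /eq_col_mx[K1 K4].
exists r', s', (row_mx (row_mx E2 Z) (row_mx E3 E4)).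
have dn : (r + s + k + (r' + s' + k))%N = n by lia.
have FF : gram B (row_mx (row_mx E2 Z) (row_mx E3 E4))
    (row_mx (row_mx E2 Z) (row_mx E3 E4)) = stdform k (Jform R r s) (Jform R r' s').
  by apply: gram_stdform => //; rewrite gramMr ?K2 ?K1 ?K4 mul0mx.
have [Ep Eq] := has_signature_unique Bsig (stdform_signature sB dn FF).
by split=> //; rewrite row_mxKl.
Qed.

Lemma gram_ul n a1 a2 b1 b2 (B : 'M[R]_n) (X : 'M[R]_(n, a1 + a2)) (Y : 'M[R]_(n, b1 + b2)) :
  gram B (lsubmx X) (lsubmx Y) = ulsubmx (gram B X Y).
Proof. by rewrite -{2}[X]hsubmxK -{2}[Y]hsubmxK gram_block block_mxKul. Qed.

Lemma gram_ur n a1 a2 b1 b2 (B : 'M[R]_n) (X : 'M[R]_(n, a1 + a2)) (Y : 'M[R]_(n, b1 + b2)) :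
  gram B (lsubmx X) (rsubmx Y) = ursubmx (gram B X Y).
Proof. by rewrite -{2}[X]hsubmxK -{2}[Y]hsubmxK gram_block block_mxKur. Qed.

Lemma gram_dl n a1 a2 b1 b2 (B : 'M[R]_n) (X : 'M[R]_(n, a1 + a2)) (Y : 'M[R]_(n, b1 + b2)) :
  gram B (rsubmx X) (lsubmx Y) = dlsubmx (gram B X Y).
Proof. by rewrite -{2}[X]hsubmxK -{2}[Y]hsubmxK gram_block block_mxKdl. Qed.

Lemma gram_dr n a1 a2 b1 b2 (B : 'M[R]_n) (X : 'M[R]_(n, a1 + a2)) (Y : 'M[R]_(n, b1 + b2)) :
  gram B (rsubmx X) (rsubmx Y) = drsubmx (gram B X Y).
Proof. by rewrite -{2}[X]hsubmxK -{2}[Y]hsubmxK gram_block block_mxKdr. Qed.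

(** In an orthonormal basis, [r] positive and [s] negative vectors are kept; [k] further positive
    vectors, each added to a further negative one, give the null directions. *)
Lemma signature_subspace_exists n r k r' s s' (B : 'M[R]_n) :
  B^T = B -> has_signature B fullv (r + k + r') (s + k + s') ->
  exists W, \dim W = (r + s + k)%N /\ has_signature B W r s.
Proof.
move=> sB Bsig; have [c [X [Y [Z [_ _ _ [XX YY _ XY _]]]]]] := signature_cols sB Bsig.
pose X1 := lsubmx (lsubmx X); pose X2 := rsubmx (lsubmx X).
pose Y1 := lsubmx (lsubmx Y); pose Y2 := rsubmx (lsubmx Y).
have XY' : gram B (lsubmx X) (lsubmx Y) = 0 by rewrite gram_ul XY /ulsubmx !linear0.
have XX' : gram B (lsubmx X) (lsubmx X) = 1%:M.
  by rewrite gram_ul XX scalar_mx_block block_mxKul.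
have YY' : gram B (lsubmx Y) (lsubmx Y) = - 1%:M.
  by rewrite gram_ul YY scalar_mx_block opp_block_mx block_mxKul.
have h11 : gram B X1 X1 = 1%:M by rewrite gram_ul XX' scalar_mx_block block_mxKul.
have h12 : gram B X1 X2 = 0 by rewrite gram_ur XX' scalar_mx_block block_mxKur.
have h22 : gram B X2 X2 = 1%:M by rewrite gram_dr XX' scalar_mx_block block_mxKdr.
have k11 : gram B Y1 Y1 = - 1%:M.
  by rewrite gram_ul YY' scalar_mx_block opp_block_mx block_mxKul.
have k12 : gram B Y1 Y2 = 0.
  by rewrite gram_ur YY' scalar_mx_block opp_block_mx block_mxKur oppr0.
have k22 : gram B Y2 Y2 = - 1%:M.
  by rewrite gram_dr YY' scalar_mx_block opp_block_mx block_mxKdr.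
have l11 : gram B X1 Y1 = 0 by rewrite gram_ul XY' /ulsubmx !linear0.
have l12 : gram B X1 Y2 = 0 by rewrite gram_ur XY' /ursubmx !linear0.
have l21 : gram B X2 Y1 = 0 by rewrite gram_dl XY' /dlsubmx !linear0.
have l22 : gram B X2 Y2 = 0 by rewrite gram_dr XY' /drsubmx !linear0.
have D : diag_cols B X1 Y1 (X2 + Y2).
  split=> //; rewrite ?gramDl ?gramDr.
    by rewrite h22 k22 l22 (gram_eq0C sB l22) addr0 add0r subrr.
  by rewrite h12 l12 k12 (gram_eq0C sB l21) !addr0.
have rZ : \rank (X2 + Y2)%R = k.
  apply/rank_injP => z E0.
  have : gram B X2 ((X2 + Y2) *m z) = 0 by rewrite E0 /gram mulmx0.
  by rewrite gramMr gramDr h22 l22 addr0 mul1mx.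
have rk := diag_cols_rank sB D rZ.
exists (colspan (row_mx (row_mx X1 Y1) (X2 + Y2))); split; first exact/dim_colspan.
by have [? ? ? ? [? ?]] := D; apply: has_signature_cols.
Qed.

End AdaptedFrames.

(** * Smooth orthonormalization *)

Section SmoothOrthonormalization.
Variable R : realType.

(* Openness and smoothness on spaces of matrices are tested on smooth families
   parametrized by open subsets of the R^d. *)
Definition fam_open m n (Om : set 'M[R]_(m, n)) :=
  forall d (U : set 'rV[R]_d) (g : 'rV[R]_d -> 'M[R]_(m, n)),
    sfam U g -> open (U `&` [set y | Om (g y)]).

Definition fam_smooth m n m' n' (Om : set 'M[R]_(m, n))
    (f : 'M[R]_(m, n) -> 'M[R]_(m', n')) :=
  forall d (U : set 'rV[R]_d) (g : 'rV[R]_d -> 'M[R]_(m, n)),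
    sfam U g -> (forall y, U y -> Om (g y)) -> sfam U (fun y => f (g y)).

(** A smooth choice of basis change that carries a Gram matrix [G] near [J] back to [J]. The
    normalization [P J = 1%:M] makes local sections built from it pass through the chosen base
    point. *)
Definition smooth_orthonormalization a (J : 'M[R]_a) (Om : set 'M[R]_a)
    (P : 'M[R]_a -> 'M[R]_a) :=
  [/\ Om J, P J = 1%:M,
      forall G, G^T = G -> Om G -> gram G (P G) (P G) = J,
      fam_open Om & fam_smooth Om P].

(** Here [y * x] is the absolute value of [x]: rescaling a vector of square [x] by its inverse
    square root yields the square [y]. *)
Lemma sqrt_inv_sqr (x y : R) : y = 1 \/ y = -1 -> 0 < y * x ->
  (Num.sqrt (y * x))^-1 * x * (Num.sqrt (y * x))^-1 = y.
Proof.
move=> y1 yx; have x0 : x != 0 by apply: contraTN yx => /eqP ->; rewrite mulr0 ltxx.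
have yy : y * y = 1 by case: y1 => ->; rewrite ?mulrNN mulr1.
have y0 : y != 0 by apply: contra_eq_neq yy => ->; rewrite mulr0 eq_sym oner_eq0.
rewrite mulrAC -invfM -expr2 sqr_sqrtr ?ltW // invfM mulfVK //.
by rewrite -[RHS]mul1r -[1](mulVf y0) -mulrA yy mulr1.
Qed.

(* One step of the Gram-Schmidt process: split off the first coordinate by its
   Schur complement. *)
Lemma block_orthonormal a (g t y : R) (w : 'rV[R]_a) (S p J : 'M[R]_a) :
  g != 0 -> t * g * t = y -> gram S p p = J ->
  let G := block_mx g%:M w w^T (S + g^-1 *: (w^T *m w)) in
  let P := block_mx t%:M (- g^-1 *: (w *m p)) 0 p in
  gram G P P = block_mx y%:M 0 0 J.
Proof.
move=> g0 tgt gramp G P.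
have GP : G *m P = block_mx (g * t)%:M 0 (t *: w^T) (S *m p).
  rewrite mulmx_block !mulmx0 !addr0 -scalar_mxM mul_scalar_mx scalerA mulrN mulfV //.
  rewrite scaleN1r addNr mul_mx_scalar mulmxDl -scalemxAr -scalemxAl mulmxA scaleNr.
  by rewrite addrCA addNr addr0.
rewrite /gram -mulmxA GP tr_block_mx mulmx_block trmx0 !mul0mx !mulmx0 !add0r !addr0.
rewrite tr_scalar_mx -scalar_mxM mulrA tgt mulmxA -[X in block_mx _ _ _ X]/(gram S p p) gramp.
congr (block_mx _ _ _ _).
rewrite scaleNr linearN linearZ /= trmx_mul mulNmx mul_mx_scalar -scalemxAr.
by rewrite scalerA mulrAC mulfV // mul1r addNr.
Qed.

(** Gram-Schmidt for an indefinite form. The domain [Om'] asks that each successive pivot have the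
    sign prescribed by [e], which replaces definiteness: it keeps the square roots and inverses
    smooth, and it holds at [diag_mx e], whose pivots are the entries of [e]. *)
Lemma smooth_orthonormalization_diag a (e : 'rV[R]_a) :
  (forall i, e 0 i = 1 \/ e 0 i = -1) ->
  exists Om P, smooth_orthonormalization (diag_mx e) Om P.
Proof.
elim: a e => [|a IH] e e1.
  exists setT, (fun=> 1%:M); split=> //.
  - by move=> G _ _; rewrite [LHS]flatmx0 [RHS]flatmx0.
  - by move=> d U g [oU _]; rewrite (_ : _ `&` _ = U) //; apply/seteqP; split=> y // [].
  - by move=> d U g [oU _] _; exact: sfam_cst.
rewrite -[a.+1]/(1 + a)%N in e e1 *.
have e'1 i : rsubmx e 0 i = 1 \/ rsubmx e 0 i = -1 by rewrite mxE; exact: e1.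
have [Om [P [OJ PJ PG Oo Ps]]] := IH _ e'1.
pose e0 := e 0 (lshift a 0).
have e01 : e0 = 1 \/ e0 = -1 by exact: e1.
have ee : e0 * e0 = 1 by case: e01 => ->; rewrite ?mulrNN mulr1.
pose g0 (G : 'M[R]_(1 + a)) := G (lshift a 0) (lshift a 0).
pose Sch (G : 'M[R]_(1 + a)) :=
  drsubmx G - (g0 G)^-1 *: ((ursubmx G)^T *m ursubmx G).
pose Om' (G : 'M[R]_(1 + a)) := 0 < e0 * g0 G /\ Om (Sch G).
pose P' (G : 'M[R]_(1 + a)) : 'M[R]_(1 + a) :=
  block_mx ((Num.sqrt (e0 * g0 G))^-1)%:M (- (g0 G)^-1 *: (ursubmx G *m P (Sch G)))
    0 (P (Sch G)).
have De : diag_mx e = block_mx e0%:M 0 0 (diag_mx (rsubmx e)).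
  rewrite -{1}[e]hsubmxK diag_mx_row; congr (block_mx _ _ _ _).
  by apply: scalar11; rewrite !mxE eqxx.
have g0e : g0 (diag_mx e) = e0 by rewrite /g0 mxE eqxx.
have Sche : Sch (diag_mx e) = diag_mx (rsubmx e).
  by rewrite /Sch De block_mxKdr block_mxKur mulmx0 scaler0 subr0.
have g0s d (U : set 'rV[R]_d) (g : 'rV[R]_d -> 'M[R]_(1 + a)) :
    sfam U g -> rfam U (fun y => g0 (g y)) by exact: sfam_entry.
have Schs d (U : set 'rV[R]_d) (g : 'rV[R]_d -> 'M[R]_(1 + a)) :
    sfam U g -> (forall y, U y -> 0 < e0 * g0 (g y)) -> sfam U (fun y => Sch (g y)).
  move=> sg gp; apply: sfam_add; first exact: (sfam_linear _ (sfam_linear _ sg)).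
  apply: sfam_opp; apply: sfam_scale.
    apply: rfamV; last exact: g0s.
    by move=> y /gp; apply: contraTneq => ->; rewrite mulr0 ltxx.
  have sw : sfam U (fun y => ursubmx (g y)) by exact: (sfam_linear _ (sfam_linear _ sg)).
  by apply: sfam_mul => //; exact: sfam_tr.
exists Om', P'; split.
- by split; [rewrite g0e ee|rewrite Sche].
- rewrite /P' g0e Sche PJ De block_mxKur mul0mx scaler0 ee sqrtr1 invr1.
  by rewrite -scalar_mx_block.
- move=> G sG [gp OG]; set g := g0 G; set w := ursubmx G; set p := P (Sch G).
  have gn0 : g != 0 by apply: contraTneq gp => h; rewrite -/g h mulr0 ltxx.
  have sSch : (Sch G)^T = Sch G.
    rewrite /Sch linearB linearZ /= trmx_mul trmxK; congr (_ - _).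
    by rewrite trmx_drsub sG.
  have GE : G = block_mx g%:M w w^T (Sch G + g^-1 *: (w^T *m w)).
    rewrite /Sch -/g -/w subrK -{1}[G]submxK; congr (block_mx _ _ _ _).
      by apply: scalar11; rewrite !mxE eqxx.
    by rewrite /w trmx_ursub sG.
  have := PG _ sSch OG; rewrite -/p => gramp.
  have := block_orthonormal w gn0 (sqrt_inv_sqr e01 gp) gramp.
  by rewrite -De -GE.
- move=> d U g sg; have sg0 := g0s _ _ _ sg; have oU := sfam_open sg.
  have oV := rfam_pos_open (rfamM (rfam_cst e0 oU) sg0).
  have sgV := sfam_sub oV (@subIsetl _ _ _) sg.
  have := Oo _ _ _ (Schs _ _ _ sgV (fun y => @proj2 _ _)).
  by congr open; rewrite /Om' -setIA; congr (_ `&` _).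
- move=> d U g sg OU; have gp y (Uy : U y) := (OU y Uy).1.
  have sS := Schs _ _ _ sg gp; have sP := Ps _ _ _ sS (fun y Uy => (OU y Uy).2).
  have oU := sfam_open sg; have sg0 := g0s _ _ _ sg.
  apply: sfam_block_mx => //; last exact: sfam_cst.
    apply: (@sfam_eq _ _ _ _ _ (fun y => (Num.sqrt (e0 * g0 (g y)))^-1 *: 1%:M)).
      by move=> y _; rewrite scalemx1.
    apply: sfam_scale; last exact: sfam_cst.
    apply: rfamV; first by move=> y /gp h; rewrite gt_eqF // sqrtr_gt0.
    by apply: rfam_sqrt => //; apply: rfamM => //; exact: rfam_cst.
  apply: sfam_scale.
    apply: (@rfam_eq _ _ _ (fun y => -1 * (g0 (g y))^-1)); first by move=> y _; rewrite mulN1r.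
    apply: rfamM; first exact: rfam_cst.
    apply: rfamV => // y /gp; apply: contraTneq => ->; rewrite mulr0 ltxx //.
  by apply: sfam_mul => //; exact: (sfam_linear _ (sfam_linear _ sg)).
Qed.

Lemma Jform_diag r s :
  Jform R r s = diag_mx (row_mx (const_mx 1) (const_mx (-1))).
Proof. by rewrite diag_mx_row !diag_const_mx raddfN. Qed.

Lemma smooth_orthonormalization_Jform r s :
  exists Om P, smooth_orthonormalization (Jform R r s) Om P.
Proof.
rewrite Jform_diag; apply: smooth_orthonormalization_diag => i.
by rewrite -(splitK i); case: (fintype.split i) => j /=;
  rewrite ?row_mxEl ?row_mxEr mxE; [left|right].
Qed.

End SmoothOrthonormalization.

(** * Charts of Grassmannians *)

Section GrassmannCharts.
Variable R : realType.

Lemma open_locally d (U : set 'rV[R]_d) :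
  (forall x, U x -> exists V, [/\ open V, V x & V `<=` U]) -> open U.
Proof.
move=> H; rewrite openE => x Ux; have [V [oV Vx VU]] := H x Ux.
by apply: filterS VU _; exact: open_nbhs_nbhs.
Qed.

Lemma sfam_preimage_open m n d (U : set 'rV[R]_d) (f : 'rV[R]_d -> 'M[R]_(m, n))
    (A : set 'M[R]_(m, n)) :
  sfam U f -> open A -> open (U `&` [set y | A (f y)]).
Proof.
move=> [oU sf] oA; rewrite openE => x [Ux Afx].
have cf : f @ x --> f x := sf 0%N x Ux.
have nA : nbhs (f x) A by apply: open_nbhs_nbhs.
by apply: filterI; [exact: open_nbhs_nbhs|exact: cf nA].
Qed.

Lemma fam_smooth_comp m n m' n' m'' n'' (Om : set 'M[R]_(m, n)) (Om' : set 'M[R]_(m', n'))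
    (f : 'M[R]_(m, n) -> 'M[R]_(m', n')) (g : 'M[R]_(m', n') -> 'M[R]_(m'', n'')) :
  fam_smooth Om f -> (forall x, Om x -> Om' (f x)) -> fam_smooth Om' g ->
  fam_smooth Om (fun x => g (f x)).
Proof.
move=> sf fO sg d U h sh hO; apply: (sg _ _ (fun y => f (h y))); first exact: sf.
by move=> y Uy; apply: fO; exact: hO.
Qed.

Section Graph.
Variables (n i j : nat) (F : 'M[R]_(n, i + j)) (F' : 'M[R]_(i + j, n)).
Hypotheses (FF' : F' *m F = 1%:M) (F'F : F *m F' = 1%:M).

Definition graph (M : 'M[R]_(j, i)) : {vspace 'cV[R]_n} :=
  colspan (F *m col_mx 1%:M M).

(** Outside the big cell of graphs the value is the default 0; inside, [graphK] makes the choice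
    unambiguous. *)
Definition graph_coord (W : {vspace 'cV[R]_n}) : 'M[R]_(j, i) :=
  xget 0 [set M | graph M = W].

Lemma rank_graph M : \rank (F *m col_mx 1%:M M) = i.
Proof.
apply: rank_mulmx_full; first by apply/rank_linvP; exists F'.
by apply/rank_linvP; exists (row_mx 1%:M 0); rewrite mul_row_col mul1mx mul0mx addr0.
Qed.

Lemma graph_inj : injective graph.
Proof.
move=> M N /(colspan_unique (rank_graph M))[P Pu].
move=> /(congr1 (mulmx F')); rewrite !mulmxA FF' !mul1mx mul_col_mx mul1mx.
by move=> /eq_col_mx[<- ->]; rewrite mulmx1.
Qed.

Lemma graphK : cancel graph graph_coord.
Proof.
move=> M; apply: graph_inj; rewrite /graph_coord.
by case: xgetP => [N _ //|H]; case: (H M).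
Qed.

(** The big cell is where the upper block of the coordinates [F' *m A] is invertible; normalizing
    this block to the identity leaves the slope of the graph below it. *)
Lemma colspan_graph (A : 'M[R]_(n, i)) : usubmx (F' *m A) \in unitmx ->
  colspan A = graph (dsubmx (F' *m A) *m invmx (usubmx (F' *m A))).
Proof.
move=> Tu; set T := usubmx _ in Tu *; set D := dsubmx _.
have -> : A = F *m col_mx 1%:M (D *m invmx T) *m T.
  by rewrite -mulmxA mul_col_mx mul1mx mulmxKV // vsubmxK mulmxA F'F mul1mx.
by rewrite colspan_mulr.
Qed.

Lemma graph_colspan_unit (A : 'M[R]_(n, i)) M : \rank A = i ->
  colspan A = graph M -> usubmx (F' *m A) \in unitmx.
Proof.
move=> rA /(colspan_unique rA)[P Pu ->].
by rewrite !mulmxA FF' mul1mx mul_col_mx col_mxKu mul1mx.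
Qed.

Lemma Gr_carrier k (A : 'M[R]_(n, k)) : \rank A = k -> carrier (Gr R k n) (colspan A).
Proof. by move=> rA; exists A. Qed.

Lemma Gr_carrierP k W : carrier (Gr R k n) W <-> \dim W = k.
Proof.
split=> [[A [_ rA] <-]|/colspan_exists[A rA <-]]; first exact/dim_colspan.
exact: Gr_carrier.
Qed.

Lemma Gr_plot_colspan k d (U : set 'rV[R]_d) (c : 'rV[R]_d -> {vspace 'cV[R]_n})
    (g : 'rV[R]_d -> 'M[R]_(n, k)) :
  sfam U g -> (forall y, U y -> \rank (g y) = k) ->
  (forall y, U y -> c y = colspan (g y)) -> plot (Gr R k n) U c.
Proof.
move=> sg rg cg; split; first exact: sfam_open sg.
by move=> x Ux; exists U, g; split.
Qed.

Lemma Gr_plot_local k d (U : set 'rV[R]_d) (c : 'rV[R]_d -> {vspace 'cV[R]_n}) :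
  open U ->
  (forall x, U x -> exists V, [/\ V x, V `<=` U & plot (Gr R k n) V c]) ->
  plot (Gr R k n) U c.
Proof.
move=> oU H; split=> // x Ux; have [V [Vx VU [_ /(_ x Vx)]]] := H x Ux.
move=> [V' [g [V'x V'V pg cg]]]; exists V', g; split=> //.
by move=> y /V'V/VU.
Qed.

Lemma Gr_plot_graph d (U : set 'rV[R]_d) (M : 'rV[R]_d -> 'M[R]_(j, i)) :
  sfam U M -> plot (Gr R i n) U (fun y => graph (M y)).
Proof.
move=> sM; have oU := sfam_open sM.
apply: (@Gr_plot_colspan _ _ _ _ (fun y => F *m col_mx 1%:M (M y))) => //.
  by apply: sfam_mul; [exact: sfam_cst|apply: sfam_col_mx => //; exact: sfam_cst].
by move=> y _; exact: rank_graph.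
Qed.

(** A plot lifts locally to frames. Invertibility of the upper block is an open condition that does
    not depend on the lift, so dividing by that block gives a smooth slope. *)
Lemma Gr_plot_near d (U : set 'rV[R]_d) c x :
  plot (Gr R i n) U c -> U x -> range graph (c x) ->
  exists V M, [/\ V x, V `<=` U, sfam V M & forall y, V y -> c y = graph (M y)].
Proof.
move=> [oU /(_ x) H] Ux [M0 _ cM0]; have [V [g [Vx VU [sg rg] cg]]] := H Ux.
have sT : sfam V (fun y => F' *m g y).
  by apply: sfam_mul => //; apply: sfam_cst; exact: sfam_open sg.
have su : sfam V (fun y => usubmx (F' *m g y)) by exact: (sfam_linear _ sT).
have oV' := sfam_unit_open su.
exists (V `&` [set y | usubmx (F' *m g y) \in unitmx]),
  (fun y => dsubmx (F' *m g y) *m invmx (usubmx (F' *m g y))); split.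
- split=> //; apply: (@graph_colspan_unit _ M0); first exact: rg.
  by rewrite -cg.
- by move=> y [/VU].
- apply: sfam_mul.
    by apply: (sfam_linear _ (sfam_sub oV' _ sT)) => y [].
  by apply: sfam_inv => [y []//|]; apply: sfam_sub su => // y [].
- by move=> y [Vy Tu]; rewrite cg // -colspan_graph.
Qed.

Lemma graph_coord_plot d (U : set 'rV[R]_d) c :
  plot (Gr R i n) U c -> (forall y, U y -> range graph (c y)) ->
  sfam U (fun y => graph_coord (c y)).
Proof.
move=> pc rc; apply: sfam_local; first by case: pc.
move=> x Ux; have [V [M [Vx VU sM cM]]] := Gr_plot_near pc Ux (rc x Ux).
by exists V, M; split=> // y Vy; rewrite cM // graphK.
Qed.

Lemma smooth_open_graph Om : fam_open Om -> smooth_open (X := Gr R i n) (graph @` Om).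
Proof.
move=> oOm; split=> [W [M _ <-]|d U c pc]; first exact: Gr_carrier (rank_graph M).
apply: open_locally => x [Ux [M0 OM0 cM0]].
have [V [M [Vx VU sM cM]]] : exists V M, [/\ V x, V `<=` U, sfam V M &
    forall y, V y -> c y = graph (M y)].
  by apply: Gr_plot_near pc Ux _; exists M0.
exists (V `&` [set y | Om (M y)]); split; first exact: oOm.
  by split=> //=; rewrite -(graph_inj (etrans cM0 (cM x Vx))).
by move=> y [Vy OM]; split; [exact: VU|exists (M y) => //; rewrite cM].
Qed.

(** The further change of coordinates [t] leaves room for the nonlinear map that straightens the
    orbit. *)
Lemma graph_chart N Om (Om' : set 'rV[R]_N) t t' :
  fam_open Om -> open Om' ->
  (forall M, Om M -> Om' (t M) /\ t' (t M) = M) ->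
  (forall w, Om' w -> Om (t' w) /\ t (t' w) = w) ->
  fam_smooth Om t -> fam_smooth Om' t' ->
  is_chart (Gr R i n) N (graph @` Om) (t \o graph_coord) (graph \o t').
Proof.
move=> oOm oOm' tt' t't st st'.
have imE : (t \o graph_coord) @` (graph @` Om) = Om'.
  apply/seteqP; split=> [w [W [M OM <-] <-]|w Ow] /=.
    by rewrite graphK; have [] := tt' M OM.
  have [OM tw] := t't w Ow; exists (graph (t' w)); first by exists (t' w).
  by rewrite /= graphK.
split; first exact: smooth_open_graph.
  by rewrite imE.
rewrite imE; split.
- split=> [W [_ [M OM <-]]|d U c [pc cD]] /=.
    by split=> //; rewrite graphK; have [] := tt' M OM.
  split; last first.
    by move=> y /cD[M OM <-] /=; rewrite graphK; have [] := tt' M OM.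
  apply: (st _ _ (fun y => graph_coord (c y))).
    by apply: graph_coord_plot => // y /cD[M _ <-]; exists M.
  by move=> y /cD[M OM <-]; rewrite graphK.
- split=> [w [_ Ow]|d U c [pc cO]] /=.
    split; first exact: Gr_carrier (rank_graph _).
    by exists (t' w) => //; have [] := t't w Ow.
  split; last by move=> y /cO Oc; exists (t' (c y)) => //; have [] := t't _ Oc.
  by apply: Gr_plot_graph; exact: st'.
- by move=> W [_ [M OM <-]] /=; rewrite graphK; have [_ ->] := tt' M OM.
- by move=> w [_ Ow] /=; rewrite graphK; have [] := t't w Ow.
Qed.

End Graph.

(** A slice chart restricts to the submanifold: the last [k] coordinates vanish there, so the chart
    drops them and its inverse restores them as 0. *)
Lemma chart_sub_space (X : smooth_space R) (S : set X) d k D kappa phi :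
  is_chart X (d + k) D kappa phi ->
  (forall y, D y -> (S y <-> rsubmx (kappa y) = 0)) ->
  is_chart (sub_space X S) d (D `&` S) (fun y => lsubmx (kappa y))
    (fun w => phi (row_mx w 0)).
Proof.
move=> [[Dc oD] oI [[kc kp] [fc fp] fk kf]] SD.
have imE : (fun y => lsubmx (kappa y)) @` (D `&` S) =
    [set w | (kappa @` D) (row_mx w 0)].
  apply/seteqP; split=> [w [y [Dy Sy] <-]|w [y Dy kw]] /=.
    by exists y => //; rewrite -[LHS]hsubmxK ((SD y Dy).1 Sy).
  exists y; last by rewrite kw row_mxKl.
  by split=> //; apply/(SD y Dy); rewrite kw row_mxKr.
have sr e (U : set 'rV[R]_e) c : sfam U c -> sfam U (fun w : 'rV_e => row_mx (c w) 0 : 'rV[R]_(d + k)).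
  by move=> sc; apply: sfam_row_mx => //; apply: sfam_cst; exact: sfam_open sc.
have S0 w : (kappa @` D) (row_mx w 0) -> D (phi (row_mx w 0)) /\ S (phi (row_mx w 0)).
  move=> Kw; have [_ Dp] := fc _ (conj I Kw); split=> //.
  by apply/(SD _ Dp); rewrite kf ?row_mxKr.
split.
- split=> [y [Dy Sy]|e U c [pc cS]]; first by split=> //; exact: Dc.
  have := oD _ _ _ pc; suff -> : U `&` c @^-1` D = U `&` c @^-1` (D `&` S) by [].
  by apply/seteqP; split=> y [Uy Dy]; split=> //; [split=> //; exact: cS|case: Dy].
- rewrite imE; have := sfam_preimage_open (sr _ _ _ (sfam_id openT)) oI.
  by rewrite setTI.
rewrite imE; split.
- split=> [y [[_ Sy] [Dy _]]|e U c [[pc cS] cD]] /=.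
    split=> //; exists y => //; rewrite -[LHS]hsubmxK.
    by rewrite ((SD y Dy).1 Sy).
  have [pk _] := kp _ _ _ (conj pc (fun y Uy => (cD y Uy).1)).
  split; first exact: (sfam_linear _ pk).
  move=> y Uy /=; have [Dy Sy] := cD y Uy; exists (c y) => //.
  by rewrite -[LHS]hsubmxK ((SD _ Dy).1 Sy).
- split=> [w [_ Kw]|e U c [pc cK]] /=.
    have [Dp Sp] := S0 w Kw.
    by split; [split=> //; exact: Dc|split].
  have [pf _] := fp _ _ _ (conj (sr _ _ _ pc) (fun y Uy => cK y Uy)).
  split; first by split=> // y Uy; have [] := S0 _ (cK y Uy).
  by move=> y Uy; exact: S0 (cK y Uy).
- move=> y [[cy Sy] [Dy _]] /=; rewrite -[RHS]fk //.
  by congr phi; rewrite -[RHS]hsubmxK ((SD y Dy).1 Sy).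
- by move=> w [_ Kw]; rewrite kf ?row_mxKl.
Qed.

End GrassmannCharts.

(** * Linear coordinates separating the symmetric part of a block *)

Section SymmetricCoordinates.
Variable R : realType.

Lemma sum_ord_succ k : (\sum_(j < k) j.+1 = k * (k + 1) %/ 2)%N.
Proof.
suff -> : (k * (k + 1) = (\sum_(j < k) j.+1) * 2)%N by rewrite mulnK.
by elim: k => [|k IH]; rewrite ?big_ord0 // big_ord_recr /= mulnDl -IH; lia.
Qed.

Lemma card_le_pairs k :
  #|{: {ij : 'I_k * 'I_k | (ij.1 <= ij.2)%N}}| = (k * (k + 1) %/ 2)%N.
Proof.
rewrite card_sig -sum_ord_succ -sum1_card.
rewrite (eq_bigl (fun ij : 'I_k * 'I_k => true && (ij.1 <= ij.2)%N)) //.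
rewrite -(pair_big_dep xpredT (fun i j : 'I_k => (i <= j)%N) (fun _ _ => 1%N)) /=.
rewrite (exchange_big_dep xpredT) //=; apply: eq_bigr => j _.
by rewrite -(big_ord_widen k (fun=> 1%N) (ltn_ord j)) sum_nat_const card_ord muln1.
Qed.

(** The functionals are the entries of x + x^T on and above the diagonal, indexed by pairs i <= j;
    this is where k(k+1)/2 comes from. *)
Lemma symmetric_part_coords k : exists A : 'M[R]_(k * k, k * (k + 1) %/ 2),
  \rank A = (k * (k + 1) %/ 2)%N /\
  forall x : 'M[R]_k, mxvec x *m A = 0 <-> x + x^T = 0.
Proof.
rewrite -card_le_pairs.
pose T : finType := {: {ij : 'I_k * 'I_k | (ij.1 <= ij.2)%N}}.
rewrite -[#|_|]/#|T|.
pose f (x : 'M[R]_k) : 'rV[R]_#|T| :=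
  \row_l (x + x^T) (val (enum_val l)).1 (val (enum_val l)).2.
have lf : linear (f \o vec_mx).
  move=> a u v; apply/matrixP => i l; rewrite !mxE; ring.
pose fM := GRing.isLinear.Build _ _ _ _ _ lf.
pose fl : {linear 'rV[R]_(k * k) -> 'rV[R]_#|T|} := HB.pack (f \o vec_mx) fM.
have fA x : mxvec x *m lin1_mx fl = f x by rewrite mul_rV_lin1 /= mxvecK.
(* Right inverse of [f]: the entries go to the upper triangle, and those on the diagonal are halved
   because x + x^T doubles them. *)
pose h (w : 'rV[R]_#|T|) : 'M[R]_k := \matrix_(i, j)
  if insub (i, j) is Some t then w 0 (enum_rank (t : T)) * (if i == j then 2^-1 else 1) else 0.
have fh w : f (h w) = w.
  apply/matrixP => i l; rewrite (ord1 i) !mxE.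
  set t := enum_val l; have tl : enum_rank t = l by rewrite enum_valK.
  have := valP t; rewrite /=; case Et : (val t) => [u v] /= uv.
  have E1 : insub (u, v) = Some t.
    by rewrite -Et valK.
  rewrite E1 tl; have [uv'|uv'] := eqVneq u v.
    rewrite -uv' in E1 *; rewrite E1 tl -mulrDr.
    by rewrite addr_half mulr1.
  rewrite insubF /=; first by rewrite mulr1 addr0.
  by apply: negbTE; rewrite -ltnNge ltn_neqAle uv' uv.
exists (lin1_mx fl); split.
  apply/rank_linvP; exists (\matrix_l mxvec (h (delta_mx 0 l))).
  by apply/row_matrixP => l; rewrite row_mul rowK fA fh rowE mulmx1.
move=> x; rewrite fA; split=> [fx|xx]; last by apply/matrixP => i l; rewrite mxE xx !mxE.
have E (i j : 'I_k) : (i <= j)%N -> (x + x^T) i j = 0.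
  move=> ij; have := congr1 (fun w : 'rV[R]_#|T| => w 0 (enum_rank (exist _ (i, j) ij : T))) fx.
  by rewrite [in RHS]mxE [in LHS]mxE enum_rankK.
apply/matrixP => i j; rewrite [RHS]mxE; have [ij|ji] := leqP i j; first exact: E.
by rewrite -[RHS](E j i (ltnW ji)) !mxE addrC.
Qed.

(** The independent functionals on the lower right block are completed to a full linear coordinate
    system. They come last, matching the order of coordinates in [embedded_codim]. *)
Lemma symmetric_coords c a k : exists d
    (L : 'M[R]_(c + k, a + k) -> 'rV[R]_(d + (k * (k + 1) %/ 2)))
    (L' : 'rV[R]_(d + (k * (k + 1) %/ 2)) -> 'M[R]_(c + k, a + k)),
  [/\ cancel L L', cancel L' L, L 0 = 0,
      fam_smooth setT L /\ fam_smooth setT L'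
    & forall M, rsubmx (L M) = 0 <-> drsubmx M + (drsubmx M)^T = 0].
Proof.
have [A [rA AP]] := symmetric_part_coords k.
pose g (M : 'M[R]_(c + k, a + k)) : 'rV[R]_(k * (k + 1) %/ 2) := mxvec (drsubmx M) *m A.
have lg : linear (g \o vec_mx).
  by move=> t u v; rewrite /g /= /drsubmx !linearP mulmxDl scalemxAl.
pose gM := GRing.isLinear.Build _ _ _ _ _ lg.
pose gl : {linear 'rV[R]_((c + k) * (a + k)) -> 'rV[R]_(k * (k + 1) %/ 2)} :=
  HB.pack (g \o vec_mx) gM.
pose A' := lin1_mx gl.
have gA M : mxvec M *m A' = g M by rewrite mul_rV_lin1 /= mxvecK.
have rA' : \rank A' = (k * (k + 1) %/ 2)%N.
  have [C CA] := (rank_linvP A).1 rA.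
  (* A left inverse of [A] becomes one of [A'] once its rows are placed in the lower right block. *)
  apply/rank_linvP; exists (\matrix_l mxvec (block_mx 0 0 0 (vec_mx (row l C)) : 'M[R]_(c + k, a + k))).
  apply/row_matrixP => l; rewrite row_mul rowK gA /g block_mxKdr vec_mxK.
  by rewrite -row_mul CA.
have [d [C [dk rC]]] := complete_cols rA'.
have rC' := rank_row_mxC rC; rewrite addnC in dk.
have [D DC CD] := rank_rinv dk rC'.
exists d, (fun M => mxvec M *m row_mx C A'), (fun w => vec_mx (w *m D)); split.
- by move=> M; rewrite -mulmxA CD mulmx1 mxvecK.
- by move=> w; rewrite vec_mxK -mulmxA DC mulmx1.
- by rewrite linear0 mul0mx.
- split=> e U h sh _; have oU := sfam_open sh.
    by apply: sfam_mul; [exact: sfam_linear|exact: sfam_cst].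
  by apply: sfam_linear; apply: sfam_mul => //; exact: sfam_cst.
- by move=> M; rewrite mul_mx_row row_mxKr gA; exact: AP.
Qed.

End SymmetricCoordinates.

(** * Radicals of subspaces *)

Section Radical.
Variable R : realType.

Lemma colspan_col0 n k (A : 'M[R]_(n, k)) : colspan (row_mx (0 : 'M[R]_(n, 0)) A) = colspan A.
Proof.
apply: (@colspan_eq _ _ _ _ _ _ (row_mx 0 1%:M) (col_mx 0 1%:M)).
  by rewrite mul_mx_row mulmx0 mulmx1.
by rewrite mul_row_col mul0mx add0r mulmx1.
Qed.

(** Diagonalizing the form on [Z1] would add [a] positive and [b] negative vectors orthogonal to
    [Z2], giving the signature [(r + a, s + b)]. Uniqueness forces [a] and [b] to be 0, so [Z1] has
    a basis of null vectors orthogonal to one another. *)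
Lemma signature_block_iff n r s k (B : 'M[R]_n) (Z2 : 'M[R]_(n, r + s))
    (Z1 : 'M[R]_(n, k)) : B^T = B ->
  gram B Z2 Z2 = Jform R r s -> gram B Z2 Z1 = 0 ->
  \rank (row_mx Z2 Z1) = (r + s + k)%N ->
  has_signature B (colspan (row_mx Z2 Z1)) r s <-> gram B Z1 Z1 = 0.
Proof.
move=> sB h22 h21 rk; pose X := lsubmx Z2; pose Y := rsubmx Z2.
have EXY : row_mx X Y = Z2 by rewrite hsubmxK.
have XX : gram B X X = 1%:M by rewrite gram_ul h22 block_mxKul.
have YY : gram B Y Y = - 1%:M by rewrite gram_dr h22 block_mxKdr.
have XY : gram B X Y = 0 by rewrite gram_ur h22 block_mxKur.
move: h21; rewrite -EXY gram_rowl -[0]vsubmxK !linear0 => /eq_col_mx[X1 Y1].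
rewrite -EXY in rk; split=> [sig|h11]; last exact: has_signature_cols.
have s1 : (gram B Z1 Z1)^T = gram B Z1 Z1 by rewrite gram_tr.
have [a [b [c [X' [Y' [Z' [abc rZ D]]]]]]] := sylvester s1.
have [XX' YY' ZZ' XY' [XZ' YZ']] := diag_cols_mul D.
have D' : diag_cols B (row_mx X (Z1 *m X')) (row_mx Y (Z1 *m Y')) (Z1 *m Z').
  have ZX l (P : 'M[R]_(k, l)) : gram B X (Z1 *m P) = 0 by rewrite gramMr X1 mul0mx.
  have ZY l (P : 'M[R]_(k, l)) : gram B Y (Z1 *m P) = 0 by rewrite gramMr Y1 mul0mx.
  have XZ l (P : 'M[R]_(k, l)) := gram_eq0C sB (ZX _ P).
  have YZ l (P : 'M[R]_(k, l)) := gram_eq0C sB (ZY _ P).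
  split=> //.
  - by rewrite gram_block XX ZX XZ XX' -scalar_mx_block.
  - by rewrite gram_block YY ZY YZ YY' (scalar_mx_block s) opp_block_mx !oppr0.
  - by rewrite gram_block XY ZX YZ XY' block_mx0.
  - by rewrite !gram_rowl ZX ZY XZ' YZ' !col_mx0.
have rZ1 : \rank Z1 = k := rank_row_mxl (rank_row_mxC rk).
have rk' := diag_cols_rank sB D' (rank_mulmx_full rZ1 rZ).
have [? ? ? ? [? ?]] := D'.
have sig' : has_signature B (colspan (row_mx (row_mx X Y) Z1)) (r + a) (s + b).
  have -> : colspan (row_mx (row_mx X Y) Z1) =
      colspan (row_mx (row_mx (row_mx X (Z1 *m X')) (row_mx Y (Z1 *m Y'))) (Z1 *m Z')).
    apply/esym/eqP; rewrite eqEdim (dim_colspan _).2 // (dim_colspan _).2 //.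
    apply/andP; split; last by lia.
    apply/subvP => x /mem_colspan[z ->]; rewrite -[z]vsubmxK -[usubmx z]vsubmxK.
    rewrite -[usubmx (usubmx z)]vsubmxK -[dsubmx (usubmx z)]vsubmxK !mul_row_col.
    rewrite -!mulmxA; set z1 := usubmx _; set z2 := dsubmx _; set z3 := usubmx _.
    set z4 := dsubmx _; set z5 := dsubmx _; apply/mem_colspan.
    exists (col_mx (col_mx z1 z3) (X' *m z2 + Y' *m z4 + Z' *m z5)).
    by rewrite !mul_row_col !mulmxDr !addrA; congr (_ + _ + _); rewrite addrAC.
  exact: has_signature_cols.
have [Ea Eb] := has_signature_unique sig sig'.
have a0 : a = 0%N by lia.
have b0 : b = 0%N by lia.
subst a b; have ck : c = k by lia.
subst c; have [Z'' _ ZZ''] := rank_rinv (erefl k) rZ.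
move: ZZ'; rewrite gramMl gramMr => /(congr1 (fun M => Z''^T *m (M *m Z''))).
rewrite mul0mx mulmx0 -(mulmxA Z'^T) -(mulmxA _ Z') ZZ'' mulmx1 mulmxA.
by rewrite -trmx_mul ZZ'' trmx1 mul1mx.
Qed.

(* The choice is unambiguous by [radical_eq]. *)
Definition radical n (B : 'M[R]_n) (W : {vspace 'cV[R]_n}) : {vspace 'cV[R]_n} :=
  xget 0%VS [set N : {vspace 'cV[R]_n} | forall x : 'cV[R]_n, x \in N <-> x \in W /\ perp B W x].

Lemma radical_eq n (B : 'M[R]_n) (W N : {vspace 'cV[R]_n}) :
  (forall x, x \in N <-> x \in W /\ perp B W x) -> radical B W = N.
Proof.
move=> NP; rewrite /radical; case: xgetP => [N' _ N'P|H]; last by case: (H N).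
apply/vspaceP => x; apply/idP/idP => h; first exact/NP/N'P.
exact/N'P/NP.
Qed.

Lemma perp_colspan n k (B : 'M[R]_n) (A : 'M[R]_(n, k)) x :
  perp B (colspan A) x <-> gram B A x = 0.
Proof.
split=> [H|Ax w /mem_colspan[z ->]]; last first.
  by rewrite bformE gramMl Ax mulmx0 mxE.
apply/matrixP => i j; rewrite (ord1 j) [RHS]mxE.
have := H (A *m delta_mx i 0) (mulmx_colspan _ _); rewrite bformE gramMl.
by rewrite trmx_delta -rowE mxE.
Qed.

Lemma radical_colspan n a k (B : 'M[R]_n) (Z2 : 'M[R]_(n, a)) (Z1 : 'M[R]_(n, k)) :
  B^T = B -> gram B Z2 Z2 \in unitmx -> gram B Z2 Z1 = 0 -> gram B Z1 Z1 = 0 ->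
  forall x, x \in colspan Z1 <->
    x \in colspan (row_mx Z2 Z1) /\ perp B (colspan (row_mx Z2 Z1)) x.
Proof.
move=> sB u22 h21 h11 x; split=> [/mem_colspan[z ->]|[]].
  split; first by apply/colspan_row_mx_mem; exists 0, z; rewrite mulmx0 add0r.
  by apply/perp_colspan; rewrite gramMr gram_rowl h21 h11 col_mx0 mul0mx.
move=> /colspan_row_mx_mem[y [z ->]] /perp_colspan.
rewrite gram_rowl -[0]vsubmxK !linear0 => /eq_col_mx[+ _].
rewrite gramDr !gramMr h21 mul0mx addr0 => /(congr1 (mulmx (invmx (gram B Z2 Z2)))).
by rewrite mulKmx // mulmx0 => ->; rewrite mulmx0 add0r mulmx_colspan.
Qed.

Lemma isotropic_colspan n k l (B : 'M[R]_n) (A : 'M[R]_(n, l)) : \rank A = l ->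
  isotropic_sub B k (colspan A) <-> l = k /\ gram B A A = 0.
Proof.
move=> rA; have dA := (dim_colspan A).2 rA; split=> [[dk H]|[lk AA]].
  split; first by rewrite -dA.
  apply/matrixP => i j; rewrite [RHS]mxE.
  have := H (A *m delta_mx i 0) (A *m delta_mx j 0) (mulmx_colspan _ _) (mulmx_colspan _ _).
  by rewrite bformE gramMl gramMr trmx_delta -rowE -colE !mxE.
split; first by rewrite dA.
by move=> x y /mem_colspan[z ->] /mem_colspan[t ->];
  rewrite bformE gramMl gramMr AA mul0mx mulmx0 mxE.
Qed.

Lemma isotropic_orbit n k (B : 'M[R]_n) : B^T = B ->
  isotropic_sub B k = orbit_sig B k 0 0.
Proof.
move=> sB; have J0 : gram B (0 : 'M[R]_(n, 0 + 0)) 0 = Jform R 0 0.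
  by rewrite [LHS]flatmx0 [RHS]flatmx0.
have sigP (A : 'M[R]_(n, k)) : \rank A = k ->
    has_signature B (colspan A) 0 0 <-> gram B A A = 0.
  move=> rA; rewrite -(colspan_col0 A).
  apply: (signature_block_iff (Z2 := 0) sB J0); first by rewrite [LHS]flatmx0 [RHS]flatmx0.
  by rewrite rank_row_0mx.
apply/seteqP; split=> W /= [dW H]; have [A rA EW] := colspan_exists dW.
  split=> //; rewrite -EW; apply/sigP => //.
  by have [] : k = k /\ gram B A A = 0 by apply/isotropic_colspan => //; rewrite EW.
rewrite -EW; apply/isotropic_colspan => //; split=> //.
by apply/sigP => //; rewrite EW.
Qed.

End Radical.

(** * Charts adapted to an orbit *)

Lemma submx_zero (R : nzRingType) m1 m2 n1 n2 :
  let Z : 'M[R]_(m1 + m2, n1 + n2) := 0 in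
  [/\ ulsubmx Z = 0, ursubmx Z = 0, dlsubmx Z = 0 & drsubmx Z = 0].
Proof.
by rewrite /= -block_mx0; split;
   rewrite ?block_mxKul ?block_mxKur ?block_mxKdl ?block_mxKdr.
Qed.

Section OrbitChart.
Variables (R : realType) (n r s k c : nat) (B : 'M[R]_n) (J3 : 'M[R]_c).
Variables (E2 : 'M[R]_(n, r + s)) (E1 : 'M[R]_(n, k)) (E3 : 'M[R]_(n, c))
  (E4 : 'M[R]_(n, k)).
Local Notation F := (row_mx (row_mx E2 E1) (row_mx E3 E4)).
Local Notation J2 := (Jform R r s).
Variables (Om0 : set 'M[R]_(r + s)) (P0 : 'M[R]_(r + s) -> 'M[R]_(r + s)).
Hypotheses (sB : B^T = B) (J33 : J3 *m J3 = 1%:M) (sJ3 : J3^T = J3)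
  (dn : (r + s + k + (c + k))%N = n) (FF : gram B F F = stdform k J2 J3)
  (smoothP : smooth_orthonormalization J2 Om0 P0).

Implicit Type M : 'M[R]_(c + k, r + s + k).

(* [gram22], [gram21] are Gram matrices of the basis (frame2, frame1) of the graph of
   [M]; [radical_frame] is the projection of frame1 orthogonal to frame2. *)
Definition gram22 M := J2 + (ulsubmx M)^T *m J3 *m ulsubmx M.
Definition gram21 M := (dlsubmx M)^T + (ulsubmx M)^T *m J3 *m ursubmx M.
Definition radcoef M := invmx (gram22 M) *m gram21 M.
(** Schur complement part of the Gram matrix of [radical_frame]. The lower right block of [M] does
    not enter it, which is why shifting that block by half of [corr] is undone by shifting back. *)
Definition corr M := (ursubmx M)^T *m J3 *m ursubmx M - (gram21 M)^T *m radcoef M.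
Definition straighten M := M + block_mx 0 0 0 (2^-1 *: corr M).
Definition unstraighten M := M - block_mx 0 0 0 (2^-1 *: corr M).
(** Domain on which [frame2] can be orthonormalized; it constrains only the left blocks of [M]. *)
Definition orbit_dom : set 'M[R]_(c + k, r + s + k) := [set M | Om0 (gram22 M)].

Definition frame2 M := E2 + E3 *m ulsubmx M + E4 *m dlsubmx M.
Definition frame1 M := E1 + E3 *m ursubmx M + E4 *m drsubmx M.
Definition radical_frame M := frame1 M - frame2 M *m radcoef M.

Lemma graph_frame M : F *m col_mx 1%:M M = row_mx (frame2 M) (frame1 M).
Proof.
rewrite -{1}[M]submxK mul_row_col mulmx1 mul_row_block add_row_mx.
by rewrite /frame2 /frame1 !addrA.
Qed.

Let grams := stdform_gram FF.

Lemma gram_frame22 M : gram B (frame2 M) (frame2 M) = gram22 M.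
Proof.
have [[h22 h21 h23 h24] [h12 h11 h13 h14] [h32 h31 h33 h34] [h42 h41 h43 h44]] := grams.
rewrite !gramDl !gramDr !gramMl !gramMr h22 h23 h24 h32 h33 h34 h42 h43 h44.
by rewrite !mul0mx !mulmx0 !addr0 add0r mulmxA.
Qed.

Lemma gram_frame21 M : gram B (frame2 M) (frame1 M) = gram21 M.
Proof.
have [[h22 h21 h23 h24] [h12 h11 h13 h14] [h32 h31 h33 h34] [h42 h41 h43 h44]] := grams.
rewrite !gramDl !gramDr !gramMl !gramMr h21 h23 h24 h31 h33 h34 h41 h43 h44.
by rewrite !mul0mx !mulmx0 !addr0 !add0r mulmx1 mulmxA addrC.
Qed.

Lemma gram_frame11 M : gram B (frame1 M) (frame1 M) =
  drsubmx M + (drsubmx M)^T + (ursubmx M)^T *m J3 *m ursubmx M.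
Proof.
have [[h22 h21 h23 h24] [h12 h11 h13 h14] [h32 h31 h33 h34] [h42 h41 h43 h44]] := grams.
rewrite !gramDl !gramDr !gramMl !gramMr h11 h13 h14 h31 h33 h34 h41 h43 h44.
rewrite !mul0mx !mulmx0 !addr0 !add0r mulmx1 mul1mx mulmxA.
by rewrite addrAC [in RHS]addrAC addrAC.
Qed.

Lemma gram22_tr M : (gram22 M)^T = gram22 M.
Proof. by rewrite -gram_frame22 gram_tr. Qed.

Lemma gram22_unit M : orbit_dom M -> gram22 M \in unitmx.
Proof.
have [_ _ PG _ _] := smoothP => OM; have := PG _ (gram22_tr M) OM.
move=> /(congr1 determinant); rewrite /gram !det_mulmx => dE.
rewrite unitmxE unitfE; apply: contra_eq_neq dE => ->.
rewrite mulr0 mul0r eq_sym; have := sqr1_unit (Jform_sqr R r s).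
by rewrite unitmxE unitfE.
Qed.

Lemma corr_tr M : orbit_dom M -> (corr M)^T = corr M.
Proof.
move=> OM; rewrite /corr /radcoef linearB /= !trmx_mul !trmxK sJ3 mulmxA.
by rewrite trmx_inv gram22_tr mulmxA.
Qed.

Lemma gram21_radical M : orbit_dom M -> gram B (frame2 M) (radical_frame M) = 0.
Proof.
move=> OM; rewrite gramDr gramNr gramMr gram_frame21 gram_frame22 /radcoef.
by rewrite mulKVmx ?subrr // gram22_unit.
Qed.

Lemma gram_radical M : orbit_dom M ->
  gram B (radical_frame M) (radical_frame M) = drsubmx M + (drsubmx M)^T + corr M.
Proof.
move=> OM; rewrite {1}/radical_frame gramDl gramNl gramMl (gram21_radical OM).
rewrite mulmx0 subr0 gramDr gramNr gramMr gram_frame11.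
by rewrite -[gram B (frame1 M) (frame2 M)](gram_tr _ _ sB) gram_frame21 -addrA.
Qed.

Lemma frame_linv : exists2 F', F' *m F = 1%:M & F *m F' = 1%:M.
Proof. exact: (frame_inv (Jform_sqr R r s) J33 dn FF). Qed.

Lemma rank_frame M : \rank (row_mx (frame2 M) (frame1 M)) = (r + s + k)%N.
Proof. by have [F' FF' _] := frame_linv; rewrite -graph_frame (rank_graph FF'). Qed.

(** Puts the graph into the form required by [signature_block_iff]: [frame2] is orthonormalized and
    [frame1] projected off it, together an invertible block triangular change of basis. *)
Lemma graph_radical_frame M : orbit_dom M -> exists2 Z2,
  gram B Z2 Z2 = J2 /\ gram B Z2 (radical_frame M) = 0 &
  \rank (row_mx Z2 (radical_frame M)) = (r + s + k)%N /\
  graph F M = colspan (row_mx Z2 (radical_frame M)).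
Proof.
move=> OM; have [_ _ PG _ _] := smoothP; have := PG _ (gram22_tr M) OM.
set P := P0 _ => PGP.
have Pu : P \in unitmx.
  have := congr1 determinant PGP; rewrite /gram !det_mulmx => dE.
  rewrite unitmxE unitfE; apply: contra_eq_neq dE => ->.
  rewrite mulr0 eq_sym; have := sqr1_unit (Jform_sqr R r s).
  by rewrite unitmxE unitfE.
have E : row_mx (frame2 M *m P) (radical_frame M) =
    row_mx (frame2 M) (frame1 M) *m block_mx P (- radcoef M) 0 1%:M.
  by rewrite mul_row_block mulmx0 addr0 mulmxN mulmx1 addrC.
have bu : block_mx P (- radcoef M) 0 1%:M \in unitmx.
  by rewrite unitmxE det_ublock det1 mulr1 -unitmxE.
exists (frame2 M *m P); split.
- by rewrite gramMl gramMr gram_frame22 mulmxA.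
- by rewrite gramMl gram21_radical // mulmx0.
- rewrite E; apply: rank_mulmx_full; first exact: rank_frame.
  by rewrite mxrank_unit.
- by rewrite E colspan_mulr // -graph_frame.
Qed.

Lemma orbit_graph_iff M : orbit_dom M ->
  orbit_sig B (r + s + k) r s (graph F M) <-> drsubmx M + (drsubmx M)^T + corr M = 0.
Proof.
move=> OM; have [Z2 [h22 h21] [rk ->]] := graph_radical_frame OM.
rewrite -(gram_radical OM) -(signature_block_iff sB h22 h21 rk).
by split=> [[]//|H]; split=> //; apply/dim_colspan.
Qed.

Lemma radical_graph M : orbit_dom M -> drsubmx M + (drsubmx M)^T + corr M = 0 ->
  \rank (radical_frame M) = k /\ radical B (graph F M) = colspan (radical_frame M).
Proof.
move=> OM M0; have [Z2 [h22 h21] [rk ->]] := graph_radical_frame OM.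
split; first exact: rank_row_mxl (rank_row_mxC rk).
apply: radical_eq; apply: radical_colspan => //; last by rewrite gram_radical.
by rewrite h22 sqr1_unit // Jform_sqr.
Qed.

Lemma corr_eq M M' : ulsubmx M = ulsubmx M' -> ursubmx M = ursubmx M' ->
  dlsubmx M = dlsubmx M' -> corr M = corr M' /\ gram22 M = gram22 M'.
Proof. by move=> e1 e2 e3; rewrite /corr /radcoef /gram21 /gram22 e1 e2 e3. Qed.

Lemma sub_dr_block M (x : 'M[R]_k) :
  [/\ ulsubmx (M + block_mx 0 0 0 x) = ulsubmx M,
      ursubmx (M + block_mx 0 0 0 x) = ursubmx M,
      dlsubmx (M + block_mx 0 0 0 x) = dlsubmx M
    & drsubmx (M + block_mx 0 0 0 x) = drsubmx M + x].
Proof.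
rewrite -{1 3 5 7}[M]submxK add_block_mx !addr0.
by rewrite block_mxKul block_mxKur block_mxKdl block_mxKdr.
Qed.

Lemma corr_add M x : corr (M + block_mx 0 0 0 x) = corr M /\
  gram22 (M + block_mx 0 0 0 x) = gram22 M.
Proof. by have [e1 e2 e3 _] := sub_dr_block M x; exact: corr_eq. Qed.

Lemma straighten_add M : straighten M = M + block_mx 0 0 0 (2^-1 *: corr M).
Proof. by []. Qed.

Lemma unstraighten_add M : unstraighten M = M + block_mx 0 0 0 (- (2^-1 *: corr M)).
Proof. by rewrite /unstraighten opp_block_mx !oppr0. Qed.

Lemma straightenK : cancel straighten unstraighten.
Proof. by move=> M; rewrite /unstraighten straighten_add (corr_add _ _).1 addrK. Qed.

Lemma unstraightenK : cancel unstraighten straighten.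
Proof.
move=> M; rewrite /straighten {2}unstraighten_add (corr_add _ _).1.
by rewrite /unstraighten subrK.
Qed.

Lemma orbit_dom_straighten M : orbit_dom M -> orbit_dom (straighten M).
Proof. by rewrite /orbit_dom /= straighten_add (corr_add _ _).2. Qed.

Lemma orbit_dom_unstraighten M : orbit_dom M -> orbit_dom (unstraighten M).
Proof. by rewrite /orbit_dom /= unstraighten_add (corr_add _ _).2. Qed.

(** As [corr] is symmetric, half of it comes from the shifted block and half from its transpose. *)
Lemma straighten_dr M : orbit_dom M ->
  drsubmx (straighten M) + (drsubmx (straighten M))^T =
  drsubmx M + (drsubmx M)^T + corr M.
Proof.
move=> OM; have [_ _ _ ->] := sub_dr_block M (2^-1 *: corr M).
rewrite [(drsubmx M + _)^T]linearD /= [(2^-1 *: _)^T]linearZ /= (corr_tr OM) addrACA -scalerDl.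
by rewrite addr_half scale1r.
Qed.

Lemma sfam_ulsubmx d (U : set 'rV[R]_d) m1 m2 n1 n2 (g : 'rV[R]_d -> 'M[R]_(m1 + m2, n1 + n2)) :
  sfam U g -> [/\ sfam U (fun y => ulsubmx (g y)), sfam U (fun y => ursubmx (g y)),
    sfam U (fun y => dlsubmx (g y)) & sfam U (fun y => drsubmx (g y))].
Proof.
move=> sg; split; exact: (sfam_linear _ (sfam_linear _ sg)).
Qed.

Lemma sfam_gram d (U : set 'rV[R]_d) (g : 'rV[R]_d -> 'M[R]_(c + k, r + s + k)) :
  sfam U g -> sfam U (fun y => gram22 (g y)) /\ sfam U (fun y => gram21 (g y)).
Proof.
move=> sg; have [s1 s2 s3 s4] := sfam_ulsubmx sg; have oU := sfam_open sg.
have sc m m' (A : 'M[R]_(m, m')) : sfam U (fun=> A) by exact: sfam_cst.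
by split; apply: sfam_add => //; do ?apply: sfam_mul => //; exact: sfam_tr.
Qed.

Lemma fam_open_orbit_dom : fam_open orbit_dom.
Proof.
have [_ _ _ oOm _] := smoothP => d U g sg.
exact: (oOm _ _ _ (sfam_gram sg).1).
Qed.

Lemma fam_smooth_radcoef : fam_smooth orbit_dom radcoef.
Proof.
move=> d U g sg OU; have [s22 s21] := sfam_gram sg.
by apply: sfam_mul => //; apply: sfam_inv => // y Uy; exact/gram22_unit/OU.
Qed.

Lemma fam_smooth_corr : fam_smooth orbit_dom corr.
Proof.
move=> d U g sg OU; have [s22 s21] := sfam_gram sg; have oU := sfam_open sg.
have sr := fam_smooth_radcoef sg OU; have [s1 s2 s3 s4] := sfam_ulsubmx sg.
apply: sfam_add; last by apply: sfam_opp; apply: sfam_mul => //; exact: sfam_tr.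
by do ?apply: sfam_mul => //; [exact: sfam_tr|exact: sfam_cst].
Qed.

Lemma fam_smooth_half_corr : fam_smooth orbit_dom (fun M => block_mx 0 0 0 (2^-1 *: corr M) : 'M[R]_(c + k, r + s + k)).
Proof.
move=> d U g sg OU; have oU := sfam_open sg.
apply: sfam_block_mx; try exact: sfam_cst.
by apply: sfam_scale; [exact: rfam_cst|exact: (fam_smooth_corr sg)].
Qed.

Lemma fam_smooth_straighten : fam_smooth orbit_dom straighten.
Proof. by move=> d U g sg OU; apply: sfam_add => //; exact: (fam_smooth_half_corr sg). Qed.

Lemma fam_smooth_unstraighten : fam_smooth orbit_dom unstraighten.
Proof.
move=> d U g sg OU; apply: sfam_add => //; apply: sfam_opp.
exact: (fam_smooth_half_corr sg).
Qed.

Lemma fam_smooth_radical_frame : fam_smooth orbit_dom radical_frame.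
Proof.
move=> d U g sg OU; have oU := sfam_open sg; have sr := fam_smooth_radcoef sg OU.
have [s1 s2 s3 s4] := sfam_ulsubmx sg.
have sc m m' (A : 'M[R]_(m, m')) : sfam U (fun=> A) by exact: sfam_cst.
apply: sfam_add; last (apply: sfam_opp; apply: sfam_mul => //);
  by do ?apply: sfam_add => //; apply: sfam_mul.
Qed.

Lemma orbit_dom0 : orbit_dom 0.
Proof.
have [OJ _ _ _ _] := smoothP; rewrite /orbit_dom /= /gram22.
by have [-> _ _ _] := submx_zero R c k (r + s) k; rewrite mulmx0 addr0.
Qed.

Lemma graph0 : graph F 0 = colspan (row_mx E2 E1).
Proof.
rewrite /graph graph_frame /frame2 /frame1.
by have [-> -> -> ->] := submx_zero R c k (r + s) k; rewrite !mulmx0 !addr0.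
Qed.

Lemma straighten0 : straighten 0 = 0.
Proof.
rewrite /straighten /corr /gram21; have [-> -> -> _] := submx_zero R c k (r + s) k.
by rewrite !(mulmx0, trmx0, addr0, mul0mx) subrr scaler0 block_mx0 addr0.
Qed.

Section Coordinates.
Variables (d : nat) (L : 'M[R]_(c + k, r + s + k) -> 'rV[R]_(d + (k * (k + 1) %/ 2)))
  (L' : 'rV[R]_(d + (k * (k + 1) %/ 2)) -> 'M[R]_(c + k, r + s + k)).
Hypotheses (LK : cancel L L') (L'K : cancel L' L) (L0 : L 0 = 0)
  (sL : fam_smooth setT L) (sL' : fam_smooth setT L')
  (LP : forall M, rsubmx (L M) = 0 <-> drsubmx M + (drsubmx M)^T = 0).

Definition orbit_chart W := L (straighten (graph_coord F W)).
Definition orbit_param w := graph F (unstraighten (L' w)).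

Lemma orbit_chartP : is_chart (Gr R (r + s + k) n) (d + (k * (k + 1) %/ 2))
  (graph F @` orbit_dom) orbit_chart orbit_param.
Proof.
have [F' F'F FF'] := frame_linv.
have sL'T : sfam setT (fun w : 'rV_(d + (k * (k + 1) %/ 2)) => L' w).
  by apply: (sL' (sfam_id openT)).
apply: (graph_chart F'F FF' (Om' := [set w | orbit_dom (L' w)])
  (t := fun M => L (straighten M)) (t' := fun w => unstraighten (L' w))).
- exact: fam_open_orbit_dom.
- by have := fam_open_orbit_dom sL'T; rewrite setTI.
- move=> M OM; split; last by rewrite LK straightenK.
  by rewrite /= LK; exact: orbit_dom_straighten.
- by move=> w Ow; split; [exact: orbit_dom_unstraighten|rewrite unstraightenK L'K].
- apply: fam_smooth_comp sL => //; exact: fam_smooth_straighten.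
- apply: (fam_smooth_comp (Om' := orbit_dom)) => //; last exact: fam_smooth_unstraighten.
  by move=> e U g sg _; exact: sL'.
Qed.

Lemma orbit_chart_iff W : (graph F @` orbit_dom) W ->
  orbit_sig B (r + s + k) r s W <-> rsubmx (orbit_chart W) = 0.
Proof.
have [F' F'F FF'] := frame_linv.
move=> [M OM <-]; rewrite orbit_graph_iff // /orbit_chart (graphK F'F).
by rewrite LP straighten_dr.
Qed.

Lemma orbit_chart0 : orbit_chart (colspan (row_mx E2 E1)) = 0.
Proof.
have [F' F'F FF'] := frame_linv.
by rewrite -graph0 /orbit_chart (graphK F'F) straighten0.
Qed.

End Coordinates.

End OrbitChart.

(** * The orbit as a submanifold, and equivariance of the radical *)

Section OrbitGeometry.
Variable R : realType.

Lemma gram_lsubr n l b1 b2 (B : 'M[R]_n) (X : 'M[R]_(n, l)) (Y : 'M[R]_(n, b1 + b2)) :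
  gram B X (lsubmx Y) = lsubmx (gram B X Y).
Proof. by rewrite -{2}[Y]hsubmxK gram_rowr row_mxKl. Qed.

Lemma gram_rsubr n l b1 b2 (B : 'M[R]_n) (X : 'M[R]_(n, l)) (Y : 'M[R]_(n, b1 + b2)) :
  gram B X (rsubmx Y) = rsubmx (gram B X Y).
Proof. by rewrite -{2}[Y]hsubmxK gram_rowr row_mxKr. Qed.

Lemma gram_sub_scalar n a b (B : 'M[R]_n) (X : 'M[R]_(n, a + b)) t :
  gram B X X = t%:M ->
  [/\ gram B (lsubmx X) (lsubmx X) = t%:M, gram B (lsubmx X) (rsubmx X) = 0,
      gram B (rsubmx X) (lsubmx X) = 0 & gram B (rsubmx X) (rsubmx X) = t%:M].
Proof.
move=> XX; rewrite gram_ul gram_ur gram_dl gram_dr XX scalar_mx_block.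
by rewrite block_mxKul block_mxKur block_mxKdl block_mxKdr.
Qed.

Lemma gram_sub0 n a b c d (B : 'M[R]_n) (X : 'M[R]_(n, a + b)) (Y : 'M[R]_(n, c + d)) :
  gram B X Y = 0 ->
  [/\ gram B (lsubmx X) (lsubmx Y) = 0, gram B (lsubmx X) (rsubmx Y) = 0,
      gram B (rsubmx X) (lsubmx Y) = 0 & gram B (rsubmx X) (rsubmx Y) = 0].
Proof.
move=> XY; rewrite gram_ul gram_ur gram_dl gram_dr XY.
by have [-> -> -> ->] := submx_zero R a b c d.
Qed.

Definition adapted r s n k c (B : 'M[R]_n) (J3 : 'M[R]_c) (E2 : 'M[R]_(n, r + s))
    (E1 : 'M[R]_(n, k)) (E3 : 'M[R]_(n, c)) (E4 : 'M[R]_(n, k)) :=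
  (r + s + k + (c + k))%N = n /\
  gram B (row_mx (row_mx E2 E1) (row_mx E3 E4)) (row_mx (row_mx E2 E1) (row_mx E3 E4)) =
  stdform k (Jform R r s) J3.
Arguments adapted : clear implicits.
Arguments adapted r s {n k c} B J3 E2 E1 E3 E4.

Lemma Jform_sum_sqr r s r' s' : Jform_sum R r s r' s' *m Jform_sum R r s r' s' = 1%:M.
Proof.
rewrite /Jform_sum; move: (Jform R r s) (Jform R r' s') (Jform_sqr R r s) (Jform_sqr R r' s').
move=> J J' JJ JJ'; rewrite mulmx_block !mulmx0 !mul0mx !addr0 add0r JJ JJ'.
by rewrite -scalar_mx_block.
Qed.

Lemma Jform_sum_tr r s r' s' : (Jform_sum R r s r' s')^T = Jform_sum R r s r' s'.
Proof. by rewrite /Jform_sum tr_block_mx !trmx0 !Jform_tr. Qed.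

Section Fixed.
Variables (n r s k r' s' : nat) (B : 'M[R]_n).
Hypotheses (sB : B^T = B) (Bu : B \in unitmx)
  (Bsig : has_signature B fullv (r + k + r') (s + k + s')).

Local Notation Orb := (orbit_sig B (r + s + k) r s).
Local Notation J2 := (Jform R r s).
Local Notation J3 := (Jform R r' s').

Lemma adapted_orbit W : Orb W -> exists (E2 : 'M[R]_(n, r + s))
    (E1 : 'M[R]_(n, k)) (E3 : 'M[R]_(n, r' + s')) (E4 : 'M[R]_(n, k)),
  adapted r s B J3 E2 E1 E3 E4 /\ W = colspan (row_mx E2 E1).
Proof.
move=> [dW sW]; have [r1 [s1 [F [dn EW FF er es]]]] := adapted_frame_exists sB Bu Bsig dW sW.
move: er es => /addnI er /addnI es; subst r1 s1.
exists (lsubmx (lsubmx F)), (rsubmx (lsubmx F)), (lsubmx (rsubmx F)), (rsubmx (rsubmx F)).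
by rewrite /adapted !hsubmxK EW.
Qed.

(** The frame of [N] as a subspace of type (0,0) has a middle block of signature [(r + r', s + s')];
    its positive and negative vectors are regrouped into [E2] and [E3]. This yields a subspace of
    type [(r, s)] with radical [N]. *)
Lemma adapted_isotropic N : isotropic_sub B k N -> exists (E2 : 'M[R]_(n, r + s))
    (E1 : 'M[R]_(n, k)) (E3 : 'M[R]_(n, r' + s')) (E4 : 'M[R]_(n, k)),
  adapted r s B J3 E2 E1 E3 E4 /\ N = colspan E1 :> {vspace 'cV[R]_n}.
Proof.
rewrite isotropic_orbit // => -[dN sN].
have [r1 [s1 [F [dn EN FF er es]]]] := adapted_frame_exists (r := 0) (s := 0) sB Bu Bsig dN sN.
have {}er : r1 = (r + r')%N by lia.
have {}es : s1 = (s + s')%N by lia.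
subst r1 s1.
move: FF EN; rewrite -[F]hsubmxK -[lsubmx F]hsubmxK -[rsubmx F]hsubmxK row_mxKl.
rewrite (_ : lsubmx (lsubmx F) = 0); last by apply: trmx_inj; rewrite [LHS]flatmx0 [RHS]flatmx0.
rewrite colspan_col0.
set E1 := rsubmx (lsubmx F); set E3 := lsubmx (rsubmx F); set E4 := rsubmx (rsubmx F).
move=> FF EN.
have [_ [_ h11 h13 h14] [_ h31 h33 h34] [_ h41 h43 h44]] := stdform_gram FF.
pose X := lsubmx E3; pose Y := rsubmx E3.
have XX : gram B X X = 1%:M by rewrite gram_ul h33 block_mxKul.
have XY : gram B X Y = 0 by rewrite gram_ur h33 block_mxKur.
have YX : gram B Y X = 0 by rewrite gram_dl h33 block_mxKdl.
have YY : gram B Y Y = (-1)%:M by rewrite gram_dr h33 block_mxKdr raddfN.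
have [X11 X12 X21 X22] := gram_sub_scalar XX.
have [Y11 Y12 Y21 Y22] := gram_sub_scalar YY.
have [Z11 Z12 Z21 Z22] := gram_sub0 XY.
have [T11 T12 T21 T22] := gram_sub0 YX.
pose E2' := row_mx (lsubmx X) (lsubmx Y); pose E3' := row_mx (rsubmx X) (rsubmx Y).
exists E2', E1, E3', E4; split=> //; split; first by move: dn; clear; lia.
have hz l (A : 'M[R]_(n, l)) : gram B A E3 = 0 ->
    gram B A E2' = 0 /\ gram B A E3' = 0.
  move=> AE; have AX : gram B A X = 0 by rewrite gram_lsubr AE linear0.
  have AY : gram B A Y = 0 by rewrite gram_rsubr AE linear0.
  rewrite !gram_rowr (gram_lsubr B A X) (gram_lsubr B A Y) (gram_rsubr B A X).
  by rewrite (gram_rsubr B A Y) AX AY !linear0 !row_mx0.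
have [h12' h13'] := hz _ _ h13; have [h42' h43'] := hz _ _ h43.
apply: gram_stdform => //.
- by rewrite gram_block X11 Z11 T11 Y11 raddfN.
- by rewrite gram_block X22 Z22 T22 Y22 raddfN.
- exact: gram_eq0C.
- by rewrite gram_block X12 Z12 T12 Y12 block_mx0.
- exact: gram_eq0C.
Qed.

Section AdaptedFacts.
Variables (E2 : 'M[R]_(n, r + s)) (E1 : 'M[R]_(n, k)) (E3 : 'M[R]_(n, r' + s'))
  (E4 : 'M[R]_(n, k)).
Hypothesis (aF : adapted r s B J3 E2 E1 E3 E4).

Lemma adapted_rank : \rank (row_mx E2 E1) = (r + s + k)%N.
Proof.
have [dn FF] := aF; have [F' F'F FF'] := frame_inv (Jform_sqr R r s) (Jform_sqr R r' s') dn FF.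
by apply: (@rank_row_mxl _ _ _ _ _ (row_mx E3 E4)); apply/rank_linvP; exists F'.
Qed.

Lemma adapted_mem_orbit : Orb (colspan (row_mx E2 E1)).
Proof.
have [dn FF] := aF; have [[h22 h21 _ _] [_ h11 _ _] _ _] := stdform_gram FF.
split; first exact/dim_colspan/adapted_rank.
by apply/(signature_block_iff sB h22 h21 adapted_rank).
Qed.

Lemma adapted_radical : radical B (colspan (row_mx E2 E1)) = colspan E1.
Proof.
have [dn FF] := aF; have [[h22 h21 _ _] [_ h11 _ _] _ _] := stdform_gram FF.
by apply: radical_eq; apply: radical_colspan; rewrite ?h22 ?sqr1_unit ?Jform_sqr.
Qed.

Lemma adapted_mem_isotropic : isotropic_sub B k (colspan E1).
Proof.
have [dn FF] := aF; have [_ [_ h11 _ _] _ _] := stdform_gram FF.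
apply/isotropic_colspan => //; exact: rank_row_mxl (rank_row_mxC adapted_rank).
Qed.

(** The same vectors regrouped as a frame for the isotropic span of [E1], with [E2] and [E3] merged.
    Orbit chart and isotropic chart thus use one basis and can be compared. *)
Lemma adapted_line : adapted 0 0 B (Jform_sum R r s r' s') 0 E1 (row_mx E2 E3) E4.
Proof.
have [dn FF] := aF.
have [[h22 h21 h23 h24] [h12 h11 h13 h14] [h32 h31 h33 h34] [h42 h41 h43 h44]] :=
  stdform_gram FF.
split; first by move: dn; clear; lia.
apply: gram_stdform => //; rewrite ?[LHS]flatmx0 ?[RHS]flatmx0 //.
- by rewrite gram_block h22 h23 h32 h33.
- by rewrite gram_rowr h12 h13 row_mx0.
- by rewrite gram_rowr h42 h43 row_mx0.
Qed.

End AdaptedFacts.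

Lemma radical_isotropic W : Orb W -> isotropic_sub B k (radical B W).
Proof.
move=> /adapted_orbit[E2 [E1 [E3 [E4 [aF ->]]]]].
by rewrite (adapted_radical aF); exact: adapted_mem_isotropic aF.
Qed.

Lemma radical_surj N : isotropic_sub B k N -> exists2 W, Orb W & radical B W = N.
Proof.
move=> /adapted_isotropic[E2 [E1 [E3 [E4 [aF ->]]]]].
exists (colspan (row_mx E2 E1)); first exact: adapted_mem_orbit aF.
exact: adapted_radical aF.
Qed.

Lemma orbit_embedded : embedded_codim (Gr R (r + s + k) n) Orb (k * (k + 1) %/ 2).
Proof.
have [d [L [L' [LK L'K L0 [sL sL'] LP]]]] := symmetric_coords R (r' + s') (r + s) k.
have [Om0 [P0 smP]] := smooth_orthonormalization_Jform R r s.
exists d => W /adapted_orbit[E2 [E1 [E3 [E4 [[dn FF] ->]]]]].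
exists (graph (row_mx (row_mx E2 E1) (row_mx E3 E4)) @` orbit_dom J3 Om0),
  (orbit_chart J3 E2 E1 E3 E4 L), (orbit_param J3 E2 E1 E3 E4 L').
split.
- exact: (orbit_chartP sB (Jform_sqr R r' s') dn FF smP).
- exists 0; last exact: graph0.
  exact: orbit_dom0 smP.
- move=> y Dy.
  exact: (orbit_chart_iff sB (Jform_sqr R r' s') (Jform_tr R r' s') dn FF smP LP).
Qed.

End Fixed.

Lemma gact_mem n (h : 'M[R]_n) W x : h \in unitmx ->
  x \in gact h W <-> invmx h *m x \in W.
Proof.
move=> hu; split=> [/memv_imgP[y yW ->]|xW].
  by rewrite lfunE /= mulKmx.
by apply/memv_imgP; exists (invmx h *m x) => //; rewrite lfunE /= mulKVmx.
Qed.

(** For an arbitrary [W], the null vectors of a diagonalizing basis span the radical, so the default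
    value of [xget] never arises. *)
Lemma radical_colspan_exists n (B : 'M[R]_n) W : B^T = B ->
  forall x, x \in radical B W <-> x \in W /\ perp B W x.
Proof.
move=> sB; have [A rA AW] := colspan_exists (erefl (\dim W)).
have [a [b [c [X [Y [Z [abc rZ D]]]]]]] := sylvester (gram_tr A A sB).
have [XX YY ZZ XY [XZ YZ]] := diag_cols_mul D.
have rk := diag_cols_rank sB (diag_cols_mul D) (rank_mulmx_full rA rZ).
pose Z2 := row_mx (A *m X) (A *m Y).
have EW : W = colspan (row_mx Z2 (A *m Z)).
  apply/esym/eqP; rewrite eqEdim; apply/andP; split; last by rewrite (dim_colspan _).2 // abc.
  rewrite -[in X in (_ <= X)%VS]AW; apply/colspan_sub.
  by exists (row_mx (row_mx X Y) Z); rewrite !mul_mx_row.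
have h22 : gram B Z2 Z2 = Jform R a b.
  by rewrite gram_block XX YY XY (gram_eq0C sB XY).
have h21 : gram B Z2 (A *m Z) = 0 by rewrite gram_rowl XZ YZ col_mx0.
have RP := radical_colspan sB (_ : gram B Z2 Z2 \in unitmx) h21 ZZ.
have h22u : gram B Z2 Z2 \in unitmx by rewrite h22 sqr1_unit // Jform_sqr.
by have {}RP := RP h22u; rewrite -EW in RP; rewrite (radical_eq RP).
Qed.

Lemma radical_gact n (B : 'M[R]_n) h W : B^T = B -> Oset B h ->
  radical B (gact h W) = gact h (radical B W).
Proof.
move=> sB [hu hB]; apply: radical_eq => x; rewrite !gact_mem //.
have RP := radical_colspan_exists W sB (invmx h *m x).
have PE : perp B W (invmx h *m x) <-> perp B (gact h W) x.
  split=> H w wW.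
    move: wW; rewrite gact_mem // => /H; rewrite !bformE.
    by rewrite -(gram_act _ _ hB) !mulKVmx.
  have := H (h *m w); rewrite !bformE gact_mem // mulKmx // => /(_ wW).
  by rewrite -{1}[x](mulKVmx hu) gram_act.
by rewrite RP PE.
Qed.

End OrbitGeometry.
Arguments adapted {R} r s {n k c} B J3 E2 E1 E3 E4.

(** * The submersion onto isotropic subspaces *)

Section RadicalSubmersion.
Variable R : realType.

Lemma Gr_plot_sub n k d (U V : set 'rV[R]_d) c : open V -> V `<=` U ->
  plot (Gr R k n) U c -> plot (Gr R k n) V c.
Proof.
move=> oV VU [oU H]; split=> // x Vx; have [A [g [Ax AU [sg rg] cg]]] := H x (VU x Vx).
have oA := sfam_open sg.
exists (A `&` V), g; split=> //.
- split; last by move=> y [/rg].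
  by apply: sfam_sub sg => [|y []//]; exact: openI.
- by move=> y [/cg].
Qed.

(** Chain rule for [g \o t = id]: a smooth right inverse through the point makes the differential of
    [g] onto. *)
Lemma diff_right_inverse d e (U : set 'rV[R]_d) (A : set 'rV[R]_e)
    (g : 'rV[R]_d -> 'rV[R]_e) (t : 'rV[R]_e -> 'rV[R]_d) w0 :
  sfam U g -> sfam A t -> A w0 -> U (t w0) -> (forall w, g (t w) = w) ->
  forall w, exists v, 'd g (t w0) v = w.
Proof.
move=> [_ sg] [_ st] Aw0 Uw0 gt w; exists ('d t w0 w).
have dg : differentiable g (t w0) := (sg 1%N).1 _ Uw0.
have dt : differentiable t w0 := (st 1%N).1 _ Aw0.
have /(congr1 (@^~ w)) /= <- := diff_comp dt dg.
have -> : g \o t = id by apply/funext.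
by rewrite diff_val.
Qed.

Section Fixed.
Variables (n r s k r' s' : nat) (B : 'M[R]_n).
Hypotheses (sB : B^T = B) (Bu : B \in unitmx)
  (Bsig : has_signature B fullv (r + k + r') (s + k + s')).

Local Notation Orb := (orbit_sig B (r + s + k) r s).
Local Notation J2 := (Jform R r s).
Local Notation J3 := (Jform R r' s').

(** Near each parameter the subspaces are graphs over the subspace at that parameter, and
    [radical_frame] is a smooth frame of their radicals. *)
Lemma radical_plot d (U : set 'rV[R]_d) c :
  plot (Gr R (r + s + k) n) U c -> (forall y, U y -> Orb (c y)) ->
  plot (Gr R k n) U (fun y => radical B (c y)).
Proof.
move=> pc Oc; have oU : open U by case: pc.
apply: Gr_plot_local => // x Ux.
have [E2 [E1 [E3 [E4 [[dn FF] cx]]]]] := adapted_orbit sB Bu Bsig (Oc x Ux).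
have [Om0 [P0 smP]] := smooth_orthonormalization_Jform R r s.
have J33 := Jform_sqr R r' s'.
have [F' F'F FF'] := frame_inv (Jform_sqr R r s) J33 dn FF.
have cx0 : graph (row_mx (row_mx E2 E1) (row_mx E3 E4)) 0 = c x by rewrite graph0.
have [V [M [Vx VU sM cM]]] := Gr_plot_near F'F FF' pc Ux (ex_intro2 _ _ 0 I cx0).
have M0 : M x = 0 by apply: (graph_inj F'F); rewrite -cM.
have oV' := fam_open_orbit_dom (J3 := J3) smP sM.
exists (V `&` [set y | orbit_dom J3 Om0 (M y)]); split.
- by split=> //=; rewrite M0; exact: orbit_dom0 smP.
- by move=> y [/VU].
have sMV : sfam (V `&` [set y | orbit_dom J3 Om0 (M y)]) M by apply: sfam_sub sM => // y [].
have eqS y : V y -> orbit_dom J3 Om0 (M y) ->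
    drsubmx (M y) + (drsubmx (M y))^T + corr J3 (M y) = 0.
  move=> Vy OM; apply/(orbit_graph_iff sB J33 dn FF smP OM).
  by rewrite -cM //; exact/Oc/VU.
apply: (Gr_plot_colspan (g := fun y => radical_frame J3 E2 E1 E3 E4 (M y))).
- by apply: (fam_smooth_radical_frame sB FF smP sMV) => y [].
- by move=> y [Vy OM]; have [] := radical_graph sB J33 dn FF smP OM (eqS y Vy OM).
- move=> y [Vy OM]; rewrite cM //.
  by have [] := radical_graph sB J33 dn FF smP OM (eqS y Vy OM).
Qed.

Lemma radical_smooth :
  smooth_map (sub_space (Gr R (r + s + k) n) Orb)
    (sub_space (Gr R k n) (isotropic_sub B k)) (radical B).
Proof.
split=> [W [_ OW]|d U c [pc Oc]] /=.
  have iW := radical_isotropic sB Bu Bsig OW; split=> //.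
  by apply/Gr_carrierP; case: iW.
split; first exact: radical_plot.
by move=> y Uy; exact: (radical_isotropic sB Bu Bsig (Oc y Uy)).
Qed.

(* With [W] near [W0] given by the blocks [0, b, - a^T J2, c'], the radical of [W]
   has coordinates [a, b, c']; this gives a right inverse of [radical] in charts. *)
Lemma radical_section E2 E1 E3 E4 Om0 P0 (a : 'M[R]_(r + s, k))
    (b : 'M[R]_(r' + s', k)) (c' : 'M[R]_k) :
  adapted r s B J3 E2 E1 E3 E4 -> smooth_orthonormalization J2 Om0 P0 ->
  c' + c'^T = 0 ->
  let M1 : 'M[R]_(r' + s' + k, r + s + k) := block_mx 0 b (- (a^T *m J2)) c' in
  let M' : 'M[R]_(r + s + (r' + s') + k, 0 + 0 + k) :=
    block_mx 0 (col_mx a b) 0 c' in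
  orbit_dom J3 Om0 M1 /\
  radical B (graph (row_mx (row_mx E2 E1) (row_mx E3 E4)) (unstraighten J3 M1)) =
  graph (row_mx (row_mx (0 : 'M[R]_(n, 0 + 0)) E1) (row_mx (row_mx E2 E3) E4))
    (unstraighten (r := 0) (s := 0) (Jform_sum R r s r' s') M').
Proof.
move=> [dn FF] smP cc M1 M'.
have J33 := Jform_sqr R r' s'; have J22 := Jform_sqr R r s.
have sJ3 := Jform_tr R r' s'; have sJ2 := Jform_tr R r s.
have g22 : gram22 J3 M1 = J2.
  by rewrite /gram22 /M1 block_mxKul mulmx0 addr0.
have OM1 : orbit_dom J3 Om0 M1.
  by rewrite /orbit_dom /= g22; case: smP.
have g21 : gram21 (r := r) (s := s) J3 M1 = - (J2 *m a).
  rewrite /gram21 /M1 block_mxKul block_mxKdl trmx0 !mul0mx addr0.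
  by rewrite linearN /= trmx_mul trmxK sJ2.
(* The lower left block of [M1] was chosen for this: projecting off [frame2] with coefficient [- a]
   gives the radical the component [E2 *m a]. *)
have rc : radcoef (r := r) (s := s) J3 M1 = - a.
  rewrite /radcoef g22 g21 mulmxN; congr (- _).
  by rewrite mulKmx // sqr1_unit.
have co : corr (r := r) (s := s) J3 M1 = b^T *m J3 *m b - a^T *m J2 *m a.
  rewrite /corr rc g21 /M1 block_mxKur [(- (J2 *m a))^T]linearN /= mulNmx mulmxN opprK trmx_mul sJ2.
  by [].
split=> //.
have OM2 := orbit_dom_unstraighten OM1.
have S0 : drsubmx (unstraighten J3 M1) + (drsubmx (unstraighten J3 M1))^T +
    corr (r := r) (s := s) J3 (unstraighten J3 M1) = 0.
  by rewrite -(straighten_dr sB sJ3 FF OM2) unstraightenK /M1 block_mxKdr.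
have [_ ->] := radical_graph sB J33 dn FF smP OM2 S0.
have [ul2 ur2 dl2 dr2] := sub_dr_block M1 (- (2^-1 *: corr J3 M1)).
rewrite -unstraighten_add in ul2 ur2 dl2 dr2.
have rc2 : radcoef (r := r) (s := s) J3 (unstraighten J3 M1) = - a.
  by rewrite -rc /radcoef /gram21 /gram22 ul2 ur2 dl2.
have [uI urI dlI drI] := sub_dr_block M'
  (- (2^-1 *: corr (r := 0) (s := 0) (Jform_sum R r s r' s') M')).
rewrite -unstraighten_add in uI urI dlI drI.
have coI : corr (r := 0) (s := 0) (Jform_sum R r s r' s') M' =
    a^T *m J2 *m a + b^T *m J3 *m b.
  rewrite /corr /M' block_mxKur tr_col_mx /Jform_sum mul_row_block !mulmx0 addr0 add0r.
  rewrite mul_row_col -[RHS]subr0; congr (_ - _).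
  have flat0 (X : 'M[R]_(0 + 0, k)) : X = 0 by exact: flatmx0.
  by rewrite [X in _ *m X]flat0 mulmx0.
rewrite /radical_frame /frame1 /frame2 rc2 ul2 ur2 dl2 dr2 co /graph graph_frame.
rewrite (_ : frame2 _ _ _ _ = 0); last by apply: trmx_inj; rewrite [LHS]flatmx0 [RHS]flatmx0.
rewrite colspan_col0 /frame1 urI drI coI /M' /M1 !block_mxKul !block_mxKur !block_mxKdl !block_mxKdr.
congr colspan; rewrite mul_row_col mulmx0 addr0 mulmxN opprK mulmxDl.
rewrite !mulmxN mulNmx mulmxA.
have half (X : 'M[R]_(n, k)) : X = 2^-1 *: X + 2^-1 *: X.
  by rewrite -scalerDl addr_half scale1r.
rewrite !mulmxDr !mulmxN -!scalemxAr !mulmxDr !mulmxN !mulmxA.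
set X2 := E2 *m a; set X3 := E3 *m b; set Xb := E4 *m b^T *m J3 *m b.
set Xa := E4 *m a^T *m J2 *m a; set Xc := E4 *m c'.
(* The half-corrections of the two charts differ by a^T J2 a, which is supplied by the [E4]
   component of [frame2] times [a]. *)
rewrite {2}(half Xa) !scalerDr !scalerN !opprD !opprK.
move: X2 X3 Xb Xa Xc => X2 X3 Xb Xa Xc.
by apply/matrixP => i j; rewrite !mxE; ring.
Qed.

Lemma radical_submersion :
  submersion (sub_space (Gr R (r + s + k) n) Orb)
    (sub_space (Gr R k n) (isotropic_sub B k)) (radical B).
Proof.
split=> [|W [_ OW]]; first exact: radical_smooth.
have [d [L [L' [LK L'K L0 [sL sL'] LP]]]] := symmetric_coords R (r' + s') (r + s) k.
have [e [LI [LI' [LIK LI'K LI0 [sLI sLI'] LIP]]]] :=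
  symmetric_coords R (r + s + (r' + s')) (0 + 0) k.
have [Om0 [P0 smP]] := smooth_orthonormalization_Jform R r s.
have [OmI [PI smI]] := smooth_orthonormalization_Jform R 0 0.
have [E2 [E1 [E3 [E4 [aF EW]]]]] := adapted_orbit sB Bu Bsig OW.
have [dn FF] := aF; have [dnI FI] := adapted_line sB aF.
have J33 := Jform_sqr R r' s'; have sJ3 := Jform_tr R r' s'.
have JII := Jform_sum_sqr R r s r' s'; have sJI := Jform_sum_tr R r s r' s'.
pose FO := row_mx (row_mx E2 E1) (row_mx E3 E4).
pose FI' := row_mx (row_mx (0 : 'M[R]_(n, 0 + 0)) E1) (row_mx (row_mx E2 E3) E4).
have chO := chart_sub_space (orbit_chartP sB J33 dn FF smP LK L'K sL sL')
  (orbit_chart_iff sB J33 sJ3 dn FF smP LP).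
have chI := chart_sub_space (orbit_chartP sB JII dnI FI smI LIK LI'K sLI sLI')
  (orbit_chart_iff sB JII sJI dnI FI smI LIP).
have RW : radical B W = colspan E1 by rewrite EW (adapted_radical sB aF).
have OmIT M : orbit_dom (r := 0) (s := 0) (k := k) (Jform_sum R r s r' s') OmI M.
  rewrite /orbit_dom /=; have [+ _ _ _ _] := smI.
  by congr OmI; rewrite [LHS]flatmx0 [RHS]flatmx0.
rewrite -(isotropic_orbit k sB) in chI.
exists d, e; do 6! eexists; split.
- exact: chO.
- split=> //; rewrite EW; exists 0; last exact: graph0.
  exact: orbit_dom0 smP.
- exact: chI.
- split; last exact: (radical_isotropic sB Bu Bsig OW).
  by rewrite RW -(colspan_col0 E1); exists 0; [exact: OmIT|exact: graph0].
set g := (_ \o _ \o _).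
have kW : lsubmx (orbit_chart J3 E2 E1 E3 E4 L W) = 0.
  by rewrite EW (orbit_chart0 J33 dn FF L0) linear0.
(* Isotropic coordinates [w] are split into their components along [E2], [E3] and [E4]; the last is
   antisymmetric since the symmetric coordinates are set to 0. The right inverse [t] sends them to
   the orbit coordinates of [M1 w]. *)
pose a w := usubmx (ursubmx (LI' (row_mx w 0))).
pose b w := dsubmx (ursubmx (LI' (row_mx w 0))).
pose c' w := drsubmx (LI' (row_mx w 0)).
pose M1 (w : 'rV[R]_e) : 'M[R]_(r' + s' + k, r + s + k) :=
  block_mx 0 (b w) (- ((a w)^T *m J2)) (c' w).
pose t w := lsubmx (L (M1 w)).
have cc w : c' w + (c' w)^T = 0 by apply/LIP; rewrite LI'K row_mxKr.
have LM1 w : L (M1 w) = row_mx (t w) 0.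
  rewrite -[LHS]hsubmxK (_ : rsubmx _ = 0) //; apply/LP.
  by rewrite block_mxKdr.
have t0 : t 0 = 0.
  have z : LI' (row_mx 0 0) = 0 by rewrite row_mx0 -LI0 LIK.
  have [_ urz _ drz] := submx_zero R (r + s + (r' + s')) k (0 + 0) k.
  rewrite /t /M1 /a /b /c' z urz drz !linear0 mul0mx oppr0 block_mx0 L0.
  exact: linear0.
have st : sfam setT t.
  have s1 : sfam setT (fun w : 'rV[R]_e => row_mx w 0 : 'rV[R]_(e + (k * (k + 1) %/ 2))).
    by apply: sfam_row_mx; [apply: sfam_id; exact: openT|apply: sfam_cst; exact: openT].
  have s2 := sLI' _ _ _ s1 (fun _ _ => I); have [_ s3 _ s4] := sfam_ulsubmx s2.
  apply: sfam_linear; apply: sL => //; apply: sfam_block_mx => //.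
  - by apply: sfam_cst; exact: openT.
  - exact: sfam_linear.
  - apply: sfam_opp; apply: sfam_mul; last by apply: sfam_cst; exact: openT.
    by apply: sfam_tr; exact: sfam_linear.
have gt w : g (t w) = w.
  rewrite /g /= /orbit_param -LM1 LK.
  have [_ ->] := radical_section (a w) (b w) aF smP (cc w).
  have -> : block_mx 0 (col_mx (a w) (b w)) 0 (c' w) = LI' (row_mx w 0).
    rewrite /a /b /c' vsubmxK -[RHS]submxK; congr block_mx;
      by apply: trmx_inj; rewrite [LHS]flatmx0 [RHS]flatmx0.
  have [G' G'G GG'] := frame_inv (Jform_sqr R 0 0) JII dnI FI.
  by rewrite /orbit_chart (graphK G'G) unstraightenK LI'K row_mxKl.
have [_ oK [_ [_ pphi] kphi _]] := chO.
set K := (X in open X) in oK pphi.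
have [pO DO] := pphi _ _ id (conj (sfam_id oK) (fun y Ky => Ky)).
have [pOG OO] := pO.
have prad := radical_plot pOG OO.
have [[_ oE] _ [[_ plam] _ _ _]] := chI.
have pradI : plot (sub_space (Gr R k n) (isotropic_sub B k)) K
    (fun y => radical B (orbit_param J3 E2 E1 E3 E4 L' (row_mx y 0))).
  split=> //; move=> y Ky; exact: (radical_isotropic sB Bu Bsig (OO y Ky)).
(* The chart expression of the radical is smooth on the part of the source chart that lands in the
   domain of the target chart. *)
have oU := oE _ _ _ pradI; set U := _ `&` _ in oU.
have pU : plot (Gr R k n) U (fun y => radical B (orbit_param J3 E2 E1 E3 E4 L' (row_mx y 0))).
  by apply: Gr_plot_sub prad => // y [].
have [|slam _] := plam d U (fun y => radical B (orbit_param J3 E2 E1 E3 E4 L' (row_mx y 0))).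
  split; last by move=> y [].
  by split=> // y [Ky _]; exact: pradI.2.
have KW : K 0.
  exists W => //=; split=> //; rewrite EW; exists 0; last exact: graph0.
  exact: orbit_dom0 smP.
move=> w; rewrite [X in 'd g X](_ : _ = t 0); last by rewrite t0 -kW.
apply: (diff_right_inverse slam st) => //.
rewrite t0; split=> //=.
rewrite -kW kphi; last first.
  split; first by split=> //; apply/Gr_carrierP; case: OW.
  by split=> //; rewrite EW; exists 0; [exact: orbit_dom0 smP|exact: graph0].
split; last exact: (radical_isotropic sB Bu Bsig OW).
by rewrite RW -(colspan_col0 E1); exists 0; [exact: OmIT|exact: graph0].
Qed.

End Fixed.
End RadicalSubmersion.

(** * Stabilizers of isotropic subspaces *)

Lemma block_utri (R : nzRingType) m1 m2 m3 n1 n2 n3 (a : 'M[R]_(m1, n1))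
    (b : 'M[R]_(m1, n2)) (t : 'M[R]_(m2, n2)) (x : 'M[R]_(m1, n3)) (y : 'M[R]_(m2, n3))
    (z : 'M[R]_(m3, n3)) :
  row_mx (row_mx (col_mx (col_mx a 0) 0) (col_mx (col_mx b t) 0)) (col_mx (col_mx x y) z) =
  block_mx (block_mx a b 0 t) (col_mx x y) 0 z.
Proof.
by rewrite -[row_mx (col_mx (col_mx a 0) 0) _]block_mxEh block_mxEv row_mx0 -!block_mxEh.
Qed.

Section IsotropicStabilizer.
Variables (R : realType) (n k m : nat) (B : 'M[R]_n) (J : 'M[R]_m).
Variables (E1 : 'M[R]_(n, k)) (E' : 'M[R]_(n, m)) (E4 : 'M[R]_(n, k)).

Definition hyperbolic_frame :=
  [/\ (k + m + k)%N = n, gram B E1 E1 = 0, gram B E1 E' = 0, gram B E1 E4 = 1%:M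
    & [/\ gram B E' E' = J, gram B E' E4 = 0 & gram B E4 E4 = 0]].

Hypotheses (sB : B^T = B) (JJ : J *m J = 1%:M) (hF : hyperbolic_frame).

Let dn : (k + m + k)%N = n. Proof. by case: hF. Qed.
Let h11 : gram B E1 E1 = 0. Proof. by case: hF. Qed.
Let h1' : gram B E1 E' = 0. Proof. by case: hF. Qed.
Let h14 : gram B E1 E4 = 1%:M. Proof. by case: hF. Qed.
Let h'' : gram B E' E' = J. Proof. by case: hF => _ _ _ _ []. Qed.
Let h'4 : gram B E' E4 = 0. Proof. by case: hF => _ _ _ _ []. Qed.
Let h44 : gram B E4 E4 = 0. Proof. by case: hF => _ _ _ _ []. Qed.
Let h'1 : gram B E' E1 = 0. Proof. exact: gram_eq0C sB h1'. Qed.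
Let h4' : gram B E4 E' = 0. Proof. exact: gram_eq0C sB h'4. Qed.
Let h41 : gram B E4 E1 = 1%:M. Proof. by rewrite -(gram_tr _ _ sB) h14 trmx1. Qed.
Local Notation F := (row_mx (row_mx E1 E') E4).

(** Inverse of the frame: coordinates along [E1] are pairings with [E4] and conversely, while on the
    middle block [J] is its own inverse. *)
Definition coframe : 'M[R]_(k + m + k, n) :=
  col_mx (col_mx (E4^T *m B) (J *m (E'^T *m B))) (E1^T *m B).

Lemma coframe_mul l (X : 'M[R]_(n, l)) : coframe *m X =
  col_mx (col_mx (gram B E4 X) (J *m gram B E' X)) (gram B E1 X).
Proof. by rewrite /coframe !mul_col_mx /gram !mulmxA. Qed.

Lemma coframeK : coframe *m F = 1%:M.
Proof.
rewrite !mul_mx_row !coframe_mul h41 h4' h44 h'1 h'' h'4 h11 h1' h14 !mulmx0 JJ.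
by rewrite block_utri col_mx0 -!scalar_mx_block.
Qed.

Lemma frameK : F *m coframe = 1%:M.
Proof. by apply: rect_mulmx1C coframeK; rewrite dn. Qed.

Lemma frame_decomp l (X : 'M[R]_(n, l)) :
  X = E1 *m gram B E4 X + E' *m (J *m gram B E' X) + E4 *m gram B E1 X.
Proof.
by rewrite -[LHS]mul1mx -frameK -mulmxA coframe_mul !mul_row_col.
Qed.

(** For [h] stabilizing N, the span of [E1], [alpha h] is its matrix on N and [theta h] its matrix
    on N^perp/N. *)
Definition alpha (h : 'M[R]_n) : 'M[R]_k := gram B E4 (h *m E1).
Definition theta (h : 'M[R]_n) : 'M[R]_m := J *m gram B E' (h *m E').

Section Element.
Variable h : 'M[R]_n.
Hypotheses (Oh : Oset B h) (hN : gact h (colspan E1) = colspan E1).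

Lemma stab_E1 : h *m E1 = E1 *m alpha h.
Proof.
have [Z EZ] : exists Z, h *m E1 = E1 *m Z.
  by apply/colspan_sub; rewrite -gact_colspan hN.
by rewrite /alpha EZ gramMr h41 mul1mx.
Qed.

Lemma rank_E1 : \rank E1 = k.
Proof.
by apply/rank_linvP; exists (E4^T *m B).
Qed.

Lemma alpha_unit : alpha h \in unitmx.
Proof.
have [Z EZ] : exists Z, E1 = h *m E1 *m Z.
  by apply/colspan_sub; rewrite -gact_colspan hN.
have : alpha h *m Z = 1%:M.
  by apply: (rank_inj rank_E1); rewrite mulmxA -stab_E1 -EZ mulmx1.
by move=> /mulmx1_unit[].
Qed.

(* Since [h] preserves [E1], it preserves the orthogonal of [E1] as well. *)
Lemma stab_gram1 l (X : 'M[R]_(n, l)) :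
  gram B E1 (h *m X) = (invmx (alpha h))^T *m gram B E1 X.
Proof.
have [hu hB] := Oh.
have -> : E1 = h *m (E1 *m invmx (alpha h)).
  by rewrite mulmxA stab_E1 mulmxK // alpha_unit.
by rewrite gram_act // gramMl mulmxA stab_E1 mulmxK // alpha_unit.
Qed.

Lemma stab_E' : h *m E' = E1 *m gram B E4 (h *m E') + E' *m theta h.
Proof. by rewrite {1}(frame_decomp (h *m E')) stab_gram1 h1' !mulmx0 addr0. Qed.

Lemma gram_perp l l' (X : 'M[R]_(k, l)) (Y : 'M[R]_(m, l)) (X' : 'M[R]_(k, l')) (Y' : 'M[R]_(m, l')) :
  gram B (E1 *m X + E' *m Y) (E1 *m X' + E' *m Y') = Y^T *m J *m Y'.
Proof.
rewrite gramDl !gramDr !gramMl !gramMr h11 h1' h'1 h''.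
by rewrite !mul0mx !mulmx0 !add0r mulmxA.
Qed.

Lemma theta_orth : (theta h)^T *m J *m theta h = J.
Proof. have [hu hB] := Oh; rewrite -(gram_perp (gram B E4 (h *m E')) _ (gram B E4 (h *m E'))).
by rewrite -stab_E' gram_act. Qed.

(** In the frame, [h] is block triangular with diagonal blocks [alpha h], [theta h] and the inverse
    transpose of [alpha h]; the outer determinants cancel. *)
Lemma theta_det : \det (theta h) = \det h.
Proof.
rewrite -(rect_det h dn coframeK) -mulmxA !mul_mx_row !coframe_mul !stab_gram1.
rewrite h11 h1' h14 !mulmx0 mulmx1 stab_E1 [gram B E' (E1 *m _)]gramMr h'1 mul0mx mulmx0.
rewrite gramMr h41 mul1mx -/(theta h).
rewrite block_utri !det_ublock det_tr det_inv mulrAC mulfV ?mul1r //.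
by have := alpha_unit; rewrite unitmxE unitfE.
Qed.

Lemma theta_Oset : Oset J (theta h).
Proof.
split; last exact: theta_orth.
by have [hu _] := Oh; rewrite unitmxE theta_det -unitmxE.
Qed.

End Element.

Section Product.
Variables g h : 'M[R]_n.
Hypotheses (Og : Oset B g) (gN : gact g (colspan E1) = colspan E1)
  (Oh : Oset B h) (hN : gact h (colspan E1) = colspan E1).

Lemma alpha_mul : alpha (g *m h) = alpha g *m alpha h.
Proof.
by rewrite {1}/alpha -mulmxA (stab_E1 hN) mulmxA (stab_E1 gN) -mulmxA gramMr h41 mul1mx.
Qed.

Lemma theta_mul : theta (g *m h) = theta g *m theta h.
Proof.
rewrite {1}/theta -mulmxA (stab_E' Oh hN) mulmxDr [g *m (E1 *m _)]mulmxA (stab_E1 gN).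
rewrite [g *m (E' *m _)]mulmxA gramDr -[E1 *m _ *m _]mulmxA [gram B E' (E1 *m _)]gramMr h'1.
by rewrite mul0mx add0r gramMr mulmxA.
Qed.

End Product.

(** Element of the Levi factor of the stabilizer, a common section of [alpha] and [theta]. The block
    on [E4] is dictated by its duality with [E1]. *)
Definition stab_lift (a : 'M[R]_k) (g : 'M[R]_m) : 'M[R]_n :=
  row_mx (row_mx (E1 *m a) (E' *m g)) (E4 *m (invmx a)^T) *m coframe.

Section Lift.
Variables (a : 'M[R]_k) (g : 'M[R]_m).
Hypotheses (au : a \in unitmx) (Og : Oset J g).

Lemma stab_lift_frame : stab_lift a g *m F =
  row_mx (row_mx (E1 *m a) (E' *m g)) (E4 *m (invmx a)^T).
Proof. by rewrite /stab_lift -mulmxA coframeK mulmx1. Qed.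

Lemma stab_lift_mul : [/\ stab_lift a g *m E1 = E1 *m a, stab_lift a g *m E' = E' *m g
  & stab_lift a g *m E4 = E4 *m (invmx a)^T].
Proof. by have := stab_lift_frame; rewrite !mul_mx_row => /eq_row_mx[/eq_row_mx[-> ->] ->]. Qed.

Lemma stab_lift_theta : theta (stab_lift a g) = g.
Proof.
by have [_ e _] := stab_lift_mul; rewrite /theta e gramMr h'' mulmxA JJ mul1mx.
Qed.

Lemma stab_lift_alpha : alpha (stab_lift a g) = a.
Proof. by have [e _ _] := stab_lift_mul; rewrite /alpha e gramMr h41 mul1mx. Qed.

Lemma stab_lift_stab : gact (stab_lift a g) (colspan E1) = colspan E1.
Proof. by have [e _ _] := stab_lift_mul; rewrite gact_colspan e colspan_mulr. Qed.

Lemma stab_lift_Oset : Oset B (stab_lift a g).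
Proof.
have [gu gJ] := Og; have [e1 e2 e3] := stab_lift_mul.
have aa : a^T *m (invmx a)^T = 1%:M by rewrite -trmx_mul mulVmx // trmx1.
have FF : gram B (stab_lift a g *m F) (stab_lift a g *m F) = gram B F F.
  rewrite !mul_mx_row e1 e2 e3 !gram_rowl !gram_rowr !gramMl !gramMr.
  rewrite h11 h1' h14 h'1 h'' h'4 h41 h4' h44 !mul0mx !mulmx0 !mul1mx aa.
  by rewrite trmxK mulVmx // mulmxA gJ.
have hB : (stab_lift a g)^T *m B *m stab_lift a g = B.
  move: FF; rewrite {1}/gram trmx_mul => /(congr1 (fun M => coframe^T *m M *m coframe)).
  rewrite /gram -!mulmxA frameK !mulmx1 !mulmxA -trmx_mul frameK trmx1 !mul1mx.
  by rewrite -!mulmxA.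
split=> //; have := stab_lift_frame; move=> E.
have := rect_det (stab_lift a g) dn coframeK; rewrite -mulmxA E !mul_mx_row !coframe_mul.
rewrite !gramMr h11 h1' h14 h'1 h'' h'4 h41 h4' h44 !mul0mx !mulmx0 !mul1mx mulmxA JJ mul1mx.
rewrite block_utri !det_ublock det_tr det_inv mulrAC mulfV ?mul1r => [dE|].
  by rewrite unitmxE -dE -unitmxE.
by move: au; rewrite unitmxE unitfE.
Qed.

End Lift.

End IsotropicStabilizer.

Lemma adapted_hyperbolic (R : realType) n r s k r' s' (B : 'M[R]_n)
    (E2 : 'M[R]_(n, r + s)) (E1 : 'M[R]_(n, k)) (E3 : 'M[R]_(n, r' + s')) (E4 : 'M[R]_(n, k)) :
  adapted r s B (Jform R r' s') E2 E1 E3 E4 ->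
  hyperbolic_frame B (Jform_sum R r s r' s') E1 (row_mx E2 E3) E4.
Proof.
move=> [dn FF].
have [[h22 _ h23 h24] [h12 h11 h13 h14] [h32 _ h33 h34] [_ _ _ h44]] := stdform_gram FF.
split=> //; [by move: dn; clear; lia|by rewrite gram_rowr h12 h13 row_mx0|split=> //].
- by rewrite gram_block h22 h23 h32 h33.
- by rewrite gram_rowl h24 h34 col_mx0.
Qed.

(** * Fibers of the submersion *)

Section Fibers.
Variable R : realType.

Lemma rank_gram_row n a k (B : 'M[R]_n) (Z2 : 'M[R]_(n, a)) (Z1 : 'M[R]_(n, k)) :
  gram B Z2 Z2 \in unitmx -> gram B Z2 Z1 = 0 -> \rank Z1 = k ->
  \rank (row_mx Z2 Z1) = (a + k)%N.
Proof.
move=> u22 h21 r1; apply/rank_injP => x; rewrite -[x]vsubmxK mul_row_col => E.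
have y0 : usubmx x = 0.
  have : gram B Z2 (Z2 *m usubmx x + Z1 *m dsubmx x) = 0 by rewrite E /gram mulmx0.
  rewrite gramDr !gramMr h21 mul0mx addr0 => /(congr1 (mulmx (invmx (gram B Z2 Z2)))).
  by rewrite mulKmx // mulmx0.
move: E; rewrite y0 mulmx0 add0r => E.
by rewrite ((rank_injP _).1 r1 _ E) col_mx0.
Qed.

Lemma gram_congr_unit n (G J P : 'M[R]_n) : gram G P P = J -> J \in unitmx ->
  G \in unitmx /\ P \in unitmx.
Proof.
move=> <-; rewrite /gram !unitmx_mul => /andP[/andP[_ Gu] Pu]; by [].
Qed.

Lemma Oset_detP n (J g : 'M[R]_n) : J \in unitmx -> g^T *m J *m g = J ->
  \det g = 1 \/ \det g = -1.
Proof.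
move=> Ju /(congr1 determinant); rewrite !det_mulmx det_tr mulrAC => dE.
have J0 : \det J != 0 by rewrite -unitfE -unitmxE.
have /eqP : \det g * \det g = 1 by apply: (mulIf J0); rewrite dE mul1r.
by rewrite -expr2 sqrf_eq1 => /orP[/eqP|/eqP]; [left|right].
Qed.

Lemma Oset_intro n (J g : 'M[R]_n) : J \in unitmx -> g^T *m J *m g = J -> Oset J g.
Proof. by move=> Ju gJ; have [] := gram_congr_unit gJ Ju. Qed.

Lemma Oset_mul n (J g h : 'M[R]_n) : Oset J g -> Oset J h -> Oset J (g *m h).
Proof.
move=> [gu gJ] [hu hJ]; split; first by rewrite unitmx_mul gu.
by rewrite trmx_mul -!mulmxA (mulmxA J) (mulmxA g^T) (mulmxA g^T) gJ mulmxA.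
Qed.

Lemma Oset_inv n (J g : 'M[R]_n) : Oset J g -> Oset J (invmx g).
Proof.
move=> [gu gJ]; split; first by rewrite unitmx_inv.
by rewrite -{1}gJ !mulmxA -trmx_mul mulmxV // trmx1 mul1mx -mulmxA mulmxV // mulmx1.
Qed.

Lemma Oset1 n (J : 'M[R]_n) : Oset J 1%:M.
Proof. by split; rewrite ?unitmx1 // trmx1 mul1mx mulmx1. Qed.

Lemma diag_reflection n (e : 'rV[R]_n) : (0 < n)%N ->
  exists2 x, Oset (diag_mx e) x & \det x = -1.
Proof.
case: n e => // n e _; pose d : 'rV[R]_n.+1 := \row_j (if j == 0 then -1 else 1).
have dd : \det (diag_mx d) = -1.
  rewrite det_diag (bigD1 ord0) //= mxE eqxx big1 ?mulr1 // => j j0.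
  by rewrite mxE (negPf j0).
exists (diag_mx d) => //; split; first by rewrite unitmxE dd unitrN1.
rewrite tr_diag_mx -mulmxA !mulmx_diag; congr diag_mx; apply/matrixP => i j.
by rewrite (ord1 i) !mxE mulrCA; case: eqP => _; rewrite ?mulrNN ?mulr1.
Qed.

Lemma Jform_reflection r s : (0 < r + s)%N ->
  exists2 x, Oset (Jform R r s) x & \det x = -1.
Proof. by rewrite Jform_diag; exact: diag_reflection. Qed.

Lemma Oset_block a c (J2 : 'M[R]_a) (J3 : 'M[R]_c) x y :
  Oset J2 x -> Oset J3 y -> Oset (block_mx J2 0 0 J3) (block_mx x 0 0 y).
Proof.
move=> [xu xJ] [yu yJ]; split.
  by rewrite unitmxE det_ublock unitrM -!unitmxE xu.
rewrite tr_block_mx !trmx0 !mulmx_block !mulmx0 !mul0mx !addr0 !add0r xJ yJ.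
by rewrite !mul0mx.
Qed.

Lemma gram_row_orth m a c (Q : 'M[R]_m) (J2 : 'M[R]_a) (J3 : 'M[R]_c)
    (C : 'M[R]_(m, a)) (D : 'M[R]_(m, c)) p q :
  Q^T = Q -> gram Q C D = 0 -> gram (gram Q C C) p p = J2 ->
  gram (gram Q D D) q q = J3 ->
  gram Q (row_mx (C *m p) (D *m q)) (row_mx (C *m p) (D *m q)) = block_mx J2 0 0 J3.
Proof.
move=> sQ CD <- <-; rewrite gram_block !gramMl !gramMr CD (gram_eq0C sQ CD).
by rewrite !mul0mx !mulmx0 /gram !mulmxA.
Qed.

Section Fiber.
Variables (n k r s r' s' : nat) (B : 'M[R]_n).
Local Notation a := (r + s)%N.
Local Notation c := (r' + s')%N.
Local Notation J2 := (Jform R r s).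
Local Notation J3 := (Jform R r' s').
Local Notation J := (Jform_sum R r s r' s').
Variables (E1 : 'M[R]_(n, k)) (E' : 'M[R]_(n, a + c)) (E4 : 'M[R]_(n, k)).
Hypotheses (sB : B^T = B) (hF : hyperbolic_frame B J E1 E' E4).

Local Notation Orb := (orbit_sig B (a + k) r s).
Local Notation sJ := (Jform_sum_tr R r s r' s').
Local Notation JJ := (Jform_sum_sqr R r s r' s').

Let Ju : J \in unitmx := sqr1_unit JJ.
Let J2u : J2 \in unitmx := sqr1_unit (Jform_sqr R r s).
Let J3u : J3 \in unitmx := sqr1_unit (Jform_sqr R r' s').
Let h11 : gram B E1 E1 = 0. Proof. by case: hF. Qed.
Let h1' : gram B E1 E' = 0. Proof. by case: hF. Qed.
Let h'' : gram B E' E' = J. Proof. by case: hF => _ _ _ _ []. Qed.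
Let h'1 : gram B E' E1 = 0. Proof. exact: gram_eq0C sB h1'. Qed.
Let r1 : \rank E1 = k. Proof. exact: rank_E1 sB hF. Qed.

Lemma orth_cols g : Oset J g ->
  [/\ gram J (lsubmx g) (lsubmx g) = J2, gram J (lsubmx g) (rsubmx g) = 0
    & gram J (rsubmx g) (rsubmx g) = J3].
Proof.
move=> [_ gJ]; rewrite gram_ul gram_ur gram_dr /gram gJ /Jform_sum.
by rewrite block_mxKul block_mxKur block_mxKdr.
Qed.

(** Preimage in N^perp of the subspace of N^perp/N spanned by the columns of [X], where N is the
    span of [E1]. *)
Definition fib (X : 'M[R]_(a + c, a)) := colspan (row_mx (E' *m X) E1).

Lemma fib_gram l (X : 'M[R]_(a + c, l)) : gram B (E' *m X) (E' *m X) = gram J X X.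
Proof. by rewrite gramMl gramMr h'' mulmxA. Qed.

Lemma fib_orbit X : gram J X X = J2 -> Orb (fib X) /\ radical B (fib X) = colspan E1.
Proof.
move=> XX; have g22 : gram B (E' *m X) (E' *m X) = J2 by rewrite fib_gram.
have g21 : gram B (E' *m X) E1 = 0 by rewrite gramMl h'1 mulmx0.
have rk : \rank (row_mx (E' *m X) E1) = (a + k)%N by apply: (rank_gram_row (B := B)); rewrite ?g22.
split; first split; first exact/dim_colspan.
  exact/(signature_block_iff sB g22 g21 rk).
by apply: radical_eq; apply: radical_colspan; rewrite ?g22.
Qed.

Lemma fib_mulr X (P : 'M[R]_a) : P \in unitmx -> fib (X *m P) = fib X.
Proof.
move=> Pu; rewrite /fib; apply: (colspan_eq (Z := block_mx P 0 0 1%:M)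
  (T := block_mx (invmx P) 0 0 1%:M)).
  by rewrite mul_row_block !mulmx0 addr0 add0r mulmx1 mulmxA.
by rewrite mul_row_block !mulmx0 addr0 add0r mulmx1 -mulmxA mulmxK.
Qed.

Lemma fib_inj X Y : fib X = fib Y -> exists P, X = Y *m P.
Proof.
move=> XY; have [Z EZ] : exists Z, E' *m X = row_mx (E' *m Y) E1 *m Z.
  apply/colspan_sub; rewrite -[colspan (row_mx _ _)]XY; apply/colspan_sub.
  by exists (col_mx 1%:M 0); rewrite mul_row_col mulmx1 mulmx0 addr0.
exists (usubmx Z); have := congr1 (fun M => J *m gram B E' M) EZ.
rewrite -{1}[Z]vsubmxK mul_row_col gramDr !gramMr h'' h'1 mul0mx addr0.
by rewrite !mulmxA JJ !mul1mx.
Qed.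

(** Equality of the subspaces means that h^-1 g maps the first coordinate summand to itself;
    orthogonality then kills the remaining off-diagonal block. *)
Lemma fib_coset g h : Oset J g -> Oset J h ->
  fib (lsubmx g) = fib (lsubmx h) <->
  exists x y, [/\ Oset J2 x, Oset J3 y & g = h *m block_mx x 0 0 y].
Proof.
move=> Og Oh; split=> [gh|[x [y [[xu _] _ ->]]]]; last first.
  rewrite -{1}[h]hsubmxK mul_row_block !mulmx0 !addr0 row_mxKl fib_mulr //.
have [P EP] := fib_inj gh; have [hu _] := Oh.
pose K := invmx h *m g.
have OK : Oset J K by apply: Oset_mul => //; exact: Oset_inv.
have [K11 K12 K22] := orth_cols OK.
have lK : lsubmx K = col_mx P 0.
  rewrite /K -[g]hsubmxK mul_mx_row row_mxKl EP -{2}[h]hsubmxK.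
  have := mulVmx hu; rewrite -{2}[h]hsubmxK mul_mx_row scalar_mx_block block_mxEh.
  by move=> /eq_row_mx[e _]; rewrite mulmxA hsubmxK e mul_col_mx mul1mx mul0mx.
move: K11 K12; rewrite lK /gram tr_col_mx trmx0 /Jform_sum mul_row_block !mulmx0 !mul0mx !addr0.
rewrite mul_row_col mulmx0 addr0 => PP.
rewrite -[rsubmx K]vsubmxK mul_row_col mul0mx addr0 => PQ.
have [_ Pu] := gram_congr_unit PP J2u.
have Q0 : usubmx (rsubmx K) = 0.
  have PJu : P^T *m J2 \in unitmx by rewrite unitmx_mul unitmx_tr Pu.
  by rewrite -[LHS](mulKmx PJu) PQ mulmx0.
exists P, (dsubmx (rsubmx K)); split.
- exact: Oset_intro.
- apply: Oset_intro => //; move: K22.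
  have -> : rsubmx K = col_mx 0 (dsubmx (rsubmx K)) by rewrite -{1}[rsubmx K]vsubmxK Q0.
  by rewrite col_mxKd /gram tr_col_mx trmx0 /Jform_sum mul_row_block !mul0mx mulmx0 !add0r mul_row_col mulmx0 add0r.
- have -> : block_mx P 0 0 (dsubmx (rsubmx K)) = K.
    by rewrite -[RHS]hsubmxK lK -[in RHS](vsubmxK (rsubmx K)) Q0 block_mxEh.
  by rewrite /K mulKVmx.
Qed.

Hypotheses (Bu : B \in unitmx) (Bsig : has_signature B fullv (r + k + r') (s + k + s')).

(** In an adapted frame of [W], the vectors [e2] and [e3] represent an orthonormal basis of
    N^perp/N; their coordinates in [E'] form the required orthogonal matrix, up to the sign of the
    determinant. *)
Lemma fib_surj W : Orb W -> radical B W = colspan E1 ->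
  exists g, SOset J g /\ fib (lsubmx g) = W.
Proof.
move=> OW rW; have [e2 [e1 [e3 [e4 [aF EW]]]]] := adapted_orbit sB Bu Bsig OW.
have re1 : colspan e1 = colspan E1 by rewrite -rW EW (adapted_radical sB aF).
have [_ FF] := aF.
have [[k22 k21 k23 k24] [k12 k11 k13 k14] [k32 k31 k33 k34] [k42 k41 k43 k44]] :=
  stdform_gram FF.
have [Z EZ] : exists Z, E1 = e1 *m Z by apply/colspan_sub; rewrite re1.
have [Z' EZ'] : exists Z, e1 = E1 *m Z by apply/colspan_sub; rewrite re1.
pose e' := row_mx e2 e3.
have E1e' : gram B E1 e' = 0 by rewrite EZ gramMl gram_rowr k12 k13 row_mx0 mulmx0.
pose g := J *m gram B E' e'.
have e'E : e' = E1 *m gram B E4 e' + E' *m g.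
  rewrite {1}(frame_decomp sB JJ hF e').
  by rewrite E1e' mulmx0 addr0.
have gJ : g^T *m J *m g = J.
  rewrite -(gram_perp sB hF (gram B E4 e') g (gram B E4 e') g) -e'E.
  by rewrite gram_block k22 k23 k32 k33.
have Og := Oset_intro Ju gJ.
have Wg : fib (lsubmx g) = W.
  have e2E : e2 = E1 *m lsubmx (gram B E4 e') + E' *m lsubmx g.
    rewrite -[LHS](row_mxKl e2 e3) -/e' {1}e'E linearD /=.
    by rewrite -[gram B E4 e']hsubmxK -[g]hsubmxK !mul_mx_row !row_mxKl.
  rewrite EW /fib; apply: (colspan_eq (Z := block_mx 1%:M 0 (- Z *m lsubmx (gram B E4 e')) Z)
    (T := block_mx 1%:M 0 (lsubmx (gram B E4 e')) Z')).
    rewrite mul_row_block !mulmx0 add0r !mulmx1 -EZ mulmxA mulmxN -EZ mulNmx.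
    by congr row_mx; rewrite e2E addrAC subrr add0r.
  by rewrite mul_row_block !mulmx0 add0r mulmx1 -EZ' addrC -e2E.
have [dg|dg] := Oset_detP Ju gJ; first by exists g.
(* Adjust the determinant by a reflection in one of the two summands. *)
have [x [y [Ox Oy dxy]]] : exists x y, [/\ Oset J2 x, Oset J3 y & \det x * \det y = -1].
  have [a0|a0] := posnP a; last first.
    have [x Ox dx] := Jform_reflection a0.
    by exists x, 1%:M; split=> //; [exact: Oset1|rewrite dx det1 mulr1].
  have [c0|c0] := posnP c; last first.
    have [y Oy dy] := Jform_reflection c0.
    by exists 1%:M, y; split=> //; [exact: Oset1|rewrite dy det1 mul1r].
  (* Both summands are zero, so [g] is the empty matrix and its determinant 1 contradicts the value
     -1. *)
  move: dg; have ac0 : (a + c = 0)%N by rewrite a0 c0.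
  have -> : \det g = 1.
    by move: (g); rewrite ac0 => g'; rewrite det_mx00.
  by move/eqP; rewrite -subr_eq0 opprK -mulr2n pnatr_eq0.
exists (g *m block_mx x 0 0 y).
have Oh : Oset J (g *m block_mx x 0 0 y) by apply: Oset_mul => //; exact: Oset_block.
split; first by split=> //; rewrite det_mulmx det_ublock dxy dg mulrNN mulr1.
by rewrite -Wg; apply/fib_coset => //; exists x, y.
Qed.

Local Notation K := (S_OO_block J2 J3).

Lemma S_OO_blockP x : K x <-> exists p q,
  [/\ Oset J2 p, Oset J3 q, \det p * \det q = 1 & x = block_mx p 0 0 q].
Proof.
split=> [[[p q] [/= Op Oq dpq] <-]|[p [q [Op Oq dpq ->]]]]; first by exists p, q.
by exists (p, q).
Qed.

Lemma left_coset_fib g : SOset J g -> left_coset K g =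
  [set h | SOset J h /\ fib (lsubmx h) = fib (lsubmx g)].
Proof.
move=> [Og dg]; apply/seteqP; split=> h /=.
  move=> [x /S_OO_blockP[p [q [Op Oq dpq ->]]] <-].
  have Oh : Oset J (g *m block_mx p 0 0 q) by apply: Oset_mul => //; exact: Oset_block.
  split; first by split=> //; rewrite det_mulmx det_ublock dpq dg mulr1.
  by apply/fib_coset => //; exists p, q.
move=> [[Oh dh] /(fib_coset Oh Og)[p [q [Op Oq E]]]].
exists (block_mx p 0 0 q) => //; apply/S_OO_blockP; exists p, q; split=> //.
by move: dh; rewrite E det_mulmx det_ublock dg mul1r.
Qed.

(** Evaluated on a chosen representative; by [left_coset_fib] all members of a coset give the same
    subspace. Conversely [fib_inv] returns the whole coset at once. *)
Definition fib_map (S : set 'M[R]_(a + c)) := fib (lsubmx (xget 1%:M S)).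
Definition fib_inv (W : {vspace 'cV[R]_n}) := [set g | SOset J g /\ fib (lsubmx g) = W].

Lemma fib_map_coset g : SOset J g -> fib_map (left_coset K g) = fib (lsubmx g).
Proof.
move=> SOg; rewrite left_coset_fib // /fib_map.
by case: xgetP => [h _ []//|H]; case: (H g).
Qed.

Lemma fib_inv_coset g : SOset J g -> fib_inv (fib (lsubmx g)) = left_coset K g.
Proof. by move=> SOg; rewrite left_coset_fib. Qed.

Lemma sfam_gram_form m l l' d (U : set 'rV[R]_d) (Q : 'M[R]_m)
    (X : 'rV[R]_d -> 'M[R]_(m, l)) (Y : 'rV[R]_d -> 'M[R]_(m, l')) :
  sfam U X -> sfam U Y -> sfam U (fun y => gram Q (X y) (Y y)).
Proof.
move=> sX sY; have oU := sfam_open sX.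
by apply: sfam_mul => //; apply: sfam_mul; [exact: sfam_tr|exact: sfam_cst].
Qed.

(* Local sections of [SO -> SO / S(O x O)]: project a smooth frame of [W(y)] to the
   complement of the radical, complete it orthogonally by the projection of the
   frame at the base point, and orthonormalize both parts. *)
Lemma fib_local_section d (U : set 'rV[R]_d) w x :
  plot (Gr R (a + k) n) U w ->
  (forall y, U y -> Orb (w y) /\ radical B (w y) = colspan E1) -> U x ->
  exists V g, [/\ V x, V `<=` U, sfam V g &
    forall y, V y -> SOset J (g y) /\ fib (lsubmx (g y)) = w y].
Proof.
move=> [oU /(_ x) H] fw Ux; have [V [A [Vx VU [sA rA] wA]]] := H Ux.
have oV := sfam_open sA.
have surj y : V y -> exists g, SOset J g /\ fib (lsubmx g) = w y.
  by move=> /VU/fw[Ow rw]; exact: fib_surj.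
have [g0 [[Og0 dg0] g0w]] := surj x Vx.
have [q11 q12 q22] := orth_cols Og0.
(* [Z0] picks out of the frame [A x] the vectors prescribed by [g0]; kept constant, it extends them
   smoothly to nearby parameters. *)
have [Z0 EZ0] : exists Z, E' *m lsubmx g0 = A x *m Z.
  apply/colspan_sub; rewrite -wA // -g0w; apply/colspan_sub.
  by exists (col_mx 1%:M 0); rewrite mul_row_col mulmx0 addr0 mulmx1.
pose C y := J *m gram B E' (A y *m Z0).
have Cx : C x = lsubmx g0 by rewrite /C -EZ0 gramMr h'' mulmxA JJ mul1mx.
have sC : sfam V C.
  apply: sfam_mul; first exact: sfam_cst.
  apply: sfam_gram_form; first exact: sfam_cst.
  by apply: sfam_mul => //; exact: sfam_cst.
have CE y (g : 'M[R]_(a + c)) : V y -> fib (lsubmx g) = w y -> exists Q, C y = lsubmx g *m Q.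
  move=> Vy gw; have [Q EQ] : exists Q, A y *m Z0 = row_mx (E' *m lsubmx g) E1 *m Q.
    apply/colspan_sub; rewrite -[colspan (row_mx _ _)]/(fib (lsubmx g)) gw wA //.
    by apply/colspan_sub; exists Z0.
  exists (usubmx Q); rewrite /C EQ -{1}[Q]vsubmxK mul_row_col gramDr !gramMr h'' h'1.
  by rewrite mul0mx addr0 !mulmxA JJ mul1mx.
have [Om2 [P2 [OJ2 P2J P2G oOm2 sP2]]] := smooth_orthonormalization_Jform R r s.
have [Om3 [P3 [OJ3 P3J P3G oOm3 sP3]]] := smooth_orthonormalization_Jform R r' s'.
pose G2 y := gram J (C y) (C y).
have sG2 : sfam V G2 by exact: sfam_gram_form.
have tG2 y : (G2 y)^T = G2 y by rewrite gram_tr ?sJ.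
pose V2 := V `&` [set y | Om2 (G2 y)].
have oV2 : open V2 by exact: oOm2 sG2.
have V2V : V2 `<=` V by move=> y [].
have G2u y : V2 y -> G2 y \in unitmx.
  by move=> [_ Oy]; have [] := gram_congr_unit (P2G _ (tG2 y) Oy) J2u.
pose D y := rsubmx g0 - C y *m (invmx (G2 y) *m gram J (C y) (rsubmx g0)).
have sCV2 := sfam_sub oV2 V2V sC; have sG2V2 := sfam_sub oV2 V2V sG2.
have sD : sfam V2 D.
  apply: sfam_add; first exact: sfam_cst.
  apply: sfam_opp; apply: sfam_mul => //; apply: sfam_mul; first exact: sfam_inv.
  by apply: sfam_gram_form => //; exact: sfam_cst.
have CD y : V2 y -> gram J (C y) (D y) = 0.
  by move=> Vy; rewrite gramDr gramNr gramMr mulKVmx ?subrr // G2u.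
have Dx : D x = rsubmx g0 by rewrite /D Cx q12 !mulmx0 subr0.
pose G3 y := gram J (D y) (D y).
have sG3 : sfam V2 G3 by exact: sfam_gram_form.
have tG3 y : (G3 y)^T = G3 y by rewrite gram_tr ?sJ.
pose V3 := V2 `&` [set y | Om3 (G3 y)].
have oV3 : open V3 by exact: oOm3 sG3.
have V3V2 : V3 `<=` V2 by move=> y [].
pose g y := row_mx (C y *m P2 (G2 y)) (D y *m P3 (G3 y)).
have sg : sfam V3 g.
  apply: sfam_row_mx; apply: sfam_mul; try exact: (sfam_sub oV3 V3V2).
    by apply: sP2; [exact: (sfam_sub oV3 V3V2)|move=> y [[]]].
  by apply: sP3; [exact: (sfam_sub oV3 V3V2)|move=> y []].
have gJ y : V3 y -> (g y)^T *m J *m g y = J.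
  move=> [V2y O3]; have [Vy O2] := V2y.
  exact: (gram_row_orth sJ (CD y V2y) (P2G _ (tG2 y) O2) (P3G _ (tG3 y) O3)).
have V3x : V3 x.
  split; [split=> //|] => /=; first by rewrite /G2 Cx q11.
  by rewrite /G3 Dx q22.
have gx : g x = g0.
  by rewrite /g /G2 /G3 Cx Dx q11 q22 P2J P3J !mulmx1 hsubmxK.
(* Orthogonal matrices have determinant 1 or -1, so positivity, an open condition true at [x],
   already puts [g] in the special orthogonal group. *)
have oD := rfam_pos_open (rfam_det sg).
exists (V3 `&` [set y | 0 < \det (g y)]), g; split.
- by split=> //=; rewrite gx dg0 ltr01.
- by move=> y [/V3V2/V2V/VU].
- exact: (sfam_sub oD (@subIsetl _ _ _) sg).
- move=> y [V3y dy]; have Og := Oset_intro Ju (gJ y V3y); split.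
    split=> //; have [//|dN] := Oset_detP Ju (gJ y V3y).
    by move: dy; rewrite /= dN ltr0N1.
  have [[Vy O2] _] := V3y; have [h [[Oh _] hw]] := surj y Vy.
  have [Q CQ] := CE y h Vy hw.
  have [p11 _ _] := orth_cols Oh.
  have G2Q : G2 y = Q^T *m J2 *m Q.
    by rewrite /G2 CQ; move: p11; move: (lsubmx h) => Z p11; rewrite gramMl gramMr p11 mulmxA.
  (* Invertibility of the Gram matrix of [C y] forces [Q] to be invertible, so the projected frame
     still spans the image of [w y] in N^perp/N. *)
  have Qu : Q *m P2 (G2 y) \in unitmx.
    have [G2u' P2u] := gram_congr_unit (P2G _ (tG2 y) O2) J2u.
    move: G2u'; rewrite G2Q !unitmx_mul -G2Q => /andP[_ Qu].
    by rewrite Qu P2u.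
  by rewrite row_mxKl CQ -mulmxA fib_mulr.
Qed.

Lemma fib_diffeo :
  diffeo (homog_space (SOset J) K)
    (sub_space (sub_space (Gr R (a + k) n) Orb) [set W | radical B W = colspan E1])
    fib_map fib_inv.
Proof.
have fO g : SOset J g -> Orb (fib (lsubmx g)) /\ radical B (fib (lsubmx g)) = colspan E1.
  by move=> [Og _]; apply: fib_orbit; have [] := orth_cols Og.
have fc g : SOset J g -> carrier (Gr R (a + k) n) (fib (lsubmx g)).
  by move=> /fO[[dW _] _]; exact/Gr_carrierP.
split.
- split=> [_ [g [_ SOg] <-]|d U w [oU H]] /=.
    rewrite fib_map_coset //; have [OW rW] := fO g SOg.
    by split=> //; split=> //; exact: fc.
  have fw y : U y -> Orb (fib_map (w y)) /\ radical B (fib_map (w y)) = colspan E1.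
    move=> /H[V [g [Vy VU [sg SOg] wg]]]; rewrite wg // fib_map_coset; last exact: SOg.
    exact/fO/SOg.
  split; last by move=> y /fw[].
  split; last by move=> y /fw[].
  apply: Gr_plot_local => // x Ux; have [V [g [Vx VU [sg SOg] wg]]] := H x Ux.
  exists V; split=> //; have oV := sfam_open sg.
  apply: (Gr_plot_colspan (g := fun y => row_mx (E' *m lsubmx (g y)) E1)).
  + apply: sfam_row_mx; last exact: sfam_cst.
    by apply: sfam_mul; [exact: sfam_cst|exact: sfam_linear].
  + move=> y Vy; have [[dW _] _] := fO _ (SOg y Vy); exact/dim_colspan.
  + by move=> y Vy /=; rewrite wg // fib_map_coset //; exact: SOg.
- split=> [W [[_ OW] rW]|d U w [[pw Ow] rw]] /=.
    have [g [SOg <-]] := fib_surj OW rW.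
    by exists g => //; rewrite fib_inv_coset.
  split; first by case: pw.
  move=> x Ux.
  have [V [g [Vx VU sg gw]]] := fib_local_section pw (fun y Uy => conj (Ow y Uy) (rw y Uy)) Ux.
  exists V, g; split=> //; first by split=> // y /gw[].
  by move=> y /gw[SOg <-] /=; rewrite fib_inv_coset.
- by move=> _ [g [_ SOg] <-]; rewrite fib_map_coset // fib_inv_coset.
- move=> W [[_ OW] rW]; have [g [SOg <-]] := fib_surj OW rW.
  by rewrite fib_inv_coset // fib_map_coset.
Qed.

Lemma theta_smooth (H : set 'M[R]_n) :
  (forall h, H h -> SOset J (theta B J E' h)) ->
  smooth_map (sub_space (mx_space R n n) H) (sub_space (mx_space R _ _) (SOset J))
    (theta B J E').
Proof.
move=> HS; split=> [h [_ Hh]|d U w [sw Hw]] /=; first by split=> //; exact: HS.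
split; last by move=> y Uy; exact/HS/Hw.
have oU : open U := sfam_open (sw : sfam U w).
apply: sfam_mul; first exact: sfam_cst.
apply: sfam_gram_form; first exact: sfam_cst.
by apply: sfam_mul => //; exact: sfam_cst.
Qed.

Lemma fib_equivariant h (g : 'M[R]_(a + c)) : Oset B h -> gact h (colspan E1) = colspan E1 ->
  gact h (fib (lsubmx g)) = fib (lsubmx (theta B J E' h *m g)).
Proof.
move=> Oh hN; rewrite /fib gact_colspan mul_mx_row mulmxA.
have Eh := stab_E1 sB hF hN.
have Eh' := stab_E' sB JJ hF Oh hN.
have au := alpha_unit sB hF hN.
have -> : lsubmx (theta B J E' h *m g) = theta B J E' h *m lsubmx g.
  by rewrite -{1}[g]hsubmxK mul_mx_row row_mxKl.
rewrite Eh Eh'; set p := gram _ _ _; set q := theta _ _ _ _.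
have au' : alpha B E1 E4 h \in unitmx := au.
apply: (colspan_eq (Z := block_mx 1%:M 0 (p *m lsubmx g) (alpha B E1 E4 h))
  (T := block_mx 1%:M 0 (- (invmx (alpha B E1 E4 h) *m (p *m lsubmx g)))
    (invmx (alpha B E1 E4 h)))).
  by rewrite mul_row_block !mulmx0 add0r !mulmx1 mulmxDl !mulmxA addrC.
rewrite mul_row_block !mulmx0 add0r !mulmx1 mulmxK // mulmxN -(mulmxA E1) mulKVmx //.
by rewrite mulmxDl !mulmxA addrAC subrr add0r.
Qed.

End Fiber.
End Fibers.

(** * Fibers as homogeneous spaces of the stabilizer *)

Section FiberBundle.
Variables (R : realType) (n r s k r' s' : nat) (B : 'M[R]_n).
Hypotheses (sB : B^T = B) (Bu : B \in unitmx)
  (Bsig : has_signature B fullv (r + k + r') (s + k + s')).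

Local Notation Orb := (orbit_sig B (r + s + k) r s).
Local Notation J2 := (Jform R r s).
Local Notation J3 := (Jform R r' s').
Local Notation J := (Jform_sum R r s r' s').

(** [theta] maps the stabilizer of [N] onto the special orthogonal group of N^perp/N, and [f]
    intertwines the actions, so the identification respects the homogeneous structure and not just
    the smooth one. *)
Lemma radical_fiber N : isotropic_sub B k N ->
  let HN := SOset B `&` [set h | gact h N = N] in
  exists (theta : 'M[R]_n -> 'M[R]_((r + s) + (r' + s')))
    (f : set 'M[R]_((r + s) + (r' + s')) -> {vspace 'cV[R]_n})
    (f' : {vspace 'cV[R]_n} -> set 'M[R]_((r + s) + (r' + s'))),
    [/\ diffeo (homog_space (SOset J) (S_OO_block J2 J3))
          (sub_space (sub_space (Gr R (r + s + k) n) Orb)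
             [set W | radical B W = N]) f f',
        smooth_map (sub_space (mx_space R n n) HN)
          (sub_space (mx_space R _ _) (SOset J)) theta,
        forall h1 h2, HN h1 -> HN h2 -> theta (h1 *m h2) = theta h1 *m theta h2,
        forall g, SOset J g -> exists2 h, HN h & theta h = g
      & forall h g, HN h -> SOset J g ->
          f (left_coset (S_OO_block J2 J3) (theta h *m g)) =
          gact h (f (left_coset (S_OO_block J2 J3) g))].
Proof.
move=> IN HN; have [E2 [E1 [E3 [E4 [aF EN]]]]] := adapted_isotropic sB Bu Bsig IN.
pose E' := row_mx E2 E3.
have hF : hyperbolic_frame B J E1 E' E4 := adapted_hyperbolic aF.
have JJ := Jform_sum_sqr R r s r' s'; have sJ := Jform_sum_tr R r s r' s'.
have thS h : HN h -> SOset J (theta B J E' h).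
  rewrite /HN EN => -[[Oh dh] hN]; split.
    exact: (theta_Oset sB JJ hF).
  by rewrite (theta_det sB JJ hF Oh hN).
exists (theta B J E'), (fib_map E1 E'), (fib_inv E1 E'); split.
- rewrite EN; exact: (fib_diffeo sB hF Bu Bsig).
- exact: theta_smooth.
- rewrite /HN EN => h1 h2 [_ h1N] [[Oh2 _] h2N].
  exact: (theta_mul sB JJ hF h1N Oh2 h2N).
- move=> g [Og dg]; have u1 := unitmx1 R k.
  exists (stab_lift B J E1 E' E4 1%:M g).
    have Ol := stab_lift_Oset sB JJ hF u1 Og.
    have lN := stab_lift_stab sB JJ hF g u1.
    split; last by rewrite EN.
    split=> //; rewrite -(theta_det sB JJ hF Ol lN).
    by rewrite stab_lift_theta.
  exact: stab_lift_theta.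
- move=> h g Hh Sg; have Sh := thS h Hh.
  have Shg : SOset J (theta B J E' h *m g).
    case: Sh Sg => [Oh dh] [Og dg]; split; first exact: Oset_mul.
    by rewrite det_mulmx dh dg mulr1.
  rewrite (fib_map_coset sB hF Shg).
  rewrite (fib_map_coset sB hF Sg).
  move: Hh; rewrite /HN EN => -[[Oh _] hN].
  by rewrite (fib_equivariant sB hF).
Qed.

End FiberBundle.

(** * Lie algebras *)

Section Velocity.
Variable R : realType.

Definition vel m n (c : 'rV[R]_1 -> 'M[R]_(m, n)) : 'M[R]_(m, n) :=
  'd c (0 : 'rV[R]_1) (const_mx 1).

Section Rules.
Variables (U : set 'rV[R]_1) (U0 : U 0).

Lemma sfam_differentiable m n (c : 'rV[R]_1 -> 'M[R]_(m, n)) :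
  sfam U c -> differentiable c 0.
Proof. by move=> [_ sc]; exact: (sc 1%N).1 _ U0. Qed.

(** Reduces velocities of matrix curves to derivatives of their entries, where the scalar rules
    apply. *)
Lemma velP m n (c : 'rV[R]_1 -> 'M[R]_(m, n)) i j : sfam U c ->
  is_derive (0 : 'rV[R]_1) (const_mx 1) (fun t => c t i j : R) (vel c i j).
Proof.
move=> sc; have dc := sfam_differentiable sc.
have [_ sij] := sfam_entry i j sc.
have dij : differentiable (fun t => c t i j : R) (0 : 'rV[R]_1) := (sij 1%N).1 _ U0.
apply: DeriveDef; first exact: diff_derivable.
by rewrite /vel -(deriveE _ dc) derive_mx ?mxE //; exact: diff_derivable.
Qed.

Lemma vel_eq m n (c c' : 'rV[R]_1 -> 'M[R]_(m, n)) : sfam U c ->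
  (forall t, U t -> c t = c' t) -> vel c = vel c'.
Proof.
move=> sc cc; rewrite /vel; have oU := sfam_open sc.
have D : is_diff (0 : 'rV[R]_1) c ('d c 0) by exact/differentiableP/sfam_differentiable.
by have D' := is_diff_near (open_eq_near oU U0 cc) D; rewrite [in RHS]diff_val.
Qed.

Lemma vel_cst m n (A : 'M[R]_(m, n)) : vel (fun=> A) = 0.
Proof. by rewrite /vel (diff_cst A). Qed.

Lemma velD m n (f g : 'rV[R]_1 -> 'M[R]_(m, n)) : sfam U f -> sfam U g ->
  vel (fun t => f t + g t) = vel f + vel g.
Proof.
move=> /sfam_differentiable df /sfam_differentiable dg.
by rewrite /vel; have /(congr1 (@^~ (const_mx 1))) /= := diffD df dg.
Qed.

Lemma velM m n p (f : 'rV[R]_1 -> 'M[R]_(m, n)) (g : 'rV[R]_1 -> 'M[R]_(n, p)) :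
  sfam U f -> sfam U g ->
  vel (fun t => f t *m g t) = vel f *m g 0 + f 0 *m vel g.
Proof.
move=> sf sg; apply/matrixP => i j.
have H := velP i j (sfam_mul sf sg).
have K := is_derive_sum (fun k => is_deriveM (velP i k sf) (velP k j sg)).
have E : (fun t => (f t *m g t) i j : R) =
    \sum_k (fun t => f t i k : R) * (fun t => g t k j : R).
  by apply/funext => t; rewrite mxE fct_sumE.
rewrite -[LHS](@derive_val _ _ _ _ _ _ _ H) E (@derive_val _ _ _ _ _ _ _ K).
rewrite !mxE -big_split; apply: eq_bigr => k _ /=.
by rewrite addrC; congr (_ + _); exact: mulrC.
Qed.

Lemma vel_tr m n (f : 'rV[R]_1 -> 'M[R]_(m, n)) : sfam U f ->
  vel (fun t => (f t)^T) = (vel f)^T.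
Proof.
move=> sf; apply/matrixP => i j.
have H := velP i j (sfam_tr sf); have K := velP j i sf.
rewrite -[LHS](@derive_val _ _ _ _ _ _ _ H) mxE.
rewrite -[RHS](@derive_val _ _ _ _ _ _ _ K).
by congr ('D__ _ _); apply/funext => t; rewrite mxE.
Qed.

End Rules.

Lemma vel_mulc m n p (A : 'M[R]_(m, n)) (f : 'rV[R]_1 -> 'M[R]_(n, p)) U :
  U 0 -> sfam U f -> vel (fun t => A *m f t) = A *m vel f.
Proof.
move=> U0 sf; rewrite (velM U0 _ sf) ?vel_cst ?mul0mx ?add0r //.
exact: sfam_cst (sfam_open sf).
Qed.

Lemma vel_mulrc m n p (f : 'rV[R]_1 -> 'M[R]_(m, n)) (A : 'M[R]_(n, p)) U :
  U 0 -> sfam U f -> vel (fun t => f t *m A) = vel f *m A.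
Proof.
move=> U0 sf; rewrite (velM U0 sf) ?vel_cst ?mulmx0 ?addr0 //.
exact: sfam_cst (sfam_open sf).
Qed.

Lemma rfam_coord (U : set 'rV[R]_1) : open U -> rfam U (fun t : 'rV[R]_1 => t 0 0).
Proof. by move=> oU; have := sfam_entry 0 0 (sfam_id oU). Qed.

Lemma sfam_line m n (U : set 'rV[R]_1) (A X : 'M[R]_(m, n)) : open U ->
  sfam U (fun t : 'rV[R]_1 => A + t 0 0 *: X).
Proof.
move=> oU; apply: sfam_add; first exact: sfam_cst.
by apply: sfam_scale; [exact: rfam_coord|exact: sfam_cst].
Qed.

Lemma vel_scale m n (U : set 'rV[R]_1) (e : 'rV[R]_1 -> R) (X : 'M[R]_(m, n)) :
  U 0 -> rfam U e ->
  vel (fun t => e t *: X) = 'd e (0 : 'rV[R]_1) (const_mx 1) *: X.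
Proof.
move=> U0 re; have [oU se] := re.
have de : differentiable e (0 : 'rV[R]_1) := (se 1%N).1 _ U0.
have sX : sfam U (fun t => e t *: X) by apply: sfam_scale => //; exact: sfam_cst.
apply/matrixP => i j.
have H := velP U0 i j sX; rewrite -[LHS](@derive_val _ _ _ _ _ _ _ H) mxE.
have D : is_derive (0 : 'rV[R]_1) (const_mx 1) e ('d e (0 : 'rV[R]_1) (const_mx 1)).
  by apply: DeriveDef; [exact: diff_derivable|rewrite deriveE].
have K := is_deriveZ (X i j) D.
have E : (fun t => (e t *: X) i j : R) = X i j \*: e.
  by apply/funext => t; rewrite mxE mulrC.
by rewrite E (@derive_val _ _ _ _ _ _ _ K) mulrC.
Qed.

Lemma vel_line m n (A X : 'M[R]_(m, n)) : vel (fun t : 'rV[R]_1 => A + t 0 0 *: X) = X.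
Proof.
have rc := rfam_coord openT; have T0 : [set: 'rV[R]_1] 0 by [].
rewrite (velD T0); last 2 first.
- exact: sfam_cst openT.
- by apply: sfam_scale => //; exact: sfam_cst openT.
rewrite vel_cst add0r (vel_scale X T0 rc).
have := velP T0 0 0 (sfam_id openT).
have dl := (rc.2 1%N).1 _ T0.
move=> H; have := @derive_val _ _ _ _ _ _ _ H.
rewrite (deriveE _ dl) => ->.
by rewrite /vel diff_val mxE scale1r.
Qed.

(* The trace, but only its description as the differential of the determinant matters. *)
Definition ddet n (X : 'M[R]_n) : R :=
  'd (fun v : 'rV[R]_(n * n) => \det (vec_mx v : 'M[R]_n)) (mxvec (1%:M : 'M[R]_n)) (mxvec X).

Lemma ddet_is_linear n : scalar (@ddet n).
Proof. by move=> a X Y; rewrite /ddet linearP linearP. Qed.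
HB.instance Definition _ n := GRing.isLinear.Build R 'M[R]_n R _ (@ddet n) (@ddet_is_linear n).

(** Chain rule through the vectorized determinant, the domain on which [ddet] is defined. *)
Lemma ddetP n U (c : 'rV[R]_1 -> 'M[R]_n) : U 0 -> sfam U c -> c 0 = 1%:M ->
  'd (fun t => \det (c t)) (0 : 'rV[R]_1) (const_mx 1) = ddet (vel c).
Proof.
move=> U0 sc c0.
have sv : sfam U (fun t => mxvec (c t)) by exact: sfam_linear.
have dv := sfam_differentiable U0 sv.
have rd : rfam [set: 'rV[R]_(n * n)] (fun v => \det (vec_mx v : 'M[R]_n)).
  by apply: rfam_det; exact: (sfam_linear (@vec_mx R n n) (sfam_id openT)).
have dd := (rd.2 1%N).1 (mxvec (c 0)) I.
have -> : (fun t => \det (c t)) =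
    (fun v : 'rV[R]_(n * n) => \det (vec_mx v : 'M[R]_n)) \o (fun t => mxvec (c t)).
  by apply/funext => t /=; rewrite mxvecK.
rewrite diff_comp //= c0 /ddet; congr ('d _ _ _).
rewrite -[LHS]/(vel (fun t => mxvec (c t))); apply/rowP => j.
have := velP U0 0 j sv; case/mxvec_indexP: j => i j H.
rewrite -[LHS](@derive_val _ _ _ _ _ _ _ H) mxvecE.
have K := velP U0 i j sc; rewrite -[RHS](@derive_val _ _ _ _ _ _ _ K).
have -> // : (fun t => mxvec (c t) 0 (mxvec_index i j) : R) = (fun t => c t i j).
by apply/funext => t; rewrite mxvecE.
Qed.

End Velocity.

(** * Lie algebras of SL, of stabilizers and of SO *)

Section LieAlgebras.
Variable R : realType.

(* Sylvester's identity: both sides are the determinant of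
   [block_mx 1 (- U) V 1]. *)
Lemma det_add1_mulC n m (U : 'M[R]_(n, m)) (V : 'M[R]_(m, n)) :
  \det (1%:M + U *m V) = \det (1%:M + V *m U).
Proof.
have L : block_mx 1%:M (- U) V 1%:M =
    block_mx 1%:M 0 V 1%:M *m block_mx 1%:M (- U) 0 (1%:M + V *m U).
  by rewrite mulmx_block !mul1mx !mulmx1 !mul0mx !addr0 mulmxN addrCA addNr addr0.
have L' : block_mx 1%:M (- U) V 1%:M =
    block_mx 1%:M (- U) 0 1%:M *m block_mx (1%:M + U *m V) 0 V 1%:M.
  by rewrite mulmx_block !mul1mx !mulmx1 !mul0mx !add0r mulNmx addrK.
have := congr1 determinant L; rewrite {1}L' !det_mulmx !det_ublock !det_lblock.
by rewrite !det1 !mul1r !mulr1.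
Qed.

Lemma lie_algP n (H : set 'M[R]_n) X : lie_alg H X <->
  exists (U : set 'rV[R]_1) c,
    [/\ sfam U c, forall t, U t -> H (c t), U 0, c 0 = 1%:M & vel c = X].
Proof. by split=> -[U [c H']]; exists U, c; case: H' => // -[]. Qed.

Lemma lie_alg_sub n (H H' : set 'M[R]_n) : H `<=` H' -> lie_alg H `<=` lie_alg H'.
Proof.
move=> HH X /lie_algP[U [c [sc Hc U0 c0 cX]]]; apply/lie_algP; exists U, c.
by split=> // t /Hc/HH.
Qed.

Lemma lie_alg_Ad n (H : set 'M[R]_n) x X : x \in unitmx ->
  (forall y, H y -> H (x *m y *m invmx x)) -> lie_alg H X -> lie_alg H (Ad x X).
Proof.
move=> xu Hx /lie_algP[U [c [sc Hc U0 c0 cX]]]; apply/lie_algP.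
have oU := sfam_open sc; exists U, (fun t => x *m c t *m invmx x).
have sxc : sfam U (fun t => x *m c t) by apply: sfam_mul => //; exact: sfam_cst.
split=> //.
- by apply: sfam_mul => //; exact: sfam_cst.
- by move=> t Ut; exact/Hx/Hc.
- by rewrite c0 mulmx1 mulmxV.
- by rewrite (vel_mulrc _ U0 sxc) (vel_mulc _ U0 sc) cX.
Qed.

Lemma gact_stab_sub n k (A : 'M[R]_(n, k)) (g : 'M[R]_n) : \rank A = k ->
  g \in unitmx -> gact g (colspan A) = colspan A <-> exists Z, g *m A = A *m Z.
Proof.
move=> rA gu; rewrite gact_colspan; split=> [gA|[Z gA]].
  by apply/colspan_sub; rewrite gA.
apply/eqP; rewrite eqEdim; apply/andP; split; first by apply/colspan_sub; exists Z.
rewrite ((dim_colspan A).2 rA) ((dim_colspan (g *m A)).2 _) //.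
by apply: rank_mulmx_full => //; exact/mxrank_unit.
Qed.

(* The curve [1 + t X] is renormalized to determinant 1 along a rank one
   idempotent with image in [colspan A]. *)
Lemma lie_alg_stab n k (A : 'M[R]_(n, k)) (j : 'I_k) X : \rank A = k ->
  lie_alg (@SLset R n `&` [set g | gact g (colspan A) = colspan A]) X <->
  ddet X = 0 /\ exists Z, X *m A = A *m Z.
Proof.
move=> rA; have [A' AA] := (rank_linvP A).1 rA; split.
  move=> /lie_algP[U [c [sc Hc U0 c0 cX]]]; split.
    rewrite -cX -(ddetP U0 sc c0).
    have oU := sfam_open sc.
    have E : \forall t \near (0 : 'rV[R]_1), cst 1 t = \det (c t).
      by apply: (open_eq_near oU U0) => t Ut; have [] := Hc t Ut.
    have D := is_diff_near E (is_diff_cst (1 : R) (0 : 'rV[R]_1)).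
    by rewrite diff_val.
  exists (A' *m X *m A).
  have scA : sfam U (fun t => c t *m A).
    by apply: sfam_mul => //; exact: sfam_cst (sfam_open sc).
  (* [A *m A'] is a projection onto the span of [A]; invariance becomes an identity linear in [c t],
     which can be differentiated. *)
  have /(vel_eq U0 scA) : forall t, U t -> c t *m A = (A *m A') *m (c t *m A).
    move=> t Ut; have [d1 gA] := Hc t Ut.
    have cu : c t \in unitmx by rewrite unitmxE d1 unitr1.
    have [Z ->] := (gact_stab_sub rA cu).1 gA.
    by rewrite -mulmxA (mulmxA A') AA mul1mx.
  by rewrite (vel_mulc _ U0 scA) !(vel_mulrc _ U0 sc) cX -!mulmxA.
move=> [dX [Z XA]]; apply/lie_algP.
pose U0 := [set: 'rV[R]_1].
pose l (t : 'rV[R]_1) : 'M[R]_n := 1%:M + t 0 0 *: X.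
have sl : sfam U0 l by exact: sfam_line openT.
have rd := rfam_det sl.
pose U := U0 `&` [set t | \det (l t) != 0].
have oU : open U := rfam_neq0_open rd.
have l0 : l 0 = 1%:M by rewrite /l mxE scale0r addr0.
have U00 : U 0 by split=> //=; rewrite l0 det1 oner_eq0.
have slU : sfam U l := sfam_sub oU (fun _ _ => I) sl.
pose e t := (\det (l t))^-1.
have re : rfam U e by apply: rfamV => [t []//|]; exact: rfam_det.
(* The normalizing factor is stationary at 0 because [ddet X = 0], so it does not disturb the
   velocity. *)
have ve : 'd e (0 : 'rV[R]_1) (const_mx 1) = 0.
  have dd : differentiable (fun t => \det (l t)) (0 : 'rV[R]_1) := (rd.2 1%N).1 _ I.
  rewrite diffV //; last by rewrite l0 det1 oner_eq0.
  have := ddetP (U := U0) I sl l0; rewrite vel_line dX => d0.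
  by rewrite /= d0 scaler0.
pose N : 'M[R]_n := A *m delta_mx j 0 *m (delta_mx (0 : 'I_1) j *m A').
(* By Sylvester's identity the determinant reduces to a one by one matrix: stretching the line by
   [a] multiplies volume by [a]. *)
have dE a : \det (1%:M + (a - 1) *: N) = a.
  rewrite /N scalemxAl det_add1_mulC -scalemxAr mulmxA -(mulmxA _ A') AA mulmx1.
  by rewrite mul_delta_mx det_mx11 !mxE eqxx mulr1 addrC subrK.
pose E t : 'M[R]_n := (1%:M - N) + e t *: N.
have EE t : E t = 1%:M + (e t - 1) *: N by rewrite scalerBl scale1r [_ - N]addrC addrA.
have sE : sfam U E.
  apply: sfam_add; first exact: sfam_cst.
  by apply: sfam_scale => //; exact: sfam_cst.
have E0 : E 0 = 1%:M by rewrite EE /e l0 det1 invr1 subrr scale0r addr0.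
exists U, (fun t => E t *m l t); split=> //.
- exact: sfam_mul.
- move=> t Ut; have dt : \det (E t *m l t) = 1.
    by rewrite det_mulmx EE dE mulVf //; case: Ut.
  split=> //=; apply/gact_stab_sub => //; first by rewrite unitmxE dt unitr1.
  exists ((1%:M + (e t - 1) *: (delta_mx j 0 *m (delta_mx (0 : 'I_1) j *m A' *m A))) *m
    (1%:M + t 0 0 *: Z)).
  have lA : l t *m A = A *m (1%:M + t 0 0 *: Z).
    by rewrite mulmxDl mulmxDr mul1mx mulmx1 -scalemxAl XA scalemxAr.
  rewrite -mulmxA lA !mulmxA; congr (_ *m _).
  by rewrite EE mulmxDl mulmxDr mul1mx mulmx1 -scalemxAl -scalemxAr /N !mulmxA.
- by rewrite E0 l0 mulmx1.
- rewrite (velM U00 sE slU) l0 E0 mulmx1 mul1mx vel_line.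
  rewrite (velD U00); last 2 first.
  + exact: sfam_cst.
  + by apply: sfam_scale => //; exact: sfam_cst.
  by rewrite vel_cst (vel_scale _ U00 re) ve scale0r !add0r.
Qed.

(** The case [A = 1%:M] of [lie_alg_stab]: every invertible matrix stabilizes the whole space. *)
Lemma lie_alg_SL n (X : 'M[R]_n) : (0 < n)%N -> lie_alg (@SLset R n) X <-> ddet X = 0.
Proof.
move=> n0; have := lie_alg_stab (A := 1%:M) (Ordinal n0) X (mxrank1 R n).
rewrite [_ `&` _](_ : _ = @SLset R n).
  by move=> ->; split=> [[]//|dX]; split=> //; exists X; rewrite mulmx1 mul1mx.
apply/seteqP; split=> g; first by case.
move=> dg; split=> //; apply/gact_stab_sub; rewrite ?mxrank1 //.
  by rewrite unitmxE (dg : \det g = 1) unitr1.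
by exists g; rewrite mulmx1 mul1mx.
Qed.

(** By Sylvester's identity det(1 + t UV) = det(1 + t VU), which is constantly 1. *)
Lemma ddet_mul n m (U : 'M[R]_(n, m)) (V : 'M[R]_(m, n)) :
  V *m U = 0 -> ddet (U *m V) = 0.
Proof.
move=> VU; pose l (t : 'rV[R]_1) := 1%:M + t 0 0 *: (U *m V).
have sl : sfam [set: 'rV[R]_1] l by exact: sfam_line openT.
have l0 : l 0 = 1%:M by rewrite /l mxE scale0r addr0.
have := ddetP (U := [set: 'rV[R]_1]) I sl l0; rewrite vel_line => <-.
have -> : (fun t => \det (l t)) = cst 1.
  by apply/funext => t; rewrite /l scalemxAl det_add1_mulC -scalemxAr VU scaler0 addr0 det1.
by rewrite diff_cst.
Qed.

(* Every solution [Z] is the velocity of its Cayley transform. *)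
Lemma lie_alg_SO n (B Z : 'M[R]_n) : B \in unitmx ->
  lie_alg (SOset B) Z <-> Z^T *m B + B *m Z = 0.
Proof.
move=> Bu; split=> [/lie_algP[U [c [sc Hc U0 c0 cX]]]|ZB].
  have oU := sfam_open sc; have sB : sfam U (fun=> B) by exact: sfam_cst.
  have sct := sfam_tr sc.
  have scB : sfam U (fun t => (c t)^T *m B) by exact: sfam_mul.
  have /(vel_eq U0 sB) : forall t, U t -> B = (c t)^T *m B *m c t.
    by move=> t Ut; have [[_ ->] _] := Hc t Ut.
  rewrite vel_cst (velM U0 scB sc) (vel_mulrc _ U0 sct) (vel_tr U0 sc) c0 cX.
  by rewrite trmx1 mul1mx mulmx1.
apply/lie_algP; pose U0 := [set: 'rV[R]_1].
have [W WE] : exists W, W = 2^-1 *: Z by exists (2^-1 *: Z).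
pose m (t : 'rV[R]_1) : 'M[R]_n := 1%:M + t 0 0 *: (- W).
pose p (t : 'rV[R]_1) : 'M[R]_n := 1%:M + t 0 0 *: W.
have sm : sfam U0 m by exact: sfam_line openT.
pose U := U0 `&` [set t | m t \in unitmx].
have oU : open U := sfam_unit_open sm.
have m0 : m 0 = 1%:M by rewrite /m mxE scale0r addr0.
have p0 : p 0 = 1%:M by rewrite /p mxE scale0r addr0.
have U00 : U 0 by split=> //=; rewrite m0 unitmx1.
have smU : sfam U m := sfam_sub oU (fun _ _ => I) sm.
have spU : sfam U p by exact: sfam_line.
have mu t : U t -> m t \in unitmx by case.
have si : sfam U (fun t => invmx (m t)) by exact: sfam_inv.
have WB : W^T *m B = - (B *m W).
  apply/eqP; rewrite -addr_eq0 WE -scalemxAr linearZ /= -scalemxAl -scalerDr ZB.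
  by rewrite scaler0.
have pB t : (p t)^T *m B = B *m m t.
  rewrite linearD /= trmx1 linearZ /= mulmxDl mulmxDr mul1mx mulmx1 -scalemxAl WB.
  by rewrite -scalemxAr mulmxN.
have mB t : (m t)^T *m B = B *m p t.
  rewrite linearD /= trmx1 linearZ /= linearN /= mulmxDl mulmxDr mul1mx mulmx1 -scalemxAl.
  by rewrite mulNmx WB opprK -scalemxAr.
have mp t : m t *m p t = p t *m m t.
  have -> : m t = (1%:M + 1%:M) - p t by rewrite /m /p opprD addrA addrK scalerN.
  by move: (p t) => P; rewrite mulmxBl mulmxBr mulmxDl mulmxDr !mul1mx !mulmx1.
(* The transpose of [m t] is conjugate to [p t] by [B], so both have the same determinant and the
   Cayley transform has determinant 1. *)
have dmp t : \det (m t) = \det (p t).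
  have := congr1 determinant (mB t); rewrite !det_mulmx det_tr mulrC.
  by move: Bu; rewrite unitmxE => /mulrI; apply.
pose c t := invmx (m t) *m p t.
have sc : sfam U c by exact: sfam_mul.
exists U, c; split=> //.
- move=> t Ut; have mt := mu t Ut.
  have pt : p t \in unitmx by rewrite unitmxE -dmp -unitmxE.
  split; last first.
    by rewrite det_mulmx det_inv dmp mulVr // -unitmxE.
  split; first by rewrite unitmx_mul unitmx_inv mt.
  have cE : c t = p t *m invmx (m t).
    by apply: (canRL (mulmxK mt)); rewrite /c -mulmxA -mp mulKmx.
  have iB : (invmx (m t))^T *m B = B *m invmx (p t).
    by rewrite -[LHS](mulmxK pt) -(mulmxA _ B) -mB mulmxA -trmx_mul mulmxV // trmx1 mul1mx.
  rewrite {2}cE /c trmx_mul -(mulmxA (p t)^T) iB mulmxA pB -mulmxA -(mulmxA B).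
  by rewrite -mulmxA mulKmx // mulmxV // mulmx1.
- by rewrite /c m0 p0 invmx1 mulmx1.
(* Differentiating p = m c at 0 gives W = - W + c', so the velocity is 2W; this explains the factor
   1/2 in [W]. *)
- have /(vel_eq U00 spU) : forall t, U t -> p t = m t *m c t.
    by move=> t Ut; rewrite mulKVmx // mu.
  rewrite (velM U00 smU sc) !vel_line m0 mul1mx /c m0 p0 invmx1 !mulmx1 => /eqP.
  rewrite addrC -subr_eq opprK eq_sym => /eqP ->.
  by rewrite WE -scalerDl addr_half scale1r.
Qed.

End LieAlgebras.

(** * The isotropy representation *)

Section IsotropyRepresentation.
Variable R : realType.

Lemma lie_coset_eq n (p : set 'M[R]_n) X Y : p 0 ->
  (forall X Y, p X -> p Y -> p (X - Y)) ->
  lie_coset p X = lie_coset p Y <-> p (X - Y).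
Proof.
move=> p0 pB; split=> [XY|pXY].
  have : lie_coset p X X by rewrite /lie_coset /= subrr.
  by rewrite XY.
apply/seteqP; split=> Z /= pZ.
  have -> : lie_coset p Y Z = p (Z - X - (0 - (X - Y))).
    by rewrite sub0r opprK addrA subrK.
  by apply: (pB) => //; exact: pB.
have -> : lie_coset p X Z = p (Z - Y - (X - Y)) by rewrite opprB addrA subrK.
exact: pB.
Qed.

(** The iterated quotient is g/(p + h). A linear map [sigma] on g with kernel p + h therefore
    descends to it injectively, and [F] evaluates [sigma] on any representative. *)
Lemma isotropy_rep_iso_intro n k (g p h Q : set 'M[R]_n) (rho : 'M[R]_n -> 'M[R]_k)
    (sigma : {linear 'M[R]_n -> 'M[R]_k}) :
  p 0 -> (forall X Y, p X -> p Y -> p (X - Y)) ->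
  h 0 -> (forall X Y, h X -> h Y -> h (X - Y)) ->
  (forall (a : R) X Y, g X -> g Y -> g (a *: X + Y)) ->
  (forall X, p X -> sigma X = 0) -> (forall X, h X -> sigma X = 0) ->
  (forall X, g X -> sigma X = 0 -> exists2 Z, h Z & p (X - Z)) ->
  (forall X, g X -> S2dual (sigma X)) ->
  (forall S, S2dual S -> exists2 X, g X & sigma X = S) ->
  (forall x X, Q x -> g X -> g (Ad x X) /\ sigma (Ad x X) = S2dual_act (rho x) (sigma X)) ->
  exists F, isotropy_rep_iso g p h Q rho F.
Proof.
move=> p0 pB h0 hB glin sp sh ker sS surj equi.
have cosetP X Y := lie_coset_eq X Y p0 pB.
pose cl := lie_class g p h.
have clE X Y : g X -> g Y -> cl X = cl Y <-> sigma X = sigma Y.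
  move=> gX gY; split=> [XY|XY].
    have : cl X (lie_coset p X) by exists X; split=> //; exists 0; rewrite ?subrr.
    rewrite XY => -[Y' [_ /cosetP/sp e1 [Z hZ /cosetP/sp]]].
    move: e1; rewrite !linearB (sh Z hZ) subr0 => /eqP; rewrite subr_eq0 => /eqP ->.
    by move=> /eqP; rewrite subr_eq0 => /eqP.
  have sub X1 Y1 : g X1 -> g Y1 -> sigma X1 = sigma Y1 -> cl X1 `<=` cl Y1.
    move=> gX1 gY1 e1; have gD : g (X1 - Y1).
      by rewrite addrC -scaleN1r; exact: glin.
    have [|Z0 hZ0 pZ0] := ker _ gD; first by rewrite linearB e1 subrr.
    move=> c [Y' [gY' -> [Z hZ /cosetP pZ]]]; exists Y'; split=> //.
    exists (Z - (0 - Z0)); first by apply: (hB) => //; exact: hB.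
    apply/cosetP.
    rewrite (_ : _ - _ = (Y' - X1 - Z) - (0 - (X1 - Y1 - Z0))).
      by apply: (pB) => //; exact: pB.
    by apply/matrixP => i j; rewrite !mxE; ring.
  by apply/seteqP; split; apply: sub.
pose F c := sigma (xget 0 [set X | g X /\ cl X = c]).
have FE X : g X -> F (cl X) = sigma X.
  move=> gX; rewrite /F; case: xgetP => [Y _ [gY YX]|/(_ X)[]]; last by split.
  exact/clE.
exists F; split.
- by move=> X gX; rewrite FE //; exact: sS.
- move=> a X Y gX gY; rewrite !FE //; last exact: glin.
  by rewrite linearP.
- by move=> X Y gX gY; rewrite !FE // => /clE; apply.
- by move=> S /surj[X gX <-]; exists X => //; exact: FE.
- move=> x X Qx gX; have [gx e] := equi x X Qx gX.
  by rewrite !FE.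
Qed.

Section Fixed.
Variables (n r s k r' s' : nat) (B : 'M[R]_n).
Hypotheses (sB : B^T = B) (Bu : B \in unitmx).

Local Notation J2 := (Jform R r s).
Local Notation J3 := (Jform R r' s').
Local Notation J := (Jform_sum R r s r' s').

Variable W : {vspace 'cV[R]_n}.
Hypothesis i0 : (0 < r + s + k)%N.

Let Q := SOset B `&` (@SLset R n `&` [set g | gact g W = W]).

Variables (E2 : 'M[R]_(n, r + s)) (E1 : 'M[R]_(n, k)) (E3 : 'M[R]_(n, r' + s'))
  (E4 : 'M[R]_(n, k)).
Hypotheses (aF : adapted r s B J3 E2 E1 E3 E4) (EW : W = colspan (row_mx E2 E1)).

Local Notation E' := (row_mx E2 E3).

Lemma stab_radical x : Q x -> gact x (colspan E1) = colspan E1.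
Proof.
move=> [[Ox _] [_ xW]]; rewrite -(adapted_radical sB aF) -EW.
by rewrite -radical_gact // xW.
Qed.

(** [E1] and [E3] span the orthogonal of [W], so this says that the double orthogonal of [W] is
    [W]. *)
Lemma colspan_perp_radical l (X : 'M[R]_(n, l)) :
  gram B E1 X = 0 -> gram B E3 X = 0 -> exists Z, X = row_mx E2 E1 *m Z.
Proof.
move=> e1 e3; have hF := adapted_hyperbolic aF.
have JJ := Jform_sum_sqr R r s r' s'.
exists (col_mx (J2 *m gram B E2 X) (gram B E4 X)).
rewrite [LHS](frame_decomp sB JJ hF) e1 mulmx0 addr0.
rewrite gram_rowl e3 /Jform_sum mul_block_col !mul0mx mulmx0 !addr0 !mul_row_col.
by rewrite mulmx0 addr0 addrC.
Qed.

(** Restriction to the radical of the derivative of b(exp(tX) -, exp(tX) -) at t = 0. *)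
Definition form_variation (X : 'M[R]_n) : 'M[R]_k := E1^T *m (X^T *m B + B *m X) *m E1.

Lemma form_variation_is_linear : linear form_variation.
Proof.
move=> a X Y; rewrite /form_variation linearP /= scalemxAl scalemxAr -mulmxDl -mulmxDr.
congr (_ *m _ *m _); rewrite mulmxDl mulmxDr -scalemxAl -scalemxAr scalerDr.
by rewrite addrACA.
Qed.
HB.instance Definition _ := GRing.isLinear.Build R 'M[R]_n 'M[R]_k _ form_variation form_variation_is_linear.

Lemma form_variationE X : form_variation X = gram B E1 (X *m E1) + (gram B E1 (X *m E1))^T.
Proof.
by rewrite /form_variation mulmxDr mulmxDl addrC /gram !trmx_mul trmxK sB !mulmxA.
Qed.

Let g := lie_alg (@SLset R n).
Let p := lie_alg (@SLset R n `&` [set g | gact g W = W]).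
Let h := lie_alg (SOset B).

Let n0 : (0 < n)%N. Proof. by move: i0 (aF.1); clear; lia. Qed.

Let rA : \rank (row_mx E2 E1) = (r + s + k)%N. Proof. exact: adapted_rank aF. Qed.

Let pP X : p X <-> ddet X = 0 /\ exists Z, X *m row_mx E2 E1 = row_mx E2 E1 *m Z.
Proof. by rewrite /p EW; exact: lie_alg_stab (Ordinal i0) X rA. Qed.

Let gP X : g X <-> ddet X = 0. Proof. exact: lie_alg_SL. Qed.
Let hP X : h X <-> X^T *m B + B *m X = 0. Proof. exact: lie_alg_SO. Qed.

Lemma form_variation_kernel D : ddet D = 0 -> form_variation D = 0 -> exists2 Z, h Z & p (D - Z).
Proof.
move=> dD sD.
have [[h22 h21 h23 h24] [h12 h11 h13 h14] [h32 h31 h33 h34] [h42 h41 h43 h44]] :=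
  stdform_gram aF.2.
have J22 := Jform_sqr R r s; have J33 := Jform_sqr R r' s'.
(* [Z = (N - N^T) B] lies in the Lie algebra of the orthogonal group; [N] is chosen so
   that [D - Z] has no component from W to the dual of W^perp. *)
pose N := E4 *m (2^-1 *: gram B E1 (D *m E1)) *m E4^T
  + E4 *m (gram B E1 (D *m E2) *m J2) *m E2^T
  + E3 *m (J3 *m gram B E3 (D *m E2) *m J2) *m E2^T
  + E3 *m (J3 *m gram B E3 (D *m E1)) *m E4^T.
have gN a b (X : 'M[R]_(n, a)) (Y : 'M[R]_(n, b)) : gram B X (N *m B *m Y) =
    gram B X E4 *m (2^-1 *: gram B E1 (D *m E1)) *m gram B E4 Y
  + gram B X E4 *m (gram B E1 (D *m E2) *m J2) *m gram B E2 Y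
  + gram B X E3 *m (J3 *m gram B E3 (D *m E2) *m J2) *m gram B E2 Y
  + gram B X E3 *m (J3 *m gram B E3 (D *m E1)) *m gram B E4 Y.
  by rewrite /N !mulmxDl !gramDr /gram !mulmxA.
have gNT a b (X : 'M[R]_(n, a)) (Y : 'M[R]_(n, b)) :
    gram B X (N^T *m B *m Y) = (gram B Y (N *m B *m X))^T.
  by rewrite gram_tr // /gram !trmx_mul sB !mulmxA.
pose Z := (N - N^T) *m B.
have hZ : h Z.
  apply/hP; rewrite /Z trmx_mul sB linearB /= trmxK -mulmxA -mulmxDr -mulmxDl.
  by rewrite addrA subrK subrr mul0mx mulmx0.
have gZ a b (X : 'M[R]_(n, a)) (Y : 'M[R]_(n, b)) : gram B X ((D - Z) *m Y) =
    gram B X (D *m Y) - gram B X (N *m B *m Y) + (gram B Y (N *m B *m X))^T.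
  by rewrite -gNT mulmxBl gramDr gramNr /Z !mulmxBl gramDr gramNr opprB addrA addrAC.
exists Z => //; apply/pP; split.
  rewrite linearB /= dD [ddet Z](_ : _ = 0) ?subrr //.
  by apply/gP; apply: lie_alg_sub hZ => x [].
(* The hypothesis on [D] says that its component from N to the dual of N is skew; half of it in [N]
   and half in the transpose then cancel it exactly. *)
have sk : (gram B E1 (D *m E1))^T = - gram B E1 (D *m E1).
  by apply/eqP; rewrite -addr_eq0 addrC -form_variationE sD.
have [Z1 e1] : exists Z', (D - Z) *m E2 = row_mx E2 E1 *m Z'.
  apply: colspan_perp_radical; rewrite gZ !gN.
    rewrite h14 h13 h22 h42 h23 h24 !mul0mx !mulmx0 !addr0 add0r !mul1mx -mulmxA J22.
    by rewrite mulmx1 trmx0 addr0 subrr.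
  rewrite h34 h33 h22 h42 h24 h23 !mul0mx !mulmx0 !addr0 !add0r.
  move: (gram B E3 (D *m E2)) => T.
  by rewrite -!mulmxA J22 mulmx1 (mulmxA J3) J33 mul1mx trmx0 addr0 subrr.
have [Z2 e2] : exists Z', (D - Z) *m E1 = row_mx E2 E1 *m Z'.
  apply: colspan_perp_radical; rewrite gZ !gN.
    rewrite h14 h13 h21 h41 !mul0mx !mulmx0 !addr0 !mul1mx !mulmx1.
    rewrite [(_ *: _)^T]linearZ /= sk scalerN -addrA -opprD -scalerDl addr_half.
    by rewrite scale1r subrr.
  rewrite h34 h33 h21 h41 h14 h13 h43 h23 !mul0mx !mulmx0 !addr0 !add0r !mulmx1.
  move: (gram B E3 (D *m E1)) => T.
  by rewrite !mulmxA J33 mul1mx trmx0 addr0 subrr.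
by exists (row_mx Z1 Z2); rewrite !mul_mx_row e1 e2.
Qed.

Lemma form_variation_iso : exists F, isotropy_rep_iso g p h Q (alpha B E1 E4) F.
Proof.
have [[h22 h21 h23 h24] [h12 h11 h13 h14] [h32 h31 h33 h34] [h42 h41 h43 h44]] :=
  stdform_gram aF.2.
apply: (isotropy_rep_iso_intro (sigma := form_variation)).
- by apply/pP; split; [rewrite linear0|exists 0; rewrite mul0mx mulmx0].
- move=> X Y /pP[dX [Z XZ]] /pP[dY [T YT]]; apply/pP.
  by rewrite linearB /= dX dY subrr; split=> //; exists (Z - T); rewrite mulmxBl mulmxBr XZ YT.
- by apply/hP; rewrite linear0 mul0mx mulmx0 addr0.
- move=> X Y /hP hX /hP hY; apply/hP.
  by rewrite linearB /= mulmxBl mulmxBr addrACA hX -opprD hY subrr.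
- by move=> a X Y /gP dX /gP dY; apply/gP; rewrite linearP /= dX dY mulr0 addr0.
- move=> X /pP[_ [Z XZ]]; rewrite /= form_variationE.
  have -> : X *m E1 = row_mx E2 E1 *m (Z *m col_mx 0 1%:M).
    by rewrite mulmxA -XZ -mulmxA mul_row_col mulmx0 add0r mulmx1.
  by rewrite gramMr gram_rowr h12 h11 row_mx0 mul0mx trmx0 addr0.
- by move=> X /hP hX; rewrite /= /form_variation hX mulmx0 mul0mx.
- by move=> X /gP dX /=; exact: form_variation_kernel.
- by move=> X _; rewrite /S2dual /= form_variationE linearD /= trmxK addrC.
(* This matrix sends [E1] to [E4 *m (2^-1 *: S)]. Its square is 0 since [E4] is isotropic, which
   puts it in the Lie algebra of SL. *)
- move=> S SS; exists ((E4 *m (2^-1 *: S)) *m (E4^T *m B)).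
    apply/gP; apply: ddet_mul; rewrite mulmxA -/(gram B E4 E4) h44 mul0mx //.
  rewrite /= form_variationE -[_ *m _ *m E1]mulmxA -/(gram B E4 E1) h41 mulmx1 gramMr h14 mul1mx.
  by rewrite linearZ /= SS -scalerDl addr_half scale1r.
- move=> x X Qx gX; have xN := stab_radical Qx; have [[[xu xB] dx] _] := Qx.
  have hF := adapted_hyperbolic aF; have au := alpha_unit sB hF xN; have xE := stab_E1 sB hF xN.
  split.
    apply: lie_alg_Ad gX => // y; rewrite /SLset /= !det_mulmx => ->.
    by rewrite mulr1 -det_mulmx mulmxV // det1.
  have ixE : invmx x *m E1 = E1 *m invmx (alpha B E1 E4 x).
    by apply: (canLR (mulKmx xu)); rewrite mulmxA xE mulmxK.
  have E1x : E1 = x *m (E1 *m invmx (alpha B E1 E4 x)) by rewrite mulmxA xE mulmxK.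
  rewrite /S2dual_act /= !form_variationE /Ad -[_ *m _ *m E1]mulmxA ixE.
  have -> : gram B E1 (x *m X *m (E1 *m invmx (alpha B E1 E4 x))) =
      (invmx (alpha B E1 E4 x))^T *m gram B E1 (X *m E1) *m invmx (alpha B E1 E4 x).
    rewrite {1}E1x -!mulmxA gram_act // gramMl.
    by rewrite /gram !mulmxA.
  move: (gram B E1 (X *m E1)) (invmx _) => T a.
  by rewrite mulmxDr mulmxDl !trmx_mul trmxK !mulmxA.
Qed.

End Fixed.
End IsotropyRepresentation.

(** * The quotient homomorphism of the stabilizer *)

Section StabilizerQuotient.
Variable R : realType.

Section Fixed.
Variables (n r s k r' s' : nat) (B : 'M[R]_n).
Hypotheses (sB : B^T = B) (Bu : B \in unitmx)
  (Bsig : has_signature B fullv (r + k + r') (s + k + s')).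

Local Notation Orb := (orbit_sig B (r + s + k) r s).
Local Notation J2 := (Jform R r s).
Local Notation J3 := (Jform R r' s').
Local Notation J := (Jform_sum R r s r' s').

Let JJ := Jform_sum_sqr R r s r' s'.

Section Frame.
Variable W : {vspace 'cV[R]_n}.
Variables (E2 : 'M[R]_(n, r + s)) (E1 : 'M[R]_(n, k)) (E3 : 'M[R]_(n, r' + s'))
  (E4 : 'M[R]_(n, k)).
Hypotheses (aF : adapted r s B J3 E2 E1 E3 E4) (EW : W = colspan (row_mx E2 E1)).
Local Notation E' := (row_mx E2 E3).

Lemma adapted_frameP : adapted_frame B W J2 J3 E1 E2 E3.
Proof.
have [[h22 h21 h23 h24] [h12 h11 h13 h14] [h32 h31 h33 h34] [h42 h41 h43 h44]] :=
  stdform_gram aF.2.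
have hF := adapted_hyperbolic aF.
split=> //.
- move=> x; rewrite -(adapted_radical sB aF) -EW.
  exact: radical_colspan_exists.
- rewrite EW; apply: (colspan_eq (Z := block_mx 0 1%:M 1%:M 0) (T := block_mx 0 1%:M 1%:M 0));
    by rewrite mul_row_block !mulmx0 !mulmx1 !addr0 !add0r.
- move=> x; rewrite EW perp_colspan; split.
    move=> /colspan_row_mx_mem[y [z ->]].
    by rewrite gram_rowl !gramDr !gramMr h21 h23 h11 h13 !mul0mx !addr0 col_mx0.
  rewrite gram_rowl -[0]vsubmxK => /eq_col_mx[]; rewrite !linear0 => e2 e1.
  apply/colspan_row_mx_mem; exists (gram B E4 x), (J3 *m gram B E3 x).
  rewrite {1}(frame_decomp sB JJ hF x) e1 mulmx0 addr0.
  by rewrite gram_rowl e2 /Jform_sum mul_block_col !mul0mx mulmx0 !add0r mul_row_col mulmx0 add0r.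
Qed.

Let Q := SOset B `&` (@SLset R n `&` [set g | gact g W = W]).

Lemma fib1 : fib E1 E' (lsubmx 1%:M) = W.
Proof.
rewrite EW /fib scalar_mx_block block_mxEh row_mxKl mul_row_col mulmx1 mulmx0 addr0.
by [].
Qed.

(** [W] is the fiber point of the identity matrix, so preserving [W] means that [theta x] fixes the
    base coset; by [fib_coset] it is then block diagonal. *)
Lemma theta_block x : Q x -> exists A2 A3,
  [/\ Oset J2 A2, Oset J3 A3, \det A2 * \det A3 = 1 & theta B J E' x = block_mx A2 0 0 A3].
Proof.
move=> Qx; have xN := stab_radical sB aF EW Qx; have [[Ox dx] [_ xW]] := Qx.
have hF := adapted_hyperbolic aF.
have Ot := theta_Oset sB JJ hF Ox xN.
have dt := theta_det sB JJ hF Ox xN.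
have := fib_equivariant sB hF 1%:M Ox xN.
rewrite mulmx1 fib1 xW -[in LHS]fib1 => /esym.
move=> /(fib_coset sB hF Ot (Oset1 J))[A2 [A3 [P2 P3 E]]].
exists A2, A3; rewrite mul1mx in E; split=> //.
by rewrite -dx -dt E det_ublock.
Qed.

Lemma stab_lift_block A A2 A3 : A \in unitmx -> Oset J2 A2 -> Oset J3 A3 ->
  \det A2 * \det A3 = 1 -> Q (stab_lift B J E1 E' E4 A (block_mx A2 0 0 A3)).
Proof.
move=> Au O2 O3 d1.
have hF := adapted_hyperbolic aF.
have Og := Oset_block O2 O3.
have Ol := stab_lift_Oset sB JJ hF Au Og.
have lN := stab_lift_stab sB JJ hF (block_mx A2 0 0 A3) Au.
have dl : \det (stab_lift B J E1 E' E4 A (block_mx A2 0 0 A3)) = 1.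
  by rewrite -(theta_det sB JJ hF Ol lN) stab_lift_theta // det_ublock.
split=> //; split=> //=; rewrite -fib1.
rewrite (fib_equivariant sB hF 1%:M Ol lN) stab_lift_theta //.
apply/(fib_coset sB hF) => //; last by exists A2, A3; rewrite mul1mx mulmx1.
- by rewrite mulmx1.
- exact: Oset1.
Qed.

End Frame.

Lemma stabilizer_quotient W : Orb W -> (0 < r + s + k)%N ->
  let P := @SLset R n `&` [set g | gact g W = W] in
  let Q := SOset B `&` P in
  exists rho : 'M[R]_n -> 'M[R]_k * ('M[R]_(r + s) * 'M[R]_(r' + s')),
    [/\ forall x, Q x -> @GLset R k (rho x).1 /\ S_OO J2 J3 (rho x).2,
        forall x y, Q x -> Q y ->
          [/\ (rho (x *m y)).1 = (rho x).1 *m (rho y).1,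
              (rho (x *m y)).2.1 = (rho x).2.1 *m (rho y).2.1
            & (rho (x *m y)).2.2 = (rho x).2.2 *m (rho y).2.2],
        forall A D, @GLset R k A -> S_OO J2 J3 D -> exists2 x, Q x & rho x = (A, D),
        exists (E1 : 'M[R]_(n, k)) (E2 : 'M[R]_(n, r + s)) (E3 : 'M[R]_(n, r' + s')),
          adapted_frame B W J2 J3 E1 E2 E3 /\
          forall x, Q x -> induced_matrices E1 E2 E3 x
            (rho x).1 (rho x).2.1 (rho x).2.2
      & exists F, isotropy_rep_iso (lie_alg (@SLset R n)) (lie_alg P)
          (lie_alg (SOset B)) Q (fun x => (rho x).1) F].
Proof.
move=> OW i0 P Q; have [E2 [E1 [E3 [E4 [aF EW]]]]] := adapted_orbit sB Bu Bsig OW.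
have hF := adapted_hyperbolic aF.
pose E' := row_mx E2 E3; pose t := theta B J E'.
exists (fun x => (alpha B E1 E4 x, (ulsubmx (t x), drsubmx (t x)))); split=> /=.
- move=> x Qx; have xN := stab_radical sB aF EW Qx.
  split; first exact: (alpha_unit sB hF xN).
  have [A2 [A3 [P2 P3 d1 E]]] := theta_block aF EW Qx.
  by rewrite /t E block_mxKul block_mxKdr.
- move=> x y Qx Qy; have xN := stab_radical sB aF EW Qx; have yN := stab_radical sB aF EW Qy.
  have [[Oy _] _] := Qy.
  have [A2 [A3 [_ _ _ Ex]]] := theta_block aF EW Qx.
  have [C2 [C3 [_ _ _ Ey]]] := theta_block aF EW Qy.
  rewrite (alpha_mul sB hF xN yN) /t.
  rewrite (theta_mul sB JJ hF xN Oy yN) Ex Ey mulmx_block.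
  by rewrite !block_mxKul !block_mxKdr !mul0mx addr0 add0r.
- move=> A [A2 A3] Au [/= P2 P3 d1].
  exists (stab_lift B J E1 E' E4 A (block_mx A2 0 0 A3)).
    exact: (stab_lift_block aF EW).
  by rewrite /t stab_lift_theta // stab_lift_alpha // block_mxKul block_mxKdr.
- exists E1, E2, E3; split; first exact: adapted_frameP aF EW.
  move=> x Qx; have xN := stab_radical sB aF EW Qx; have [[Ox _] _] := Qx.
  have [A2 [A3 [_ _ _ Ex]]] := theta_block aF EW Qx.
  have := stab_E' sB JJ hF Ox xN.
  rewrite /t Ex block_mxKul block_mxKdr; move: (gram B E4 _) => Z.
  rewrite -[Z]hsubmxK !mul_mx_row mul_row_block !mulmx0 addr0 add0r add_row_mx.
  move=> /eq_row_mx[x2 x3]; split; first exact: (stab_E1 sB hF xN).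
    by apply/colspan_sub; exists (lsubmx Z); rewrite x2 addrK.
  by apply/colspan_sub; exists (rsubmx Z); rewrite x3 addrK.
- exact: (form_variation_iso sB Bu i0 aF EW).
Qed.

End Fixed.
End StabilizerQuotient.

(** * Moving the coordinate subspace and conjugating the group *)

Section CoordinateSubspace.
Variable R : realType.

Lemma dim_coord_sub i n : (i <= n)%N -> \dim (coord_sub R i n) = i.
Proof.
move=> lein; pose C : 'M[R]_(n, i) := \matrix_(a, b) ((a : nat) == b)%:R.
have CC : C^T *m C = 1%:M.
  apply/matrixP => a b; rewrite !mxE (bigD1 (widen_ord lein a)) //= !mxE eqxx mul1r.
  rewrite big1 ?addr0 // => c ca; rewrite !mxE; case: eqP => [e|]; rewrite ?mul0r //.
  by case/eqP: ca; apply: val_inj.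
have CE j : C *m delta_mx j 0 = delta_mx (widen_ord lein j) 0 :> 'cV[R]_n.
  apply/colP => a; rewrite mxE (bigD1 j) //= big1 ?addr0 => [|b bj].
    by rewrite !mxE eqxx mulr1 andbT.
  by rewrite !mxE (negPf bj) mulr0.
have -> : coord_sub R i n = colspan C; last by apply/dim_colspan/rank_linvP; exists C^T.
apply/eqP; rewrite eqEsubv; apply/andP; split.
  apply/span_subvP => v /mapP[j + ->]; rewrite mem_filter => /andP[ji _].
  apply/mem_colspan; exists (delta_mx (Ordinal ji) 0); rewrite CE.
  by congr delta_mx; apply: val_inj.
apply/subvP => _ /mem_colspan[z ->].
have -> : z = \sum_j z j 0 *: delta_mx j 0.
  by rewrite {1}[z]matrix_sum_delta; apply: eq_bigr => j _; rewrite big_ord1.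
rewrite mulmx_sumr; apply: memv_suml => j _; rewrite -scalemxAr CE; apply: memvZ.
apply/memv_span/mapP; exists (widen_ord lein j) => //.
by rewrite mem_filter mem_enum /= ltn_ord.
Qed.

(** A linear map matching completed bases has some determinant; rescaling one basis vector of [W]
    corrects it to 1 without changing the image. The hypothesis [0 < i] provides that vector. *)
Lemma SL_transitive n i (W W' : {vspace 'cV[R]_n}) : (0 < i)%N ->
  \dim W = i -> \dim W' = i -> exists2 k, @SLset R n k & gact k W' = W.
Proof.
case: i => // i _ /colspan_exists[A rA <-] /colspan_exists[A' rA' <-].
have [l [C [il rAC]]] := complete_cols rA.
have [l' [C' [il' rAC']]] := complete_cols rA'.
have El : l' = l by move: il il'; clear; lia.
subst l'; have [F' F'F FF'] := rank_rinv il rAC.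
have [G' G'G GG'] := rank_rinv il rAC'.
pose k0 := row_mx A C *m G'.
have k0u : k0 \in unitmx.
  have : k0 *m (row_mx A' C' *m F') = 1%:M by rewrite mulmxA -(mulmxA _ G') G'G mulmx1.
  by move=> /mulmx1_unit[].
pose e : 'rV[R]_i.+1 := \row_j (if j == 0 then (\det k0)^-1 else 1).
have de : \det (diag_mx e) = (\det k0)^-1.
  by rewrite det_diag (bigD1 0) //= mxE big1 ?mulr1 // => j /negPf j0; rewrite mxE j0.
pose D := block_mx (diag_mx e) 0 0 (1%:M : 'M[R]_l).
have d0 : \det k0 != 0 by rewrite -unitfE -unitmxE.
exists (row_mx A C *m D *m G').
  rewrite /SLset /= -(mulmx1 (_ *m D *m G')) -FF'.
  have -> : row_mx A C *m D *m G' *m (row_mx A C *m F') =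
     row_mx A C *m (D *m (G' *m row_mx A C)) *m F' by rewrite !mulmxA.
  rewrite -(rect_det _ il F'F) -!mulmxA F'F mulmx1 !mulmxA F'F mul1mx.
  rewrite -mulmxA det_mulmx det_ublock de det1 mulr1.
  have -> : \det (G' *m row_mx A C) = \det k0.
    rewrite -(rect_det k0 il G'G) /k0 -!mulmxA G'G mulmx1 //.
  by rewrite mulVf.
have GA' : G' *m A' = col_mx 1%:M 0.
  have := G'G; rewrite mul_mx_row scalar_mx_block block_mxEh.
  by move=> /eq_row_mx[].
rewrite gact_colspan -!mulmxA GA' mul_block_col !mul0mx !mulmx0 !addr0 mulmx1 mul_row_col.
rewrite mulmx0 addr0 colspan_mulr // unitmxE de unitrV unitfE //.
Qed.

Lemma has_signature_gact n (B k : 'M[R]_n) W r s : B^T = B -> k \in unitmx ->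
  has_signature B (gact k W) r s -> has_signature (k^T *m B *m k) W r s.
Proof.
move=> sB ku sig.
have [c [X [Y [Z [_ E rk [XX YY ZZ XY [XZ YZ]]]]]]] := signature_cols sB sig.
have gk a b (X1 : 'M[R]_(n, a)) (X2 : 'M[R]_(n, b)) :
    gram (k^T *m B *m k) (invmx k *m X1) (invmx k *m X2) = gram B X1 X2.
  rewrite /gram trmx_mul !mulmxA -(mulmxA _ _ k^T) -trmx_mul mulmxV // trmx1 mulmx1.
  by rewrite -(mulmxA _ k) mulmxV // mulmx1.
have -> : W = colspan (row_mx (row_mx (invmx k *m X) (invmx k *m Y)) (invmx k *m Z)).
  by rewrite -!mul_mx_row -gact_colspan E -gact_mul mulVmx // gact1.
apply: has_signature_cols; rewrite ?gk //.
  by rewrite !trmx_mul trmxK sB mulmxA.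
rewrite -!mul_mx_row; apply: rank_mulmx_full => //.
by apply: mxrank_unit; rewrite unitmx_inv.
Qed.

(** Conjugating the group amounts to pulling back the form, so part (3) becomes a statement about
    the stabilizer of a subspace for the form k^T B k. *)
Lemma conj_set_SOset n (B k : 'M[R]_n) : k \in unitmx ->
  conj_set k (SOset B) = SOset (k^T *m B *m k).
Proof.
move=> ku.
have conjP (l C h : 'M[R]_n) : l \in unitmx -> SOset C h ->
    SOset (l^T *m C *m l) (invmx l *m h *m l).
  move=> lu [[hu hC] dh]; split; last first.
    by rewrite !det_mulmx det_inv mulrAC mulVr -?unitmxE // mul1r.
  split; first by rewrite !unitmx_mul unitmx_inv lu hu.
  have e : l *m (invmx l *m h *m l) = h *m l by rewrite !mulmxA mulmxV // mul1mx.
  have -> : (invmx l *m h *m l)^T *m (l^T *m C *m l) *m (invmx l *m h *m l) =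
      (l *m (invmx l *m h *m l))^T *m C *m (l *m (invmx l *m h *m l)).
    by rewrite (trmx_mul l) !mulmxA.
  by rewrite e -[in RHS]hC trmx_mul !mulmxA.
apply/seteqP; split=> [_ [h Hh <-]|h Hh]; first exact: conjP.
have iku : invmx k \in unitmx by rewrite unitmx_inv.
have := conjP (invmx k) _ h iku Hh; rewrite invmxK => H.
exists (k *m h *m invmx k); last by rewrite !mulmxA mulVmx // mul1mx mulmxKV.
suff -> : B = (invmx k)^T *m (k^T *m B *m k) *m invmx k by [].
by rewrite !mulmxA -trmx_mul mulmxV // trmx1 mul1mx mulmxK.
Qed.

End CoordinateSubspace.

Theorem proposition3p1 (R : realType) (p q i r s : nat) (B : 'M[R]_(p + q))
    (hi1 : (1 <= i)%N) (hi2 : (i <= (p + q) - 1)%N)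
    (Bsym : B^T = B) (Bnondeg : B \in unitmx)
    (Bsig : has_signature B fullv p q)
    (hr : (r <= p)%N) (hs : (s <= q)%N) (hrs : (r + s <= i)%N) :
  let n := (p + q)%N in
  let nu := (i - r - s)%N in
  let rh := (p - r - nu)%N in
  let sh := (q - s - nu)%N in
  let G := @SLset R n in
  let H := SOset B in
  let O := orbit_sig B i r s in
  let IGr := isotropic_sub B nu in
  (* (1) *)
  [/\ ((exists W, O W) <->
         [/\ (nu <= minn p q)%N, (r + nu <= p)%N & (s + nu <= q)%N]) /\
      ((exists W, O W) ->
         embedded_codim (Gr R i n) O (nu * (nu + 1) %/ 2)%N),
  (* (2) *)
      (exists W, O W) ->
      let SOr := SOset (Jform_sum R r s rh sh) in
      let K := S_OO_block (Jform R r s) (Jform R rh sh) in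
      exists Phi : {vspace 'cV[R]_n} -> {vspace 'cV[R]_n},
        [/\ submersion (sub_space (Gr R i n) O)
              (sub_space (Gr R nu n) IGr) Phi,
            forall N, IGr N -> exists2 W, O W & Phi W = N,
            forall h W, H h -> O W -> Phi (gact h W) = gact h (Phi W)
          & forall N, IGr N ->
            let HN := H `&` [set h | gact h N = N] in
            exists (theta : 'M[R]_n -> 'M[R]_((r + s) + (rh + sh)))
              (f : set 'M[R]_((r + s) + (rh + sh)) -> {vspace 'cV[R]_n})
              (f' : {vspace 'cV[R]_n} -> set 'M[R]_((r + s) + (rh + sh))),
              [/\ diffeo (homog_space SOr K)
                    (sub_space (sub_space (Gr R i n) O)
                       [set W | Phi W = N]) f f',
                  smooth_map (sub_space (mx_space R n n) HN)
                    (sub_space (mx_space R _ _) SOr) theta,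
                  forall h1 h2, HN h1 -> HN h2 ->
                    theta (h1 *m h2) = theta h1 *m theta h2,
                  forall g, SOr g -> exists2 h, HN h & theta h = g
                & forall h g, HN h -> SOr g ->
                    f (left_coset K (theta h *m g)) =
                    gact h (f (left_coset K g))]]
  (* (3) *)
    & let Ri := coord_sub R i n in
      let P := G `&` [set g | gact g Ri = Ri] in
      ((exists W, O W) -> exists2 k, G k & O (gact k Ri)) /\
      forall k, G k -> O (gact k Ri) ->
        let HO := conj_set k H in
        let Q := HO `&` P in
        exists rho : 'M[R]_n ->
            'M[R]_nu * ('M[R]_(r + s) * 'M[R]_(rh + sh)),
          [/\ forall x, Q x -> @GLset R nu (rho x).1 /\
                S_OO (Jform R r s) (Jform R rh sh) (rho x).2,
              forall x y, Q x -> Q y ->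
                [/\ (rho (x *m y)).1 = (rho x).1 *m (rho y).1,
                    (rho (x *m y)).2.1 = (rho x).2.1 *m (rho y).2.1
                  & (rho (x *m y)).2.2 = (rho x).2.2 *m (rho y).2.2],
              forall A D, @GLset R nu A ->
                S_OO (Jform R r s) (Jform R rh sh) D ->
                exists2 x, Q x & rho x = (A, D),
              exists (E1 : 'M[R]_(n, nu)) (E2 : 'M[R]_(n, r + s))
                (E3 : 'M[R]_(n, rh + sh)),
                adapted_frame (k^T *m B *m k) Ri
                  (Jform R r s) (Jform R rh sh) E1 E2 E3 /\
                forall x, Q x -> induced_matrices E1 E2 E3 x
                  (rho x).1 (rho x).2.1 (rho x).2.2
            & exists F : set (set 'M[R]_n) -> 'M[R]_nu,
                isotropy_rep_iso (lie_alg G) (lie_alg P) (lie_alg HO) Q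
                  (fun x => (rho x).1) F]].
Proof.
(* With i written as r + s + k, the number nu becomes the variable [k] and its truncated
   subtractions disappear. *)
have [k Ek] : exists k, i = (r + s + k)%N by exists (i - (r + s))%N; rewrite subnKC.
move: Ek => Ei; subst i; rewrite (_ : (r + s + k - r - s)%N = k); last by clear; lia.
move=> n nu rh sh G H O IGr.
(* A nonempty orbit guarantees that [rh] and [sh] are true differences rather than truncated ones;
   every later use of the signature relies on these two equations. *)
have frame : (exists W, O W) ->
    p = (r + k + rh)%N /\ q = (s + k + sh)%N.
  move=> [W [dW sW]].
  have [r' [s' [F [_ _ _ ep eq]]]] := adapted_frame_exists Bsym Bnondeg Bsig dW sW.
  by move: ep eq; rewrite /rh /sh /nu; clear; lia.
have sig : p = (r + k + rh)%N /\ q = (s + k + sh)%N ->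
    has_signature B fullv (r + k + rh) (s + k + sh).
  by move=> [ep eq]; rewrite -ep -eq.
have i0 : (0 < r + s + k)%N := hi1.
have dRi : \dim (coord_sub R (r + s + k) n) = (r + s + k)%N.
  by apply: dim_coord_sub; move: hi2; rewrite /n; clear; lia.
split.
- split=> [|/frame/sig Bs]; last exact: (orbit_embedded Bsym Bnondeg Bs).
  split=> [/frame|[h1 h2 h3]].
    by rewrite /rh /sh /nu; clear=> -[ep eq]; split; lia.
  apply: (signature_subspace_exists (k := k) (r' := rh) (s' := sh) Bsym); apply: sig.
  by move: h1 h2 h3; rewrite /rh /sh /nu; clear; lia.
- move=> /frame/sig Bs SOr K; exists (radical B); split.
  + exact: (radical_submersion Bsym Bnondeg Bs).
  + exact: (radical_surj Bsym Bnondeg Bs).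
  + by move=> h W [Oh _] _; exact: radical_gact.
  + by move=> N IN; exact: (radical_fiber Bsym Bnondeg Bs IN).
- move=> Ri P; split=> [[W OW]|k0 Gk OkRi].
    have [k0 Gk kRi] := SL_transitive i0 OW.1 dRi.
    by exists k0 => //; rewrite kRi.
  have ku : k0 \in unitmx by rewrite unitmxE (Gk : \det k0 = 1) unitr1.
  have Bs : has_signature B (gact k0 fullv) (r + k + rh) (s + k + sh).
    rewrite (_ : gact k0 fullv = fullv); last first.
      by rewrite -colspan1 gact_colspan mulmx1 -[k0]mul1mx colspan_mulr.
    by apply/sig/frame; exists (gact k0 Ri).
  have sB' : (k0^T *m B *m k0)^T = k0^T *m B *m k0 by rewrite !trmx_mul trmxK Bsym mulmxA.
  have Bu' : k0^T *m B *m k0 \in unitmx by rewrite !unitmx_mul unitmx_tr ku Bnondeg.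
  have Bs' := has_signature_gact Bsym ku Bs.
  have ORi : orbit_sig (k0^T *m B *m k0) (r + s + k) r s Ri.
    by split=> //; exact: (has_signature_gact Bsym ku OkRi.2).
  (* The subspace is now the fixed coordinate subspace, and the form k0^T B k0 restricts to it with
     signature [(r, s)]. *)
  move=> HO Q; rewrite /Q /HO /H conj_set_SOset //.
  exact: (stabilizer_quotient sB' Bu' Bs' ORi i0).
Qed.
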